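(* Consider the linear-quadratic control problem described in the context, with the associated HJB equation $$\partial_t \bar V+\inf_{\bar b\in\mathbb{R}}\Bigl\{\alpha_t(m_t-x)\,\partial_X\bar V+\bar b\,\partial_I\bar V+\tfrac12\sigma_t^2\,x(X_{\max}-x)\,\partial_{XX}\bar V+(x-\bar b-M_t)^2+c_1\bar b^2+c_2(\iota-I_m)^2\Bigr\}=0$$ with terminal condition $\bar V(T,x,\iota)=\mathcal{P}(\iota-I_{\text{target}})^2$. Assume that the solution $\bar V$ of this equation is of class $\mathcal{C}^{1,2}([0,T]\times\mathcal{D})$, where $\mathcal{D}=[0,X_{\max}]\times[I_{\min},I_{\max}]$. When the mean-reversion level is constant, $m_t=m$ for all $t\in[0,T]$, the value function is given explicitly by $$\bar V(t,x,\iota)=P_1(t)(\iota-I_m)^2+P_2(t)(\iota-I_m)(x-m)+P_3(t)(x-m)^2+P_4(t)(\iota-I_m)+P_5(t)(x-m)+P_6(t),$$ where, with $\kappa=\frac{1}{1+c_1}$, the functions $P_1,\dots,P_6$ solve the system of backward Riccati ordinary differential equations $$\begin{aligned} &\dot P_1+c_2-\kappa P_1^2=0, && P_1(T)=\mathcal{P},\\ &\dot P_2-\alpha_tP_2-\kappa P_1P_2+2\kappa P_1=0, && P_2(T)=0,\\ &\dot P_3+(1-\kappa)-(2\alpha_t+\sigma_t^2)P_3+\kappa P_2-\tfrac{\kappa}{4}P_2^2=0, && P_3(T)=0,\\ &\dot P_4+2\kappa(m-M_t)P_1-\kappa P_1P_4=0, && P_4(T)=2\mathcal{P}(I_m-I_{\text{target}}),\\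 &\dot P_5+2(1-\kappa)(m-M_t)-\alpha_tP_5+\kappa P_4+\kappa(m-M_t)P_2-\tfrac{\kappa}{2}P_2P_4+(\sigma_t^2X_{\max}-2\sigma_t^2m)P_3=0, && P_5(T)=0,\\ &\dot P_6+(1-\kappa)(m-M_t)^2+\kappa(m-M_t)P_4-\tfrac{\kappa}{4}P_4^2=0, && P_6(T)=\mathcal{P}(I_m-I_{\text{target}})^2. \end{aligned}$$ Moreover, the optimal control (the minimizer in the HJB equation) is of closed-loop feedback form and is given by $$\bar b(t,x,\iota)=\kappa(x-M_t)-\kappa P_1(t)(\iota-I_m)-\tfrac{\kappa}{2}P_2(t)(x-m)-\tfrac{\kappa}{2}P_4(t).$$
   Context: Fix a horizon $T>0$, constants $X_{\max}>0$, $I_{\min}<I_{\max}$, $I_m:=\frac{I_{\max}-I_{\min}}{2}$, a target $I_{\text{target}}\in\mathbb{R}$, penalty constants $c_1,c_2>0$ and $\mathcal{P}>0$, and deterministic functions of time $\alpha_t>0$ (mean-reversion rate), $\sigma_t>0$ (volatility), $m_t\ge 0$ (mean-reversion level) and $M_t$ (dispatch target), $t\in[0,T]$. On a filtered probability space carrying a Wiener process $W$, the exogenous state $X$ (wind power generation), with values in $[0,X_{\max}]$, solves the Jacobi SDE $$dX_t=\alpha_t(m_t-X_t)\,dt+\sigma_t\sqrt{X_t(X_{\max}-X_t)}\,dW_t .$$ The controlled state $I$ (battery state of charge) has dynamics $dI_t=B_t\,dt$, where the control $B$ is an adapted process with values in $\mathbb{R}$; there are no hard constraints on $B$ or $I$.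 The value function is $$\bar V(t,x,\iota)=\inf_{B}\mathbb{E}\Bigl[\int_t^T\bigl\{(X_s-B_s-M_s)^2+c_1B_s^2+c_2(I_s-I_m)^2\bigr\}ds+\mathcal{P}(I_T-I_{\text{target}})^2\Bigr],\qquad X_t=x,\ I_t=\iota.$$ Here $\partial_X,\partial_{XX}$ denote derivatives in $x$, $\partial_I$ the derivative in $\iota$, and a dot denotes $d/dt$; the argument $t$ of the $P_i$ is suppressed in the ODE system.
   Formalization: The printed equation for P_6 omits the term σ_t² m (X_max − m) P_3 on its left-hand side and fails for 0 < m < X_max; the formal statement adds it. The time functions α, σ, m, M are taken continuous on [0,T]. *)

(* Defs.v *)
From HB Require Import structures.
From mathcomp Require Import all_boot all_order all_algebra.
From mathcomp Require Import all_classical all_reals all_analysis.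

Set Implicit Arguments.
Unset Strict Implicit.
Unset Printing Implicit Defensive.

Import Order.TTheory GRing.Theory Num.Theory.
Import numFieldNormedType.Exports.

Local Open Scope classical_set_scope.
Local Open Scope ring_scope.

(** * Derivatives relative to a set *)

Section derivative_within.
Context {R : realType}.
Implicit Types (A : set R) (f : R -> R) (x : R).

(* Two-sided at interior points of [A], one-sided at the endpoints when [A] is
   a segment; the functions below live on closed boxes only. *)
Definition within_quotient A f x : set_system R :=
  (fun h : R => h^-1 * (f (x + h) - f x)) @ within [set h | A (x + h)] 0^'.

Definition derivable_within A f x : Prop := cvg (within_quotient A f x).

Definition deriv_within A f x : R := lim (within_quotient A f x).

End derivative_within.

(** * Stochastic calculus *)

Section stochastic_calculus.
Context {R : realType} {d : measure_display} {Omega : measurableType d}.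
Variable P : probability Omega R.
Implicit Types (F : R -> set (set Omega)) (H W Y : R -> Omega -> R).

Definition filtration (T : R) F : Prop :=
  [/\ forall t : R, t \in `[0, T] -> sigma_algebra setT (F t),
      forall t : R, t \in `[0, T] -> F t `<=` @measurable d Omega
    & forall s t : R, 0 <= s -> s <= t -> t <= T -> F s `<=` F t].

Definition measurable_wrt (G : set (set Omega)) (f : Omega -> R) : Prop :=
  forall S : set R, measurable S -> G (f @^-1` S).

Definition adapted (a b : R) F H : Prop :=
  forall s : R, s \in `[a, b] -> measurable_wrt (F s) (H s).

Definition jointly_measurable (a b : R) H : Prop :=
  measurable_fun ((`[a, b] : set R) `*` [set: Omega])
    (fun p : R * Omega => H p.1 p.2).

(* Wiener process on [0, T] relative to [F]; [normal_prob] takes a standard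
   deviation. *)
Definition wiener (T : R) F W : Prop :=
  [/\ {ae P, forall w, W 0 w = 0},
      {ae P, forall w, {within `[0, T], continuous (W ^~ w)}},
      adapted 0 T F W,
      (forall s t : R, 0 <= s -> s < t -> t <= T ->
         forall S : set R, measurable S ->
         P ((fun w => W t w - W s w) @^-1` S)
         = normal_prob 0 (Num.sqrt (t - s)) S)
    & (forall s t : R, 0 <= s -> s < t -> t <= T ->
         forall (A : set Omega) (S : set R), F s A -> measurable S ->
         P (A `&` (fun w => W t w - W s w) @^-1` S)
         = (P A * P ((fun w => (W t w - W s w)%R) @^-1` S))%E)].

(* The process  \sum_(i < n) xi_i 1_(]tau_i, tau_(i+1)]). *)
Record simple_process := SimpleProcess {
  sp_size : nat;
  sp_time : nat -> R;
  sp_coef : nat -> Omega -> R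
}.

Definition simple_process_on (a b : R) F (h : simple_process) : Prop :=
  [/\ sp_time h 0%N = a, sp_time h (sp_size h) = b,
      forall i, (i < sp_size h)%N -> sp_time h i <= sp_time h i.+1,
      forall i, (i < sp_size h)%N ->
        measurable_wrt (F (sp_time h i)) (sp_coef h i)
    & forall i, (i < sp_size h)%N ->
        exists C : R, forall w, `|sp_coef h i w| <= C].

Definition sp_val (h : simple_process) (s : R) (w : Omega) : R :=
  \sum_(i < sp_size h)
    sp_coef h i w * \1_(`]sp_time h i, sp_time h i.+1] : set R) s.

Definition sp_integral W (h : simple_process) (s : R) (w : Omega) : R :=
  \sum_(i < sp_size h)
    sp_coef h i w * (W (Num.min (sp_time h i.+1) s) w
                     - W (Num.min (sp_time h i) s) w).

(* [Y s] is the Ito integral of [H] against [W] over [a, s], for s in [a, b]: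
   the L^2 limit of the integrals of simple processes approximating [H] in
   L^2([a, b] x Omega). *)
Definition ito_integral (a b : R) F W H Y : Prop :=
  [/\ jointly_measurable a b H, adapted a b F H,
      forall s : R, s \in `[a, b] -> measurable_fun setT (Y s)
    & exists h : nat -> simple_process,
      [/\ forall n, simple_process_on a b F (h n),
          (fun n => \int[P]_w \int[lebesgue_measure]_(s in `[a, b])
             ((sp_val (h n) s w - H s w) ^+ 2)%:E)%E @ \oo --> 0%E
        & forall s : R, s \in `[a, b] ->
          (fun n => \int[P]_w
             ((sp_integral W (h n) s w - Y s w) ^+ 2)%:E)%E @ \oo --> 0%E]].

End stochastic_calculus.

(** * The control problem *)

Record lq_data (R : realType) := LQData {
  horizon : R;
  Xmax : R;
  Imin : R;
  Imax : R;
  Itarget : R;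
  c1 : R;
  c2 : R;
  pen : R;
  alpha : R -> R;
  sigma : R -> R;
  level : R -> R;      (* m_t *)
  dispatch : R -> R    (* M_t *)
}.

Section control_problem.
Context {R : realType}.
Variable p : lq_data R.

Notation T := (horizon p).

(* Half the width of [Imin, Imax], not its midpoint. *)
Definition I_m : R := (Imax p - Imin p) / 2.

Definition kappa : R := (1 + c1 p)^-1.

Definition standing_assumptions : Prop :=
  [/\ [/\ 0 < T, 0 < Xmax p & Imin p < Imax p],
      [/\ 0 < c1 p, 0 < c2 p & 0 < pen p],
      (forall t : R, t \in `[0, T] ->
         [/\ 0 < alpha p t, 0 < sigma p t & 0 <= level p t])
    & [/\ {within `[0, T], continuous (alpha p)},
          {within `[0, T], continuous (sigma p)},
          {within `[0, T], continuous (level p)}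
        & {within `[0, T], continuous (dispatch p)}]].

Section processes.
Context {d : measure_display} {Omega : measurableType d}.
Variables (P : probability Omega R) (F : R -> set (set Omega)).
Implicit Types (W X B : R -> Omega -> R) (t x i : R).

Definition jacobi_solution W t x X : Prop :=
  [/\ adapted t T F X,
      forall w, {within `[t, T], continuous (X ^~ w)},
      forall (s : R) (w : Omega), s \in `[t, T] -> 0 <= X s w <= Xmax p
    & exists Y : R -> Omega -> R,
        ito_integral P t T F W
          (fun s w => sigma p s * Num.sqrt (X s w * (Xmax p - X s w))) Y /\
        forall s : R, s \in `[t, T] ->
          {ae P, forall w,
             X s w = x + \int[lebesgue_measure]_(r in `[t, s])
                           (alpha p r * (level p r - X r w)) + Y s w}].

(* The integrability in time only gives a meaning to dI = B dt; controls of
   infinite cost are allowed and do not affect the infimum. *)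
Definition admissible t B : Prop :=
  [/\ jointly_measurable t T B, adapted t T F B
    & {ae P, forall w,
         lebesgue_measure.-integrable `[t, T] (fun s => (B s w)%:E)}].

Definition charge_state t i B : R -> Omega -> R :=
  fun s w => i + \int[lebesgue_measure]_(r in `[t, s]) B r w.

Definition cost t i X B : \bar R :=
  (\int[P]_w
     (\int[lebesgue_measure]_(s in `[t, T])
        ((X s w - B s w - dispatch p s) ^+ 2 + c1 p * B s w ^+ 2
         + c2 p * (charge_state t i B s w - I_m) ^+ 2)%:E
      + (pen p * (charge_state t i B T w - Itarget p) ^+ 2)%:E))%E.

(* [X t x] is the exogenous state started from [x] at time [t]. *)
Definition value_function (X : R -> R -> R -> Omega -> R) t x i : \bar R :=
  ereal_inf [set cost t i (X t x) B | B in admissible t].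

End processes.

(** * The Hamilton-Jacobi-Bellman equation *)

Definition box : set (R * R * R) :=
  [set q | [/\ q.1.1 \in `[0, T], q.1.2 \in `[0, Xmax p]
             & q.2 \in `[Imin p, Imax p]]].

Implicit Types V : R -> R -> R -> R.

Definition d_t V t x i : R := deriv_within `[0, T] (fun s => V s x i) t.
Definition d_X V t x i : R := deriv_within `[0, Xmax p] (fun y => V t y i) x.
Definition d_I V t x i : R :=
  deriv_within `[Imin p, Imax p] (fun j => V t x j) i.

Definition exists_d_t V : Prop := forall t x i : R, box (t, x, i) ->
  derivable_within `[0, T] (fun s => V s x i) t.
Definition exists_d_X V : Prop := forall t x i : R, box (t, x, i) ->
  derivable_within `[0, Xmax p] (fun y => V t y i) x.
Definition exists_d_I V : Prop := forall t x i : R, box (t, x, i) ->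
  derivable_within `[Imin p, Imax p] (fun j => V t x j) i.

Definition continuous_on_box V : Prop :=
  {within box, continuous (fun q : R * R * R => V q.1.1 q.1.2 q.2)}.

Definition class_C12 V : Prop :=
  [/\ [/\ exists_d_t V, exists_d_X V & exists_d_I V],
      [/\ exists_d_X (d_X V), exists_d_I (d_X V),
          exists_d_X (d_I V) & exists_d_I (d_I V)],
      [/\ continuous_on_box V, continuous_on_box (d_t V),
          continuous_on_box (d_X V) & continuous_on_box (d_I V)]
    & [/\ continuous_on_box (d_X (d_X V)), continuous_on_box (d_I (d_X V)),
          continuous_on_box (d_X (d_I V)) & continuous_on_box (d_I (d_I V))]].

Definition hamiltonian V t x i (b : R) : R :=
  alpha p t * (level p t - x) * d_X V t x i + b * d_I V t x i
  + 2^-1 * sigma p t ^+ 2 * (x * (Xmax p - x)) * d_X (d_X V) t x i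
  + (x - b - dispatch p t) ^+ 2 + c1 p * b ^+ 2 + c2 p * (i - I_m) ^+ 2.

(* The infimum is taken in the extended reals, so that unboundedness from
   below is not hidden by a default value. *)
Definition solves_HJB V : Prop :=
  (forall t x i : R, box (t, x, i) ->
     ((d_t V t x i)%:E
      + ereal_inf [set (hamiltonian V t x i b)%:E | b in [set: R]])%E = 0%E)
  /\ (forall x i : R, box (T, x, i) -> V T x i = pen p * (i - Itarget p) ^+ 2).

(** * The Riccati system and the feedback *)

Definition dot (f : R -> R) (t : R) : R := deriv_within `[0, T] f t.

(* The last term of the equation of [P6] is missing from the system as printed
   in the source, which is false without it.  It comes from the expansion
   x (Xmax - x) = - (x - m)^2 + (Xmax - 2 m) (x - m) + m (Xmax - m):
   its constant part, multiplied by sigma^2 P3, is not cancelled by anything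
   else in the HJB equation.  It vanishes for m = 0 or m = Xmax, and the
   printed system is recovered in these cases. *)
Definition riccati_system (m : R) (P1 P2 P3 P4 P5 P6 : R -> R) : Prop :=
  let differentiable (f : R -> R) := forall t : R, t \in `[0, T] ->
                            derivable_within `[0, T] f t in
  [/\ [/\ [/\ differentiable P1, differentiable P2 & differentiable P3],
          differentiable P4, differentiable P5 & differentiable P6],
      [/\ P1 T = pen p, P2 T = 0 & P3 T = 0],
      [/\ P4 T = 2 * pen p * (I_m - Itarget p), P5 T = 0
        & P6 T = pen p * (I_m - Itarget p) ^+ 2]
    & forall t : R, t \in `[0, T] ->
      let a := alpha p t in
      let s2 := sigma p t ^+ 2 in
      let n := m - dispatch p t in
      let k := kappa in
      [/\ [/\ dot P1 t + c2 p - k * P1 t ^+ 2 = 0,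
              dot P2 t - a * P2 t - k * P1 t * P2 t + 2 * k * P1 t = 0
            & dot P3 t + (1 - k) - (2 * a + s2) * P3 t + k * P2 t
              - k / 4 * P2 t ^+ 2 = 0],
          dot P4 t + 2 * k * n * P1 t - k * P1 t * P4 t = 0,
          dot P5 t + 2 * (1 - k) * n - a * P5 t + k * P4 t + k * n * P2 t
            - k / 2 * P2 t * P4 t + (s2 * Xmax p - 2 * s2 * m) * P3 t = 0
        & dot P6 t + (1 - k) * n ^+ 2 + k * n * P4 t - k / 4 * P4 t ^+ 2
            + s2 * m * (Xmax p - m) * P3 t = 0]].

Definition feedback (m : R) (P1 P2 P4 : R -> R) (t x i : R) : R :=
  kappa * (x - dispatch p t) - kappa * P1 t * (i - I_m)
  - kappa / 2 * P2 t * (x - m) - kappa / 2 * P4 t.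

End control_problem.

(* Main.v *)
Require Import Defs.
From HB Require Import structures.
From mathcomp Require Import all_boot all_order all_algebra.
From mathcomp Require Import all_classical all_reals all_analysis.
From mathcomp Require Import measurable_realfun ring lra.
Set Implicit Arguments.
Unset Strict Implicit.
Unset Printing Implicit Defensive.
Import Order.TTheory GRing.Theory Num.Theory.
Import numFieldNormedType.Exports.
Local Open Scope classical_set_scope.
Local Open Scope ring_scope.

(* Write J = I - I_m and Z = X - m.  The Ito integral driving X has mean zero,
   its increments are uncorrelated with the past, and it satisfies the Ito
   isometry; this yields integrated linear equations for the moments of J, J^2,
   JZ, Z and Z^2 under any square-integrable control, which replace Ito's formula
   since the candidate value function is quadratic.  Weighting these moments by
   the P_i and integrating by parts, the Riccati system completes the square:
     cost B = candidate + (1 + c1) E int_t^T (B_s - feedback_s)^2 ds.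
   The candidate is therefore a lower bound, attained by the closed-loop control,
   whose state equation is linear in J and solved pathwise by an integrating
   factor.  Knowing V, only d_I V matters for the minimiser of the Hamiltonian,
   which is a quadratic polynomial in b with leading coefficient 1 + c1.
   The equation of P1 is solved in closed form, the others are linear. *)

(** * Integrable and square-integrable functions *)

(** The Jacobi state stays in [0, Xmax], so [Z] minus its drift part is a bounded, jointly
    measurable process [N]. It stands in for the Ito integral, with which it agrees almost surely at
    each fixed time, and every square-integrable control can be multiplied by it. Decorrelation from
    the past is used in the form E[u_r N_s] = E[u_r N_r] for r <= s and u_r known at time r: under a
    time integral it replaces N_s by N_r, which does the work of the product rule for J N. The
    constant level makes the drift of [Z] homogeneous, - alpha Z, and the squared diffusion
    coefficient is quadratic in [Z]; this is why the moment equations close. Admissible controls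
    need not be square-integrable: this follows from finite cost since c1 > 0, and at infinite cost
    the lower bound is trivial. Values are known on closed boxes only, hence derivatives relative to
    a segment and functions of time extended to the line by clamping their argument. *)

Section L1_L2.
Context d (T : measurableType d) (R : realType) (mu : {measure set T -> \bar R}).
Implicit Types (f g : T -> R).

Definition L1 f := mu.-integrable setT (EFin \o f).
Definition L2 f := measurable_fun setT f /\ L1 (fun x => f x ^+ 2).
Definition bounded_meas f :=
  measurable_fun setT f /\ exists C : R, forall x, `|f x| <= C.

Lemma L1_meas f : L1 f -> measurable_fun setT f.
Proof. by move=> /measurable_int /measurable_EFinP. Qed.

Lemma L1_le f g : measurable_fun setT f -> (forall x, `|f x| <= g x) -> L1 g -> L1 f.
Proof.
move=> mf fg ig; apply: (le_integrable measurableT _ _ ig) => //.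
- exact/measurable_EFinP.
- by move=> x _; rewrite lee_fin (le_trans (fg x))// ler_norm.
Qed.

Lemma L1D f g : L1 f -> L1 g -> L1 (fun x => f x + g x).
Proof. by move=> f1 g1; have := integrableD measurableT f1 g1. Qed.

Lemma L1B f g : L1 f -> L1 g -> L1 (fun x => f x - g x).
Proof. by move=> f1 g1; have := integrableB measurableT f1 g1. Qed.

Lemma L1Zl c f : L1 f -> L1 (fun x => c * f x).
Proof. by move=> f1; have := integrableZl measurableT c f1. Qed.

Lemma L1_norm f : L1 f -> L1 (fun x => `|f x|).
Proof. exact: integrable_norm. Qed.

Lemma L1_ext f g : f =1 g -> L1 f -> L1 g.
Proof. by move=> /funext ->. Qed.

Lemma L1Ml f g : bounded_meas f -> L1 g -> L1 (fun x => f x * g x).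
Proof.
move=> [mf [C fC]] ig; apply: (@L1_le _ (fun x => C * `|g x|)).
- by apply: measurable_funM => //; exact: L1_meas.
- by move=> x; rewrite normrM ler_wpM2r.
- by apply: L1Zl; exact: L1_norm.
Qed.

Lemma L2_meas f : L2 f -> measurable_fun setT f. Proof. by case. Qed.

Lemma L2_L1M f g : L2 f -> L2 g -> L1 (fun x => f x * g x).
Proof.
move=> [mf f2] [mg g2]; apply: (@L1_le _ (fun x => f x ^+ 2 + g x ^+ 2)).
- exact: measurable_funM.
- move=> x; rewrite ler_norml.
  have := sqr_ge0 (f x + g x); have := sqr_ge0 (f x - g x).
  rewrite sqrrB sqrrD; have := sqr_ge0 (f x); have := sqr_ge0 (g x).
  by move=> *; apply/andP; split; lra.
- exact: L1D.
Qed.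

Lemma L2Zl c f : L2 f -> L2 (fun x => c * f x).
Proof.
move=> [mf f2]; split; first exact: measurable_funM.
by apply: L1_ext (L1Zl (c ^+ 2) f2) => x; rewrite exprMn.
Qed.

Lemma L2D f g : L2 f -> L2 g -> L2 (fun x => f x + g x).
Proof.
move=> hf hg; split; first by apply: measurable_funD; [case: hf|case: hg].
apply: (@L1_ext (fun x => f x ^+ 2 + (2 * (f x * g x) + g x ^+ 2))).
  by move=> x; ring.
by apply: L1D; [case: hf|apply: L1D; [apply/L1Zl/L2_L1M|case: hg]].
Qed.

Lemma L2B f g : L2 f -> L2 g -> L2 (fun x => f x - g x).
Proof.
move=> hf hg; have := L2D hf (L2Zl (-1) hg).
by congr L2; apply/funext => x; rewrite mulN1r.
Qed.

Lemma L2Ml f g : bounded_meas f -> L2 g -> L2 (fun x => f x * g x).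
Proof.
move=> [mf [C fC]] [mg g2]; split; first exact: measurable_funM.
apply: (@L1_ext (fun x => (f x ^+ 2) * g x ^+ 2)); first by move=> x; ring.
apply: L1Ml => //; split; first exact: measurable_funX.
exists (C ^+ 2) => x; rewrite normrX lerXn2r ?nnegrE//.
exact: le_trans (fC x).
Qed.

Lemma bmM f g : bounded_meas f -> bounded_meas g -> bounded_meas (fun x => f x * g x).
Proof.
move=> [mf [C fC]] [mg [D gD]]; split; first exact: measurable_funM.
by exists (C * D) => x; rewrite normrM ler_pM.
Qed.

Lemma bmD f g : bounded_meas f -> bounded_meas g -> bounded_meas (fun x => f x + g x).
Proof.
move=> [mf [C fC]] [mg [D gD]]; split; first exact: measurable_funD.
by exists (C + D) => x; rewrite (le_trans (ler_normD _ _))// lerD.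
Qed.

Lemma bm_cst c : bounded_meas (fun=> c).
Proof. by split; [exact: measurable_cst | exists `|c|]. Qed.

Lemma bmB f g : bounded_meas f -> bounded_meas g -> bounded_meas (fun x => f x - g x).
Proof.
move=> hf hg; have := bmD hf (bmM (bm_cst (-1)) hg).
by congr bounded_meas; apply/funext => x; rewrite mulN1r.
Qed.

Lemma bmX n f : bounded_meas f -> bounded_meas (fun x => f x ^+ n).
Proof.
move=> [mf [C fC]]; split; first exact: measurable_funX.
exists (C ^+ n) => x; rewrite normrX lerXn2r ?nnegrE//; exact: le_trans (fC x).
Qed.

Lemma IntD f g : L1 f -> L1 g ->
  \int[mu]_x (f x + g x) = \int[mu]_x f x + \int[mu]_x g x.
Proof. exact: RintegralD. Qed.

Lemma IntB f g : L1 f -> L1 g ->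
  \int[mu]_x (f x - g x) = \int[mu]_x f x - \int[mu]_x g x.
Proof. exact: RintegralB. Qed.

Lemma IntZl c f : L1 f -> \int[mu]_x (c * f x) = c * \int[mu]_x f x.
Proof. exact: RintegralZl. Qed.

Lemma Int_ext f g : f =1 g -> \int[mu]_x f x = \int[mu]_x g x.
Proof. by move=> /funext ->. Qed.

Lemma Int_le f g : L1 f -> L1 g -> (forall x, f x <= g x) ->
  \int[mu]_x f x <= \int[mu]_x g x.
Proof. by move=> *; exact: le_Rintegral. Qed.

Lemma Int_norm f : L1 f -> `|\int[mu]_x f x| <= \int[mu]_x `|f x|.
Proof. exact: le_normr_Rintegral. Qed.

Lemma IntE f : L1 f -> (\int[mu]_x (f x)%:E)%E = (\int[mu]_x f x)%:E.
Proof. by move=> f1; rewrite fineK//; exact: integrable_fin_num. Qed.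

Lemma L1_ae f g : measurable_fun setT g -> {ae mu, forall x, f x = g x} -> L1 f -> L1 g.
Proof.
move=> mg fg /integrableP[mf fi]; apply/integrableP; split; first exact/measurable_EFinP.
rewrite (ae_eq_integral (fun x => `|(f x)%:E|)%E)//.
- by apply: measurableT_comp => //; exact/measurable_EFinP.
- exact: measurableT_comp.
- by apply: filterS fg => x /= ->.
Qed.

Lemma Int_ae f g : measurable_fun setT f -> measurable_fun setT g ->
  {ae mu, forall x, f x = g x} -> \int[mu]_x f x = \int[mu]_x g x.
Proof.
move=> mf mg fg; congr fine; apply: ae_eq_integral => //; try exact/measurable_EFinP.
by apply: filterS fg => x /= ->.
Qed.

Lemma L2_ae f g : measurable_fun setT g -> {ae mu, forall x, f x = g x} -> L2 f -> L2 g.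
Proof.
move=> mg fg [mf f2]; split=> //; apply: L1_ae f2; first exact: measurable_funX.
by apply: filterS fg => x ->.
Qed.

Lemma L1_of_lty f : measurable_fun setT f -> (forall x, 0 <= f x) ->
  (\int[mu]_x (f x)%:E < +oo)%E -> L1 f.
Proof.
move=> mf f0 foo; apply/integrableP; split; first exact/measurable_EFinP.
by under eq_integral do rewrite /= ger0_norm//.
Qed.

End L1_L2.

Section L1_finite.
Context d (T : measurableType d) (R : realType) (mu : {measure set T -> \bar R}).
Hypothesis muoo : (mu setT < +oo)%E.
Implicit Types (f g : T -> R).

Lemma bm_L1 f : bounded_meas f -> L1 mu f.
Proof.
move=> [mf [C fC]]; apply: measurable_bounded_integrable => //.
exists C; split; first exact: num_real.
by move=> x Cx y _; exact: le_trans (fC y) (ltW Cx).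
Qed.

Lemma bm_L2 f : bounded_meas f -> L2 mu f.
Proof.
move=> bf; split; first by case: bf.
by apply: bm_L1; apply: bmM.
Qed.

Lemma L2_L1 f : L2 mu f -> L1 mu f.
Proof.
move=> f2; apply: (@L1_ext _ _ _ _ (fun x => 1 * f x)); first by move=> x; rewrite mul1r.
by apply: L2_L1M => //; apply: bm_L2; exact: bm_cst.
Qed.

Lemma Int_cst c : \int[mu]_x c = c * fine (mu setT).
Proof. by rewrite Rintegral_cst. Qed.

End L1_finite.

Ltac bm := repeat first
  [assumption | exact: bm_cst | apply: bmB | apply: bmD | apply: bmX | apply: bmM].

Section slices.
Context d1 d2 (T1 : measurableType d1) (T2 : measurableType d2) (R : realType).
Implicit Types (u : T1 * T2 -> R).

Lemma slice_meas u y : measurable_fun setT u -> measurable_fun setT (fun x => u (x, y)).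
Proof. by move=> mu; apply: (measurableT_comp mu); exact: pair2_measurable. Qed.

Lemma slice_meas2 u x : measurable_fun setT u -> measurable_fun setT (fun y => u (x, y)).
Proof. by move=> mu; apply: (measurableT_comp mu); exact: pair1_measurable. Qed.

Lemma bm_slice u y : bounded_meas u -> bounded_meas (fun x => u (x, y)).
Proof. by move=> [mu [C uC]]; split; [exact: slice_meas|exists C => x]. Qed.

Lemma bm_slice2 u x : bounded_meas u -> bounded_meas (fun y => u (x, y)).
Proof. by move=> [mu [C uC]]; split; [exact: slice_meas2|exists C => y]. Qed.

Lemma bm_fst (g : T1 -> R) : bounded_meas g -> bounded_meas (fun q : T1 * T2 => g q.1).
Proof. by move=> [mg [C gC]]; split; [exact: measurableT_comp|exists C => q]. Qed.

End slices.

(** * Fubini and Tonelli for real-valued integrands *)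

Section fubini_real.
Context d1 d2 (T1 : measurableType d1) (T2 : measurableType d2) (R : realType).
Variables (m1 : {sigma_finite_measure set T1 -> \bar R}).
Variables (m2 : {sigma_finite_measure set T2 -> \bar R}).
Implicit Types (f : T1 * T2 -> R).

(** An integrable extended-real function is finite almost everywhere, so [fine] changes it on a null
    set only. Inner integrals in Fubini's theorem thereby become real-valued. *)
Lemma L1_fine d (T : measurableType d) (m : {measure set T -> \bar R}) (g : T -> \bar R) :
  m.-integrable setT g ->
  L1 m (fine \o g) /\ (\int[m]_x (fine (g x))%:E = \int[m]_x g x)%E.
Proof.
move=> ig; have mg := measurable_int _ ig.
have mfg : measurable_fun setT (fine \o g) by exact: measurableT_comp.
split.
- apply: (le_integrable measurableT _ _ ig); first exact/measurable_EFinP.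
  by move=> x _ /=; case: (g x) => [r| |] //=; rewrite ?normr0 ?leey.
- apply: ae_eq_integral => //; first exact/measurable_EFinP.
  by apply: filterS (integrable_ae measurableT ig) => x h xT; rewrite fineK// h.
Qed.

Lemma L1_slice1 f : L1 (m1 \x m2)%E f -> {ae m1, forall x, L1 m2 (fun y => f (x, y))}.
Proof. exact: ae_integrable1. Qed.

Lemma L1_slice2 f : L1 (m1 \x m2)%E f -> {ae m2, forall y, L1 m1 (fun x => f (x, y))}.
Proof. exact: ae_integrable2. Qed.

Lemma L1_fubini1 f : L1 (m1 \x m2)%E f -> L1 m1 (fun x => \int[m2]_y f (x, y)).
Proof. by move=> /integrable_fubini_F /L1_fine[]. Qed.

(** The inner integral is dominated by that of the absolute value, whose outer integral is finite by
    Tonelli. *)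
Lemma integrable_fubini_G (f : T1 * T2 -> \bar R) : (m1 \x m2)%E.-integrable setT f ->
  m2.-integrable setT (fubini_G m1 f).
Proof.
move=> intf; have mf := measurable_int _ intf.
have foo := (integrable21ltyP m1 m2 mf).1 intf.
apply/integrableP; split; first exact: (measurable_fubini_G intf).
apply: le_lt_trans foo; apply: ge0_le_integral => //.
- by apply: measurableT_comp => //; exact: (measurable_fubini_G intf).
- apply: (measurable_fun_fubini_tonelli_G (abse \o f)) => //=.
  exact: measurableT_comp.
- move=> y _; apply: le_abse_integral => //.
  exact: measurableT_comp.
Qed.

Lemma L1_fubini2 f : L1 (m1 \x m2)%E f -> L1 m2 (fun y => \int[m1]_x f (x, y)).
Proof. by move=> /integrable_fubini_G /L1_fine[]. Qed.

Lemma Int_fubini1 f : L1 (m1 \x m2)%E f ->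
  \int[m1]_x \int[m2]_y f (x, y) = \int[(m1 \x m2)%E]_z f z.
Proof.
move=> f1; rewrite [RHS]/Rintegral -integral12_prod_meas1//.
by have [_ <-] := L1_fine (integrable_fubini_F f1).
Qed.

Lemma Int_fubini2 f : L1 (m1 \x m2)%E f ->
  \int[m2]_y \int[m1]_x f (x, y) = \int[(m1 \x m2)%E]_z f z.
Proof.
move=> f1; rewrite [RHS]/Rintegral -integral21_prod_meas1//.
by have [_ <-] := L1_fine (integrable_fubini_G f1).
Qed.

Lemma L1_tensor (g : T1 -> R) (h : T2 -> R) : L1 m1 g -> L1 m2 h ->
  L1 (m1 \x m2)%E (fun p => g p.1 * h p.2).
Proof.
move=> g1 h1; have mg := L1_meas g1; have mh := L1_meas h1.
have mgh : measurable_fun setT (fun p : T1 * T2 => g p.1 * h p.2).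
  by apply: measurable_funM; apply: measurableT_comp.
apply/integrable12ltyP; first exact/measurable_EFinP.
under eq_integral => x _.
  under eq_integral do rewrite /= normrM EFinM.
  rewrite ge0_integralZl//; last by apply/measurable_EFinP; exact: measurableT_comp.
  over.
have -> : (\int[m2]_y `|h y|%:E)%E = (\int[m2]_y `|h y|)%:E by rewrite IntE//; exact: L1_norm.
rewrite ge0_integralZr//.
- rewrite IntE; first by rewrite -EFinM ltry.
  exact: L1_norm.
- by apply/measurable_EFinP; exact: measurableT_comp.
- by rewrite lee_fin Rintegral_ge0.
Qed.

Lemma L1_tonelli2 f : measurable_fun setT f -> (forall z, 0 <= f z) ->
  (\int[m2]_y \int[m1]_x (f (x, y))%:E < +oo)%E -> L1 (m1 \x m2)%E f.
Proof.
move=> mf f0 foo; apply: L1_of_lty => //.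
by rewrite fubini_tonelli2//; exact/measurable_EFinP.
Qed.

(** No integrability is assumed: the integral is [fine] of a difference of two Tonelli integrals, of
    the positive and the negative part. Primitives of arbitrary measurable controls are thus
    measurable. *)
Lemma meas_Int1 f : measurable_fun setT f ->
  measurable_fun setT (fun x => \int[m2]_y f (x, y)).
Proof.
move=> /measurable_EFinP mf; apply: measurableT_comp => //.
rewrite (_ : (fun x => _) = fun x => ((fubini_F m2 (fun z => (f z)%:E)^\+ x) -
   (fubini_F m2 (fun z => (f z)%:E)^\- x))%E); last first.
  apply/funext => x; rewrite integralE /fubini_F.
  have h y : ((fun y => (f (x, y))%:E)^\+ y = (fun z => (f z)%:E)^\+ (x, y)
    /\ (fun y => (f (x, y))%:E)^\- y = (fun z => (f z)%:E)^\- (x, y))%E.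
    by rewrite !unlock.
  congr (_ - _)%E; apply: eq_integral => y _.
    by have [-> _] := h y.
  by have [_ ->] := h y.
apply: emeasurable_funB; apply: measurable_fun_fubini_tonelli_F => //.
- exact: measurable_funepos.
- exact: measurable_funeneg.
Qed.

End fubini_real.

(** * Joint measurability of processes with continuous paths *)

Section caratheodory.
Context {R : realType} d (T : measurableType d).

(** Time is rounded down to the grid of mesh 1/(n+1). Preimages under the rounded function are
    countable unions of rectangles, one for each grid cell, and continuity in time gives pointwise
    convergence as the mesh shrinks. *)
Lemma measurable_caratheodory (f : R -> T -> R) :
  (forall w, continuous (f ^~ w)) -> (forall s, measurable_fun setT (f s)) ->
  measurable_fun setT (fun p : R * T => f p.1 p.2).
Proof.
move=> cf mf.
pose fl n (s : R) : R := (Num.floor (s * n.+1%:R))%:~R / n.+1%:R.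
apply: (@measurable_fun_cvg _ _ _ _ (fun n (p : R * T) => f (fl n p.1) p.2)).
- move=> n _ S mS; rewrite setTI.
  rewrite (_ : _ @^-1` S = \bigcup_(k : int)
    ((fun s : R => Num.floor (s * n.+1%:R)) @^-1` [set k] `*`
       (f (k%:~R / n.+1%:R) @^-1` S))).
    apply: countable_bigcupT_measurable; first exact: countableP.
    move=> k; apply: measurableX.
      rewrite (_ : _ @^-1` _ = `[k%:~R / n.+1%:R, (k + 1)%:~R / n.+1%:R[%classic).
        exact: measurable_itv.
      apply/seteqP; split=> s /=; rewrite in_itv/=.
        move=> <-; rewrite ler_pdivrMr// ltr_pdivlMr//.
        by rewrite Num.Theory.floor_le floorD1_gt.
      rewrite ler_pdivrMr// ltr_pdivlMr// => h; exact: floor_def.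
    by rewrite -[X in measurable X]setTI; exact: mf.
  apply/seteqP; split=> [[s w] /= h|[s w] [k _ [/= <-]]] //.
  by exists (Num.floor (s * n.+1%:R)).
- move=> [s w] _ /=.
  have : fl n s @[n --> \oo] --> s.
    apply/cvgrPdist_le => e e0; near=> n.
    rewrite /fl -{1}(mulfK (_ : n.+1%:R != 0) s)//.
    rewrite -mulrBl normrM normfV (ger0_norm (ler0n _ n.+1)) ler_pdivrMr//.
    rewrite ger0_norm; last by rewrite subr_ge0 Num.Theory.floor_le.
    apply: (@le_trans _ _ 1).
      by rewrite lerBlDl -intrD1 ltW// floorD1_gt.
    rewrite -ler_pdivrMl// mulr1.
    apply: (@le_trans _ _ n%:R); last by rewrite ler_nat.
    near: n; exact: nbhs_infty_ger.
  by move=> h; exact: (cvg_comp (fl ^~ s) (f ^~ w) h (cf w s)).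
Unshelve. all: by end_near.
Qed.

End caratheodory.

(** * Primitives over a segment *)

Section leb_on.
Context {R : realType}.
Implicit Types (a b s : R).

Lemma leb_itv_lty a b : (lebesgue_measure (`[a, b]%classic : set R) < +oo)%E.
Proof. by rewrite lebesgue_measure_itv /=; case: ifP => _; rewrite ?ltry// -EFinB ltry. Qed.

(* [lebesgue_measure] lives on the alias [measurableTypeR R] of [R]; this
   restriction is a measure on [R] itself, as needed for products. *)
Definition leb_on a b (A : set R) : \bar R :=
  lebesgue_measure (A `&` `[a, b]%classic).

Let leb_on0 a b : leb_on a b set0 = 0%E.
Proof. by rewrite /leb_on set0I measure0. Qed.

Let leb_on_ge0 a b A : (0 <= leb_on a b A)%E.
Proof. exact: measure_ge0. Qed.

Let leb_on_sigma_additive a b : semi_sigma_additive (leb_on a b).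
Proof.
exact: (@measure_semi_sigma_additive _ _ _ (mrestr lebesgue_measure (measurable_itv `[a, b]))).
Qed.

HB.instance Definition _ a b := isMeasure.Build _ _ _ (leb_on a b)
  (leb_on0 a b) (leb_on_ge0 a b) (@leb_on_sigma_additive a b).

Let leb_on_fin a b : fin_num_fun (leb_on a b).
Proof.
move=> A mA; rewrite ge0_fin_numE ?measure_ge0//.
apply: le_lt_trans (leb_itv_lty a b); apply: le_measure; rewrite ?inE//.
by apply: measurableI => //; exact: measurable_itv.
Qed.

HB.instance Definition _ a b := @Measure_isFinite.Build _ _ _ (leb_on a b) (@leb_on_fin a b).

Lemma leb_onE a b A : leb_on a b A = lebesgue_measure (A `&` `[a, b]%classic).
Proof. by []. Qed.

Lemma leb_on_out a b : leb_on a b (~` `[a, b]%classic) = 0%E.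
Proof. by rewrite leb_onE setICl measure0. Qed.

Lemma leb_on_ae a b (Q : R -> Prop) : (forall r, r \in `[a, b] -> Q r) ->
  {ae leb_on a b, forall r, Q r}.
Proof.
move=> h; exists (~` `[a, b]%classic); split.
- by apply: measurableC; exact: measurable_itv.
- exact: leb_on_out.
- by move=> r /= nQ rab; apply: nQ; exact: h.
Qed.

Lemma leb_on_set1_ae a b s : {ae leb_on a b, forall r, r != s}.
Proof.
exists [set s]; split => //.
  apply/eqP; rewrite eq_le measure_ge0 andbT leb_onE.
  rewrite -(lebesgue_measure_set1 s); apply: le_measure; rewrite ?inE//.
  by apply: measurableI => //; exact: measurable_itv.
by move=> r /= /negP; rewrite negbK => /eqP.
Qed.

Lemma ge0_integral_leb_on a b (f : R -> \bar R) : measurable_fun setT f ->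
  (forall x, (0 <= f x)%E) ->
  (\int[leb_on a b]_x f x = \int[lebesgue_measure]_(x in `[a, b]) f x)%E.
Proof.
move=> mf f0; have mI : measurable (`[a, b]%classic : set R) by exact: measurable_itv.
(* The identity, seen as a map into the alias on which [lebesgue_measure] lives: the image of
   [leb_on a b] under it is compared with Lebesgue measure on subsets of the segment. *)
pose phi : R -> measurableTypeR R := id.
have mphi : measurable_fun setT phi by move=> _ A mA; rewrite setTI.
rewrite (@ge0_negligible_integral _ _ _ _ setT (~` `[a, b]))//=; last 2 first.
- exact: measurableC.
- exact: leb_on_out.
rewrite setTD setCK.
transitivity (\int[leb_on a b]_(x in phi @^-1` `[a, b]) (f \o phi) x)%E => //.
rewrite -ge0_integral_pushforward//; last exact: measurable_funTS.
by apply: eq_measure_integral => A mA Aab; rewrite -[in RHS](setIidl Aab).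
Qed.

Lemma integral_leb_on a b (f : R -> \bar R) : measurable_fun setT f ->
  (\int[leb_on a b]_x f x = \int[lebesgue_measure]_(x in `[a, b]) f x)%E.
Proof.
move=> mf; rewrite integralE [RHS]integralE.
by rewrite !ge0_integral_leb_on//; [exact: measurable_funeneg | exact: measurable_funepos].
Qed.

Lemma Rintegral_leb_on a b (f : R -> R) : measurable_fun setT f ->
  \int[leb_on a b]_x f x = \int[lebesgue_measure]_(x in `[a, b]) f x.
Proof. by move=> mf; congr fine; apply: integral_leb_on; exact/measurable_EFinP. Qed.

Lemma measurable_ler_nat d (T : measurableType d) (f g : T -> R) :
  measurable_fun setT f -> measurable_fun setT g ->
  measurable_fun setT (fun x => (f x <= g x)%R%:R : R).
Proof.
move=> mf mg.
rewrite (_ : (fun x => _) = fun x => if f x <= g x then 1 else 0 : R); last first.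
  by apply/funext => x; case: ifP.
by apply: measurable_fun_ifT => //; exact: measurable_fun_ler.
Qed.

Lemma bm_ler d (T : measurableType d) (f g : T -> R) :
  measurable_fun setT f -> measurable_fun setT g ->
  bounded_meas (fun x => (f x <= g x)%R%:R : R).
Proof.
move=> mf mg; split; first exact: measurable_ler_nat.
by exists 1 => x; case: (f x <= g x); rewrite ?normr1 ?normr0 ?ler01.
Qed.

(* The indicator keeps the domain of integration independent of [s], as needed
   for Fubini. *)
Definition prim a b (f : R -> R) s := \int[leb_on a b]_r ((r <= s)%R%:R * f r).

Lemma L1_below a b s (f : R -> R) : L1 (leb_on a b) f ->
  L1 (leb_on a b) (fun r => (r <= s)%R%:R * f r).
Proof. by apply: L1Ml; exact: bm_ler. Qed.

Lemma L2_below a b s (f : R -> R) : L2 (leb_on a b) f ->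
  L2 (leb_on a b) (fun r => (r <= s)%R%:R * f r).
Proof. by apply: L2Ml; exact: bm_ler. Qed.

Lemma primE a b s (f : R -> R) : measurable_fun setT f -> s <= b ->
  prim a b f s = \int[lebesgue_measure]_(r in `[a, s]) f r.
Proof.
move=> mf sb; rewrite /prim Rintegral_leb_on; last first.
  by apply: measurable_funM => //; exact: measurable_ler_nat.
rewrite Rintegral_mkcond [RHS]Rintegral_mkcond; congr fine.
apply: eq_integral => r _; rewrite !patchE.
case: ifPn; case: ifPn => //; rewrite ?inE/= !in_itv/=.
- by move=> /andP[_ ->] _; rewrite mul1r.
- rewrite notin_setE/= in_itv/= => /negP; rewrite negb_and => /orP[ar|rs] /andP[ar' rb].
    by rewrite ar' in ar.
  by rewrite (negbTE rs) mul0r.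
- rewrite notin_setE/= in_itv/= => /andP[ar rs] /negP; rewrite ar/= => /negP.
  by rewrite (le_trans rs sb).
Qed.

Lemma prim_top a b (f : R -> R) : measurable_fun setT f ->
  prim a b f b = \int[leb_on a b]_r f r.
Proof. by move=> mf; rewrite primE// Rintegral_leb_on. Qed.

Lemma prim_bot a b (f : R -> R) : measurable_fun setT f -> a <= b -> prim a b f a = 0.
Proof. by move=> mf ab; rewrite primE// set_itv1 Rintegral_set1. Qed.

Lemma prim_ext a b (f g : R -> R) s : measurable_fun setT f -> measurable_fun setT g ->
  (forall r, r \in `[a, b] -> r <= s -> f r = g r) -> prim a b f s = prim a b g s.
Proof.
move=> mf mg fg; apply: Int_ae.
- by apply: measurable_funM => //; exact: measurable_ler_nat.
- by apply: measurable_funM => //; exact: measurable_ler_nat.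
- apply: leb_on_ae => r rab; case: (leP r s) => rs; last by rewrite !mul0r.
  by rewrite fg.
Qed.

Lemma primD a b (f g : R -> R) s : L1 (leb_on a b) f -> L1 (leb_on a b) g ->
  prim a b (fun r => f r + g r) s = prim a b f s + prim a b g s.
Proof.
move=> f1 g1; rewrite /prim -IntD; try exact: L1_below.
by apply: Int_ext => r; rewrite mulrDr.
Qed.

Lemma primZ a b c (f : R -> R) s : L1 (leb_on a b) f ->
  prim a b (fun r => c * f r) s = c * prim a b f s.
Proof.
move=> f1; rewrite /prim -IntZl; last exact: L1_below.
by apply: Int_ext => r; rewrite mulrCA.
Qed.

Lemma prim_meas a b (f : R -> R) : measurable_fun setT f ->
  measurable_fun setT (prim a b f).
Proof.
move=> mf.
apply: (@meas_Int1 _ _ _ _ _ (leb_on a b) (fun p : R * R => (p.2 <= p.1)%R%:R * f p.2)).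
apply: measurable_funM; first exact: measurable_ler_nat.
exact: measurableT_comp.
Qed.

Lemma prim_le a b (f : R -> R) s : L1 (leb_on a b) f ->
  `|prim a b f s| <= \int[leb_on a b]_r `|f r|.
Proof.
move=> f1; apply: le_trans (Int_norm (L1_below s f1)) _.
apply: Int_le; [exact/L1_norm/L1_below|exact: L1_norm|].
move=> r; rewrite normrM; case: (r <= s); rewrite ?normr1 ?normr0 ?mul1r ?mul0r//.
Qed.

Lemma bm_prim a b (f : R -> R) : L1 (leb_on a b) f -> bounded_meas (prim a b f).
Proof.
move=> f1; split; first by apply: prim_meas; exact: L1_meas f1.
by exists (\int[leb_on a b]_r `|f r|) => s; exact: prim_le.
Qed.

(** Integration by parts as Fubini: the double integral of [g p.1 * h p.2] is split along the
    diagonal, and in each triangle the smaller variable is integrated first. *)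
Lemma prod_Int a b (g h : R -> R) : L1 (leb_on a b) g -> L1 (leb_on a b) h ->
  (\int[leb_on a b]_r g r) * (\int[leb_on a b]_r h r) =
  \int[leb_on a b]_r (g r * prim a b h r) + \int[leb_on a b]_r (h r * prim a b g r).
Proof.
set nu := leb_on a b => g1 h1.
have gh1 := L1_tensor g1 h1.
have m21 : measurable_fun setT (fun p : R * R => (p.2 <= p.1)%R%:R : R).
  exact: measurable_ler_nat.
have b21 : bounded_meas (fun p : R * R => (p.2 <= p.1)%R%:R : R) by exact: bm_ler.
have A1 := L1Ml b21 gh1.
have B1 : L1 (nu \x nu)%E (fun p : R * R => (1 - (p.2 <= p.1)%R%:R) * (g p.1 * h p.2)).
  by apply: L1Ml => //; apply: bmB => //; exact: bm_cst.
transitivity (\int[(nu \x nu)%E]_p (g p.1 * h p.2)).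
  rewrite -Int_fubini1//= mulrC -IntZl//; apply: Int_ext => r.
  by rewrite IntZl// mulrC.
transitivity (\int[(nu \x nu)%E]_p ((p.2 <= p.1)%R%:R * (g p.1 * h p.2)) +
  \int[(nu \x nu)%E]_p ((1 - (p.2 <= p.1)%R%:R) * (g p.1 * h p.2))).
  by rewrite -IntD//; apply: Int_ext => p; ring.
congr (_ + _).
  rewrite -Int_fubini1//=; apply: Int_ext => r.
  rewrite -IntZl; last exact: L1_below.
  by apply: Int_ext => s; ring.
rewrite -Int_fubini2//=; apply: Int_ext => s.
rewrite -IntZl; last exact: L1_below.
have mg := L1_meas g1; have mh := L1_meas h1.
apply: Int_ae.
- apply: measurable_funM; last by apply: measurable_funM.
  by apply: measurable_funB => //; exact: measurable_ler_nat.
- do 2 apply: measurable_funM => //; exact: measurable_ler_nat.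
(* One side has the strict inequality r < s, the other r <= s; they differ at r = s only, a null
   set. *)
- apply: filterS (leb_on_set1_ae a b s) => r rs.
  by case: ltgtP rs => //= _ _; ring.
Qed.

(** [prod_Int] for both integrands cut off at [s]. For r <= s the cut-off does not affect the
    primitive at [r], which sees only earlier times. *)
Lemma prim_mul a b (g h : R -> R) s : L1 (leb_on a b) g -> L1 (leb_on a b) h ->
  prim a b g s * prim a b h s =
  prim a b (fun r => g r * prim a b h r + h r * prim a b g r) s.
Proof.
move=> g1 h1.
have e (f k : R -> R) r : (r <= s)%R%:R * f r * prim a b (fun q => (q <= s)%R%:R * k q) r
    = (r <= s)%R%:R * (f r * prim a b k r).
  case: (leP r s) => rs; last by rewrite !mul0r.
  rewrite !mul1r; congr (_ * _); apply: Int_ext => q.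
  by case: (leP q r) => qr; rewrite ?mul0r// (le_trans qr rs) !mul1r.
have ge := @L1Ml _ _ _ _ _ g (bm_prim h1) g1.
have he := @L1Ml _ _ _ _ _ h (bm_prim g1) h1.
rewrite {1 2}/prim prod_Int; try exact: L1_below.
rewrite primD.
- by congr (_ + _); apply: Int_ext => r; rewrite e.
- by apply: L1_ext ge => r; rewrite mulrC.
- by apply: L1_ext he => r; rewrite mulrC.
Qed.

(** The product rule for absolutely continuous functions with initial values [g0] and [h0], in
    integrated form. *)
Lemma prim_mulD a b (g h : R -> R) g0 h0 s : L1 (leb_on a b) g -> L1 (leb_on a b) h ->
  (g0 + prim a b g s) * (h0 + prim a b h s) = g0 * h0 +
  prim a b (fun r => g r * (h0 + prim a b h r) + h r * (g0 + prim a b g r)) s.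
Proof.
move=> g1 h1.
have ge := @L1Ml _ _ _ _ _ g (bm_prim h1) g1.
have he := @L1Ml _ _ _ _ _ h (bm_prim g1) h1.
have e1 : L1 (leb_on a b) (fun r => g r * prim a b h r).
  by apply: L1_ext ge => r; rewrite mulrC.
have e2 : L1 (leb_on a b) (fun r => h r * prim a b g r).
  by apply: L1_ext he => r; rewrite mulrC.
rewrite mulrDl !mulrDr prim_mul// -primZ// [prim a b _ s * h0]mulrC -primZ//.
rewrite -!addrA; congr (_ + _); rewrite -primD//; [|exact: L1Zl|exact: L1D].
rewrite -primD//; [|exact: L1Zl|by apply: L1D; [exact: L1Zl|exact: L1D]].
by apply: Int_ext => r; ring.
Qed.

End leb_on.

(** * The Cauchy-Schwarz inequality against the constant one *)

Section cauchy_schwarz.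
Context d (T : measurableType d) (R : realType) (mu : {finite_measure set T -> \bar R}).

Lemma mass_lty : (mu setT < +oo)%E.
Proof. by rewrite -ge0_fin_numE// fin_num_measure. Qed.

(** Expand the nonnegative integral of [(f - l) ^+ 2] at a nearly optimal [l]. Dividing by the mass
    plus one instead of the mass keeps the case of mass zero, which occurs for a time segment
    reduced to a point. *)
Lemma Int_sqr_le (f : T -> R) : L2 mu f ->
  (\int[mu]_x f x) ^+ 2 <= (fine (mu setT) + 1) * \int[mu]_x (f x ^+ 2).
Proof.
move=> f2; have f1 := L2_L1 mass_lty f2.
set I := \int[mu]_x f x; set c := fine (mu setT).
have c0 : 0 <= c by exact: fine_ge0.
pose l := I / (c + 1).
have : 0 <= \int[mu]_x ((f x - l) ^+ 2) by apply: Rintegral_ge0 => x _; exact: sqr_ge0.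
have -> : \int[mu]_x ((f x - l) ^+ 2) =
    \int[mu]_x (f x ^+ 2) - 2 * l * I + l ^+ 2 * c.
  rewrite -(Int_cst mu (l ^+ 2)) -IntZl// -IntB; [|by case: f2|exact: L1Zl].
  rewrite -IntD; first by apply: Int_ext => x; ring.
    by apply: L1B; [case: f2|exact: L1Zl].
  by apply: bm_L1; [exact: mass_lty|exact: bm_cst].
have c10 : 0 < c + 1 by rewrite ltr_wpDl.
move=> h; rewrite mulrC -ler_pdivrMr//.
have h2 : l ^+ 2 * c <= l ^+ 2 * (c + 1) by rewrite ler_wpM2l ?sqr_ge0// lerDl.
have : I ^+ 2 / (c + 1) = 2 * l * I - l ^+ 2 * (c + 1).
  by rewrite /l; field; rewrite gt_eqF.
move=> ->; lra.
Qed.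

End cauchy_schwarz.

(** * Integrals over [t, T] x Omega *)

Section strip.
Context {R : realType} d (Omega : measurableType d) (P : {finite_measure set Omega -> \bar R}).
Variables a b : R.
Local Notation nu := (leb_on a b).
Local Notation mu := (nu \x P)%E.
Implicit Types (u v f N : R * Omega -> R) (s : R).

Lemma strip_lty : (mu setT < +oo)%E.
Proof.
by rewrite -setXTT product_measure1E// lte_mul_pinfty// ?mass_lty// fin_num_measure.
Qed.

Lemma prim_jmeas u : measurable_fun setT u ->
  measurable_fun setT (fun p : R * Omega => prim a b (fun r => u (r, p.2)) p.1).
Proof.
move=> mu'.
apply: (@meas_Int1 _ _ _ _ _ nu
  (fun q : (R * Omega) * R => (q.2 <= q.1.1)%R%:R * u (q.2, q.1.2))).
apply: measurable_funM.
  by apply: measurable_ler_nat => //; apply: measurableT_comp.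
by apply: (measurableT_comp mu'); apply: measurable_fun_pair => //; exact: measurableT_comp.
Qed.

Lemma bm_prim_time u : bounded_meas u ->
  bounded_meas (fun p : R * Omega => prim a b (fun r => u (r, p.2)) p.1).
Proof.
move=> bu; have [mu' [C uC]] := bu; split; first exact: prim_jmeas.
exists (C * fine (nu setT)) => q.
have u1 : L1 nu (fun r => u (r, q.2)).
  by apply: bm_L1; [exact: mass_lty|exact: bm_slice].
apply: le_trans (prim_le _ u1) _; rewrite -(Int_cst nu C); apply: Int_le.
- exact: L1_norm.
- by apply: bm_L1; [exact: mass_lty|exact: bm_cst].
- by move=> r; exact: uC.
Qed.

Lemma Int_prim u s : L1 mu u ->
  L1 P (fun w => prim a b (fun r => u (r, w)) s) /\
  \int[P]_w prim a b (fun r => u (r, w)) s = prim a b (fun r => \int[P]_w u (r, w)) s.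
Proof.
move=> u1.
have us : L1 mu (fun p => (p.1 <= s)%R%:R * u p) by apply: L1Ml => //; exact: bm_ler.
split; first exact: (L1_fubini2 us).
rewrite (Int_fubini2 us) -(Int_fubini1 us); apply: Int_ae.
- exact: L1_meas (L1_fubini1 us).
- exact: L1_meas (L1_below s (L1_fubini1 u1)).
- by apply: filterS (L1_slice1 u1) => r ur /=; rewrite IntZl.
Qed.

Lemma prim_Int u s : L1 mu u ->
  prim a b (fun r => \int[P]_w u (r, w)) s = \int[mu]_p ((p.1 <= s)%R%:R * u p).
Proof.
move=> u1; have [_ <-] := Int_prim s u1.
have us : L1 mu (fun p => (p.1 <= s)%R%:R * u p) by apply: L1Ml => //; exact: bm_ler.
by rewrite (Int_fubini2 us).
Qed.

Let c := fine (nu setT) + 1.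
Let c_gt0 : 0 < c. Proof. by rewrite ltr_wpDl// fine_ge0. Qed.

(** A pathwise bound valid for every [w]: on paths that are not square-integrable the right side is
    infinite, because [c] is positive even for a degenerate segment. *)
Lemma prim_sqr_le u w s : measurable_fun setT u ->
  (((prim a b (fun r => u (r, w)) s) ^+ 2)%:E <=
  c%:E * \int[nu]_r (u (r, w) ^+ 2)%:E)%E.
Proof.
move=> mu'; have mw := slice_meas w mu'.
have i0 : (0 <= \int[nu]_r (u (r, w) ^+ 2)%:E)%E.
  by apply: integral_ge0 => r _; rewrite lee_fin sqr_ge0.
have [fin|] := ltP (\int[nu]_r (u (r, w) ^+ 2)%:E)%E +oo%E; last first.
  by rewrite leye_eq => /eqP ->; rewrite gt0_muley ?lte_fin// leey.
have u2 : L2 nu (fun r => u (r, w)).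
  split => //; apply: L1_of_lty => //; first exact: measurable_funX.
  by move=> r; exact: sqr_ge0.
rewrite IntE; last by case: u2.
rewrite -EFinM lee_fin; have us := L2_below s u2.
apply: le_trans (Int_sqr_le us) _; rewrite ler_pM2l//.
apply: Int_le; [by case: us|by case: u2|move=> r].
by case: (r <= s); rewrite ?mul1r// mul0r expr0n sqr_ge0.
Qed.

Lemma L2_ae_slice u : L2 mu u -> {ae P, forall w, L2 nu (fun r => u (r, w))}.
Proof.
move=> [mu' u2]; apply: filterS (L1_slice2 u2) => w h; split => //.
exact: slice_meas.
Qed.

Lemma L2_ae_slice1 u : L2 mu u -> {ae nu, forall r, L2 P (fun w => u (r, w))}.
Proof.
move=> [mu' u2]; apply: filterS (L1_slice1 u2) => w h; split => //.
exact: slice_meas2.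
Qed.

Lemma L2_lty u : L2 mu u -> (\int[P]_w \int[nu]_r (u (r, w) ^+ 2)%:E < +oo)%E.
Proof.
move=> [mu' u2]; have mu2 : measurable_fun setT (fun p => (u p ^+ 2)%:E).
  by apply/measurable_EFinP; exact: measurable_funX.
have := integral21_prod_meas1 u2; rewrite /fubini_G /= => ->.
by rewrite IntE// ltry.
Qed.

Lemma measurable_Int_sqr u : measurable_fun setT u ->
  measurable_fun setT (fun w => \int[nu]_r (u (r, w) ^+ 2)%:E)%E.
Proof.
move=> mu'; apply: (@measurable_fun_fubini_tonelli_G _ _ _ _ _ nu (fun p => (u p ^+ 2)%:E)).
- by apply/measurable_EFinP; exact: measurable_funX.
- by move=> p; rewrite lee_fin sqr_ge0.
Qed.

Lemma L2_prim_slice u s : L2 mu u -> L2 P (fun w => prim a b (fun r => u (r, w)) s).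
Proof.
move=> u2; have mu' := L2_meas u2.
have mp : measurable_fun setT (fun w => prim a b (fun r => u (r, w)) s).
  exact: (slice_meas2 s (prim_jmeas mu')).
split => //; apply: L1_of_lty; [exact: measurable_funX|by move=> w; exact: sqr_ge0|].
apply: (@le_lt_trans _ _ (\int[P]_w (c%:E * \int[nu]_r (u (r, w) ^+ 2)%:E))%E).
  apply: ge0_le_integral => //.
  - by move=> w _; rewrite lee_fin sqr_ge0.
  - by apply/measurable_EFinP; exact: measurable_funX.
  - by apply: emeasurable_funM => //; exact: measurable_Int_sqr.
  - by move=> w _; exact: prim_sqr_le.
rewrite ge0_integralZl//; last 3 first.
- exact: measurable_Int_sqr.
- by move=> w _; apply: integral_ge0 => r _; rewrite lee_fin sqr_ge0.
- by rewrite lee_fin ltW.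
by rewrite lte_mul_pinfty// ?lee_fin ?ltW//; exact: L2_lty.
Qed.

Lemma L2_prim u : L2 mu u -> L2 mu (fun p => prim a b (fun r => u (r, p.2)) p.1).
Proof.
move=> u2; have mu' := L2_meas u2.
have mp := prim_jmeas mu'.
split => //; apply: L1_tonelli2; [exact: measurable_funX|by move=> w; exact: sqr_ge0|].
(* One factor [c] comes from [prim_sqr_le], the other bounds the length of the segment when that
   bound, constant in time, is integrated. *)
apply: (@le_lt_trans _ _ (\int[P]_w (c%:E * c%:E * \int[nu]_r (u (r, w) ^+ 2)%:E))%E).
  apply: ge0_le_integral => //.
  - by move=> w _; apply: integral_ge0 => r _; rewrite lee_fin sqr_ge0.
  - apply: (@measurable_fun_fubini_tonelli_G _ _ _ _ _ nu
      (fun p => ((prim a b (fun r => u (r, p.2)) p.1) ^+ 2)%:E)).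
    + by apply/measurable_EFinP; exact: measurable_funX.
    + by move=> p; rewrite lee_fin sqr_ge0.
  - by apply: emeasurable_funM => //; exact: measurable_Int_sqr.
  - move=> w _ /=.
    apply: (@le_trans _ _ (\int[nu]_r (c%:E * \int[nu]_r (u (r, w) ^+ 2)%:E))%E).
      apply: ge0_le_integral => //.
      + by move=> r _; rewrite lee_fin sqr_ge0.
      + apply/measurable_EFinP; apply: measurable_funX.
        exact: (slice_meas w mp).
      + by move=> r _; exact: prim_sqr_le.
    rewrite integral_cst// muleAC; apply: lee_wpmul2r.
      by apply: integral_ge0 => r _; rewrite lee_fin sqr_ge0.
    apply: lee_wpmul2l; first by rewrite lee_fin ltW.
    by rewrite /c EFinD fineK ?fin_num_measure// leeDl.
rewrite ge0_integralZl//; last 3 first.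
- exact: measurable_Int_sqr.
- by move=> w _; apply: integral_ge0 => r _; rewrite lee_fin sqr_ge0.
- by rewrite -EFinM lee_fin ltW// mulr_gt0.
by rewrite -EFinM lte_mul_pinfty// ?lee_fin ?mulr_ge0 ?ltW//; exact: L2_lty.
Qed.

Lemma L2_primD g0 u : L2 mu u -> L2 mu (fun p => g0 + prim a b (fun r => u (r, p.2)) p.1).
Proof.
move=> u2; apply: L2D; last exact: L2_prim.
by apply: bm_L2; [exact: strip_lty|exact: bm_cst].
Qed.

(** Almost every path of [u] and [v] is square-integrable in time, so the product rule holds
    pathwise; Fubini then takes the expectation inside. *)
Lemma Int_prod_prim g0 h0 u v s : L2 mu u -> L2 mu v ->
  let G p := g0 + prim a b (fun r => u (r, p.2)) p.1 in
  let H p := h0 + prim a b (fun r => v (r, p.2)) p.1 in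
  \int[P]_w (G (s, w) * H (s, w)) = g0 * h0 * fine (P setT) +
    \int[mu]_p ((p.1 <= s)%R%:R * (u p * H p + v p * G p)).
Proof.
move=> u2 v2 G H.
have G2 : L2 mu G by exact: L2_primD.
have H2 : L2 mu H by exact: L2_primD.
have k1 : L1 mu (fun p => u p * H p + v p * G p) by apply: L1D; apply: L2_L1M.
rewrite -prim_Int//; have [i1 <-] := Int_prim s k1.
rewrite -(Int_cst P (g0 * h0)) -IntD//; last first.
  by apply: bm_L1; [exact: mass_lty|exact: bm_cst].
apply: Int_ae.
- apply: measurable_funM; apply: measurable_funD => //.
    exact: (slice_meas2 s (prim_jmeas (L2_meas u2))).
  exact: (slice_meas2 s (prim_jmeas (L2_meas v2))).
- by apply: measurable_funD => //; exact: L1_meas i1.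
- apply: filterS2 (L2_ae_slice u2) (L2_ae_slice v2) => w uw vw /=.
  have u1 := L2_L1 (mass_lty nu) uw; have v1 := L2_L1 (mass_lty nu) vw.
  by rewrite /G /H /= prim_mulD.
Qed.

(** Move [N s] under the time integral and exchange with the expectation: for each r <= s, [N s] may
    then be replaced by [N r]. For [N] a martingale and [u] adapted this is the product rule with a
    mean-zero stochastic integral. Square-integrability of [u r] is asked of the relation since it
    holds for almost every [r] only. *)
Lemma Int_prim_martingale N u s : bounded_meas N -> L2 mu u ->
  (forall r, r \in `[a, b] -> r <= s -> L2 P (fun w => u (r, w)) ->
    \int[P]_w (u (r, w) * N (s, w)) = \int[P]_w (u (r, w) * N (r, w))) ->
  \int[P]_w (prim a b (fun r => u (r, w)) s * N (s, w)) =
  \int[mu]_p ((p.1 <= s)%R%:R * (u p * N p)).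
Proof.
move=> bN u2 orth; have mu' := L2_meas u2.
have u1 := L2_L1 strip_lty u2.
have mN : measurable_fun setT N by case: bN.
have mNs := slice_meas2 s mN.
have bNs : bounded_meas (fun p : R * Omega => N (s, p.2)).
  case: bN => _ [C NC]; split; last by exists C.
  by apply: (measurableT_comp mNs).
have uN : L1 mu (fun p => u p * N p) by apply: L1_ext (L1Ml bN u1) => p; rewrite mulrC.
have uNs : L1 mu (fun p => u p * N (s, p.2)).
  by apply: L1_ext (L1Ml bNs u1) => p; rewrite mulrC.
rewrite -prim_Int//; have [i1 e1] := Int_prim s uNs.
transitivity (\int[P]_w prim a b (fun r => u (r, w) * N (s, w)) s).
  apply: Int_ae.
  - by apply: measurable_funM => //; exact: (slice_meas2 s (prim_jmeas mu')).
  - exact: L1_meas i1.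
  - apply: filterS (L2_ae_slice u2) => w uw /=.
    rewrite mulrC -primZ; last exact: (L2_L1 (mass_lty nu) uw).
    by apply: Int_ext => r; rewrite [N _ * _]mulrC.
rewrite e1; apply: Int_ae.
- exact: L1_meas (L1_below s (L1_fubini1 uNs)).
- exact: L1_meas (L1_below s (L1_fubini1 uN)).
- have h : {ae nu, forall r, r \in `[a, b]} by exact: leb_on_ae.
  apply: filterS2 (L2_ae_slice1 u2) h => r ur rab.
  case: (leP r s) => rs; last by rewrite !mul0r.
  by rewrite !mul1r /=; exact: orth.
Qed.

(* Integration by parts of [p s] against the moment [E (F s)]. *)
Lemma Int_weighted (p p' : R -> R) (M0 : R) (f F : R * Omega -> R) : a <= b ->
  bounded_meas p' -> bounded_meas p ->
  (forall s, s \in `[a, b] -> p s = p a + prim a b p' s) ->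
  L1 mu f -> L1 mu F ->
  (forall s, s \in `[a, b] ->
    \int[P]_w F (s, w) = M0 + \int[mu]_q ((q.1 <= s)%R%:R * f q)) ->
  \int[mu]_q (p' q.1 * F q + p q.1 * f q) = p b * \int[P]_w F (b, w) - p a * M0.
Proof.
move=> ab bp' bp pE f1 F1 FE.
have nuoo := mass_lty nu.
have p1 : L1 nu p' by exact: bm_L1.
have phi1 := L1_fubini1 f1; set phi := (fun r => _) in phi1.
have p'F : L1 mu (fun q => p' q.1 * F q) by apply: L1Ml => //; exact: bm_fst.
have pf : L1 mu (fun q => p q.1 * f q) by apply: L1Ml => //; exact: bm_fst.
have FE' s : s \in `[a, b] -> \int[P]_w F (s, w) = M0 + prim a b phi s.
  by move=> /FE ->; rewrite prim_Int.
have mphi := L1_meas phi1; have mp' := L1_meas p1.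
have bprim := bm_prim phi1.
have e1 : \int[mu]_q (p' q.1 * F q) = \int[nu]_s (M0 * p' s + p' s * prim a b phi s).
  rewrite -(Int_fubini1 p'F); apply: Int_ae.
  - exact: L1_meas (L1_fubini1 p'F).
  - apply: measurable_funD; first exact: measurable_funM.
    by apply: measurable_funM => //; case: bprim.
  - have h : {ae nu, forall r, r \in `[a, b]} by exact: leb_on_ae.
    apply: filterS2 (L1_slice1 F1) h => s Fs sab /=.
    by rewrite IntZl// FE'//; ring.
have e2 : \int[mu]_q (p q.1 * f q) = \int[nu]_s (p a * phi s + phi s * prim a b p' s).
  rewrite -(Int_fubini1 pf); apply: Int_ae.
  - exact: L1_meas (L1_fubini1 pf).
  - apply: measurable_funD; first exact: measurable_funM.
    by apply: measurable_funM => //; exact: prim_meas.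
  - have h : {ae nu, forall r, r \in `[a, b]} by exact: leb_on_ae.
    apply: filterS2 (L1_slice1 f1) h => s fs sab /=.
    by rewrite IntZl// pE//; rewrite -/(phi s); ring.
have bin : b \in `[a, b] by rewrite in_itv/= ab lexx.
rewrite IntD// e1 e2 IntD; [|exact: L1Zl|by apply: bm_L1 => //; exact: bmM].
rewrite IntD; last 2 first.
- exact: L1Zl.
- by apply: L1_ext (L1Ml (bm_prim p1) phi1) => r; rewrite mulrC.
rewrite !IntZl// FE'// (pE b bin) !prim_top//.
(* The boundary term at [b] contains the product of the full integrals of [p'] and [phi], which this
   splits into the two remaining integrals. *)
have := prod_Int p1 phi1 => h.
move: h; do 4 move: (\int[nu]_r _); move=> y1 y2 y3 y4 h; ring: h.
Qed.

End strip.

(** * Moments of Wiener increments *)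

Section independence.
Context {R : realType} d (Omega : measurableType d) (P : probability Omega R).

Lemma L1_pushforward d1 (T1 : measurableType d1) (X : {mfun Omega >-> T1}) (g : T1 -> R) :
  measurable_fun setT g ->
  L1 (distribution P X) g <-> L1 P (g \o X).
Proof.
move=> mg; have mgX : measurable_fun setT (g \o X) by exact: measurableT_comp.
have e : (\int[distribution P X]_y `|(g y)%:E| = \int[P]_w `|(g (X w))%:E|)%E.
  rewrite ge0_integral_distribution//; apply: measurableT_comp => //.
  exact/measurable_EFinP.
split=> /integrableP[_ h]; apply/integrableP; split; try exact/measurable_EFinP.
  by rewrite /= -e.
by rewrite e.
Qed.

Lemma Int_pushforward d1 (T1 : measurableType d1) (X : {mfun Omega >-> T1}) (g : T1 -> R) :
  measurable_fun setT g -> L1 P (g \o X) ->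
  \int[distribution P X]_y g y = \int[P]_w g (X w).
Proof.
move=> mg ig; congr fine.
by rewrite integral_distribution//; exact/measurable_EFinP.
Qed.

(** By independence the law of [(xi, X)] agrees with the product of the laws on rectangles, hence
    everywhere, and Fubini factors the expectation. The function [psi] lets the same lemma serve an
    increment and its square. *)
Lemma indep_Int (xi X phi : Omega -> R) (psi : R -> R) :
  measurable_fun setT X -> measurable_fun setT psi -> phi = psi \o X ->
  L1 P xi -> L1 P phi ->
  (forall A B : set R, measurable A -> measurable B ->
    P (xi @^-1` A `&` X @^-1` B) = (P (xi @^-1` A) * P (X @^-1` B))%E) ->
  L1 P (fun w => xi w * phi w) /\
  \int[P]_w (xi w * phi w) = (\int[P]_w xi w) * (\int[P]_w phi w).
Proof.
move=> mX mpsi -> xi1 phi1 ind; have mxi := L1_meas xi1.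
have mJ : measurable_fun setT (fun w => (xi w, X w)) by exact: measurable_fun_pair.
pose xi' : {mfun Omega >-> R} := HB.pack xi (isMeasurableFun.Build _ _ _ _ _ mxi).
pose X' : {mfun Omega >-> R} := HB.pack X (isMeasurableFun.Build _ _ _ _ _ mX).
pose J : {mfun Omega >-> (R * R)%type} :=
  HB.pack (fun w => (xi w, X w)) (isMeasurableFun.Build _ _ _ _ _ mJ).
have prodE A : measurable A ->
    (distribution P xi' \x distribution P X')%E A = distribution P J A.
  apply: product_measure_unique => B C mB mC.
  by rewrite /distribution /pushforward /= -ind.
have mg : measurable_fun setT (fun p : R * R => p.1 * psi p.2).
  by apply: measurable_funM => //; exact: measurableT_comp.
have a1 : L1 (distribution P xi') id by apply/L1_pushforward.
have b1 : L1 (distribution P X') psi by apply/L1_pushforward.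
have t1 := L1_tensor a1 b1.
have eqI (f : R * R -> \bar R) :
    (\int[distribution P J]_z f z = \int[(distribution P xi' \x distribution P X')%E]_z f z)%E.
  by apply: eq_measure_integral => A mA _; exact: esym (prodE A mA).
have t2 : L1 (distribution P J) (fun p => p.1 * psi p.2).
  move: t1 => /integrableP[_ h]; apply/integrableP; split; first exact/measurable_EFinP.
  by rewrite eqI.
have t3 := (L1_pushforward J mg).1 t2.
split=> //.
rewrite -(Int_pushforward mg t3) [LHS]/Rintegral eqI -/(Rintegral _ _ _).
rewrite -Int_fubini1//= -(@Int_pushforward _ _ X' psi mpsi phi1).
rewrite -(@Int_pushforward _ _ xi' id)// mulrC -IntZl//.
by apply: Int_ext => x; rewrite IntZl// mulrC.
Qed.

End independence.

(** * First two moments of a centred normal law *)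

Section normal_moments.
Context {R : realType} {s : R}.
Hypothesis s0 : 0 < s.
Local Notation mu := (@lebesgue_measure R).
Local Notation pdf := (normal_pdf 0 s).
Let sn0 : s != 0. Proof. by rewrite gt_eqF. Qed.

Let pdfE x : pdf x = normal_peak s * expR (- x ^+ 2 / (s ^+ 2 *+ 2)).
Proof. by rewrite normal_pdfE// /normal_fun subr0. Qed.

Let pdf_deriv (x : R) : is_derive x 1 pdf (- (x / s ^+ 2) * pdf x).
Proof.
have -> : pdf = fun x : R => normal_peak s * expR (- x ^+ 2 / (s ^+ 2 *+ 2)).
  by apply/funext => y; exact: pdfE.
apply: is_derive_eq; rewrite /= /GRing.scale /=.
by field.
Qed.

(** Change of variables with the Radon-Nikodym derivative, which agrees with the density almost
    everywhere because both have the same integral over every measurable set. *)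
Lemma ge0_integral_normal (g : R -> \bar R) : measurable_fun setT g ->
  (forall x, (0 <= g x)%E) ->
  (\int[normal_prob 0 s]_x g x = \int[mu]_x (g x * (pdf x)%:E))%E.
Proof.
move=> mg g0; have dom := @normal_prob_dominates R 0 s.
rewrite -(Radon_Nikodym_SigmaFinite.change_of_variables dom)//.
apply: ae_eq_integral => //.
- apply: emeasurable_funM => //.
  exact: measurable_int (Radon_Nikodym_SigmaFinite.f_integrable dom).
- by apply: emeasurable_funM => //; apply/measurable_EFinP; exact: measurable_normal_pdf.
- apply: ae_eqe_mul2l; apply: integral_ae_eq => //.
  + exact: Radon_Nikodym_SigmaFinite.f_integrable.
  + by apply/measurable_EFinP; exact: measurable_normal_pdf.
  + by move=> E _ mE; rewrite -Radon_Nikodym_SigmaFinite.f_integral.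
Qed.

Let ibp n : (\int[mu]_(x in `[(- n%:R)%R, n%:R%R]) (x ^+ 2 * pdf x)%:E =
  (s ^+ 2)%R%:E * \int[mu]_(x in `[(- n%:R)%R, n%:R%R]) (pdf x)%:E -
   (2 * s ^+ 2 * (n%:R * pdf n%:R))%:E)%E.
Proof.
have cpdf : continuous pdf by exact: continuous_normal_pdf.
have mpdf : measurable_fun setT pdf by exact: measurable_normal_pdf.
have [->|n0] := eqVneq n 0%N.
  by rewrite oppr0 set_itv1 !integral_set1 mule0 mul0r mulr0 sube0.
(* Since the density satisfies pdf' = - (x / s^2) pdf, the derivative of [G] is (x^2 - s^2) pdf; its
   boundary values give the correction term. *)
pose G (x : R) : R := - s ^+ 2 * (x * pdf x).
pose g (x : R) : R := x ^+ 2 * pdf x - s ^+ 2 * pdf x.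
have dG (x : R) : is_derive x 1 G (g x).
  have Hp := pdf_deriv x.
  rewrite /G; apply: is_derive_eq; rewrite /g /= /GRing.scale /=.
  by field.
have cg : continuous g.
  move=> x; apply: cvgB; apply: cvgM => //; try exact: cpdf.
  - exact: exprn_continuous.
  - exact: cvg_cst.
have nn : - n%:R < n%:R :> R by rewrite gtrN// ltr0n lt0n.
have dF : derivable_oo_LRcontinuous G (- n%:R) n%:R.
  have cG (x : R) : {for x, continuous G}.
    by apply: differentiable_continuous; apply/derivable1_diffP; case: (dG x).
  split.
  - by move=> x _; case: (dG x).
  - by apply: cvg_at_right_filter; exact: cG.
  - by apply: cvg_at_left_filter; exact: cG.
have dGg : {in `](- n%:R)%R, n%:R%R[, derive1 G =1 g}.
  by move=> x _; rewrite derive1E; case: (dG x) => _ ->.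
have := @continuous_FTC2 _ g G (- n%:R) n%:R nn (continuous_subspaceT cg) dF dGg.
have pdfN : pdf (- n%:R) = pdf n%:R by rewrite !pdfE sqrrN.
have -> : ((G n%:R)%:E - (G (- n%:R))%:E)%E = (- (2 * s ^+ 2 * (n%:R * pdf n%:R)))%:E.
  by rewrite -EFinB /G pdfN; congr EFin; ring.
have i1 (h : R -> R) : continuous h -> mu.-integrable `[(- n%:R)%R, n%:R%R] (EFin \o h).
  move=> ch; apply: continuous_compact_integrable; first exact: segment_compact.
  exact: continuous_subspaceT.
have c1 : continuous (fun x : R => x ^+ 2 * pdf x).
  by move=> x; apply: cvgM; [exact: exprn_continuous|exact: cpdf].
have c2 : continuous (fun x : R => s ^+ 2 * pdf x).
  by move=> x; apply: cvgM; [exact: cvg_cst|exact: cpdf].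
rewrite integralB_EFin//; [|exact: i1|exact: i1].
have -> : (\int[mu]_(x in `[(- n%:R)%R, n%:R%R]) (s ^+ 2 * pdf x)%:E =
    (s ^+ 2)%R%:E * \int[mu]_(x in `[(- n%:R)%R, n%:R%R]) (pdf x)%:E)%E.
  by under eq_integral do rewrite EFinM; rewrite integralZl//; exact: i1.
have f1 : (\int[mu]_(x in `[(- n%:R)%R, n%:R%R]) (x ^+ 2 * pdf x)%:E)%E \is a fin_num.
  by apply: integrable_fin_num => //; exact: i1.
have f2 : (\int[mu]_(x in `[(- n%:R)%R, n%:R%R]) (pdf x)%:E)%E \is a fin_num.
  by apply: integrable_fin_num => //; exact: i1.
rewrite -(fineK f1) -(fineK f2) -!EFinM -!EFinB => -[] h.
by congr EFin; lra.
Qed.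

Lemma normal_second_moment : (\int[mu]_x (x ^+ 2 * pdf x)%:E = (s ^+ 2)%:E)%E.
Proof.
have mpdf : measurable_fun setT pdf by exact: measurable_normal_pdf.
pose I n : set R := `[- n%:R, n%:R]%classic.
have UI : \bigcup_n I n = setT.
  apply/seteqP; split=> // x _; exists (Num.truncn `|x|).+1 => //.
  by rewrite /I/= in_itv/= -ler_norml ltW// truncnS_gt.
have ndI : nondecreasing_seq I.
  move=> i j ij; apply/subsetPset => x; rewrite /I/= !in_itv/= -!ler_norml.
  by move/le_trans; apply; rewrite ler_nat.
have lim (f : R -> R) : measurable_fun setT f -> (forall x, 0 <= f x) ->
    (\int[mu]_(x in I n) (f x)%:E @[n --> \oo] --> \int[mu]_x (f x)%:E)%E.
  move=> mf f0; rewrite -UI; apply: ge0_nondecreasing_set_cvg_integral => //.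
  - by move=> i; exact: measurable_itv.
  - by move=> i; apply/measurable_EFinP; exact: measurable_funTS.
  - by move=> i x _; rewrite lee_fin.
have p0 x : 0 <= pdf x by exact: normal_pdf_ge0.
have l1 := lim (fun x => x ^+ 2 * pdf x) _ _.
have l2 := lim pdf mpdf p0.
rewrite integral_normal_pdf in l2.
(* From exp y >= 1 + y >= y at y = n^2 / (2 s^2), the boundary term is at most a constant times
   1/n. *)
have l3 : (n%:R * pdf n%:R : R) @[n --> \oo] --> 0.
  have l4 : ((normal_peak s * (s ^+ 2 *+ 2)) * (n%:R)^-1 : R) @[n --> \oo] --> 0.
    rewrite -[X in _ --> X](mulr0 (normal_peak s * (s ^+ 2 *+ 2))).
    apply: cvgM; first exact: cvg_cst.
    apply/cvgr0Pnorm_le => e e0; near=> n.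
    rewrite normfV ger0_norm// -[e]invrK lef_pV2 ?posrE ?invr_gt0//.
      near: n; exact: nbhs_infty_ger.
    near: n; exact: nbhs_infty_gtr.
  apply: (squeeze_cvgr _ (cvg_cst 0) l4); near=> n.
  have n0 : 0 < n%:R :> R by near: n; exact: nbhs_infty_gtr.
  rewrite mulr_ge0//= pdfE mulrCA -mulrA ler_wpM2l ?normal_peak_ge0//.
  rewrite mulNr expRN ler_pdivrMr ?expR_gt0//.
  have k0 : 0 < s ^+ 2 *+ 2 by rewrite pmulrn_lgt0// exprn_gt0.
  apply: (@le_trans _ _ (s ^+ 2 *+ 2 / n%:R * (n%:R ^+ 2 / (s ^+ 2 *+ 2)))).
    by rewrite le_eqVlt; apply/orP; left; apply/eqP; field; rewrite !gt_eqF.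
  rewrite ler_wpM2l//; first by rewrite divr_ge0// ltW.
  by rewrite (le_trans _ (expR_ge1Dx _))// lerDr.
have l4 : (\int[mu]_(x in I n) (x ^+ 2 * pdf x)%:E @[n --> \oo] --> (s ^+ 2)%:E)%E.
  rewrite (_ : (fun n => _) = (fun n => (s ^+ 2)%:E * (\int[mu]_(x in I n) (pdf x)%:E)%E
     - (2 * s ^+ 2 * (n%:R * pdf n%:R))%:E)%E); last by apply/funext => n; exact: ibp.
  rewrite -[X in _ --> X]sube0; apply: cvgeB => //.
    by rewrite -[X in _ --> X]mule1; apply: cvgeZl.
  apply: cvg_EFin; first by apply: nearW.
  by rewrite -[X in _ --> X](mulr0 (2 * s ^+ 2)); apply: cvgM => //; exact: cvg_cst.
apply: (cvg_unique _ (l1 _ _) l4) => //.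
- by apply: measurable_funM => //; exact: measurable_funX.
- by move=> x; rewrite mulr_ge0// sqr_ge0.
Unshelve. all: by end_near.
Qed.

(** The integrand is odd and Lebesgue measure is invariant under reflection, so the integral equals
    its opposite. Integrability comes from |x| <= x^2 + 1 and the second moment. *)
Lemma normal_first_moment : (\int[mu]_x (x * pdf x)%:E = 0)%E.
Proof.
have mpdf : measurable_fun setT pdf by exact: measurable_normal_pdf.
have mf : measurable_fun setT (fun x : R => x * pdf x) by exact: measurable_funM.
have fi : mu.-integrable setT (EFin \o (fun x : R => x * pdf x)).
  have i2 : mu.-integrable setT (EFin \o (fun x : R => x ^+ 2 * pdf x + pdf x)).
    have := @integrableD _ _ _ mu setT measurableT (EFin \o (fun x : R => x ^+ 2 * pdf x))
      (EFin \o pdf); apply.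
    - apply/integrableP; split.
        by apply/measurable_EFinP/measurable_funM => //; exact: measurable_funX.
      apply: (@le_lt_trans _ _ (\int[mu]_x (x ^+ 2 * pdf x)%:E)%E); last first.
        by rewrite normal_second_moment ltry.
      rewrite le_eqVlt; apply/orP; left; apply/eqP; apply: eq_integral.
      by move=> x _; rewrite gee0_abs//= lee_fin mulr_ge0 ?sqr_ge0 ?normal_pdf_ge0.
    - exact: integrable_normal_pdf.
  apply: (le_integrable measurableT _ _ i2); first exact/measurable_EFinP.
  move=> x _; rewrite lee_fin /= normrM (ger0_norm (normal_pdf_ge0 _ _ _)).
  rewrite [leRHS]ger0_norm; last first.
    by apply: addr_ge0; [apply: mulr_ge0; [exact: sqr_ge0|] |]; exact: normal_pdf_ge0.
  rewrite -[X in _ + X]mul1r -mulrDl ler_wpM2r ?normal_pdf_ge0//.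
  rewrite -real_normK ?num_real//; have := sqr_ge0 (`|x| - 1).
  have := normr_ge0 x; rewrite sqrrB1; lra.
have f1 : (\int[mu]_x (x * pdf x)%:E)%E \is a fin_num by exact: integrable_fin_num.
have : (\int[mu]_x (x * pdf x)%:E = - \int[mu]_x (x * pdf x)%:E)%E.
  pose phi : measurableTypeR R -> measurableTypeR R := -%R.
  have mphi : measurable_fun setT phi by exact: oppr_measurable.
  have e1 (f : R -> \bar R) : (\int[mu]_x f x = \int[pushforward mu phi]_x f x)%E.
    by apply: eq_measure_integral => A mA _; apply/esym; exact: lebesgue_measureN.
  rewrite [LHS]e1 integral_pushforward//=; last 2 first.
  - exact/measurable_EFinP.
  - rewrite (_ : _ \o _ = -%E \o (EFin \o (fun x : R => x * pdf x))).
      exact: integrableN.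
    by apply/funext => x /=; rewrite /phi !pdfE sqrrN mulNr.
  rewrite -integralN; last exact: integrable_add_def.
  by apply: eq_integral => x _ /=; rewrite /phi !pdfE sqrrN mulNr EFinN.
rewrite -(fineK f1) -EFinN => -[] h; congr EFin; lra.
Qed.

End normal_moments.

(** * Ito integrals *)

Section measurable_wrt_theory.
Context {R : realType} d (Omega : measurableType d).
Variable G : set (set Omega).
Hypothesis sG : sigma_algebra setT G.
Implicit Types f g : Omega -> R.

(** Turns measurability for a sub-sigma-algebra into ordinary measurability on another measurable
    type, where the closure properties are available. *)
Lemma measurable_wrtP f :
  measurable_wrt G f <-> measurable_fun (setT : set (g_sigma_algebraType G)) f.
Proof.
have mE : @measurable _ (g_sigma_algebraType G) = G by exact: sigma_algebra_id.
split=> mf.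
  by move=> _ S mS; rewrite setTI mE; exact: mf.
by move=> S mS; have := mf measurableT S mS; rewrite setTI mE.
Qed.

Lemma measurable_wrt_cst (c : R) : measurable_wrt G (fun _ : Omega => c).
Proof. by apply/measurable_wrtP; exact: measurable_cst. Qed.

Lemma measurable_wrtM f g : measurable_wrt G f -> measurable_wrt G g ->
  measurable_wrt G (fun w => f w * g w).
Proof.
move=> /measurable_wrtP mf /measurable_wrtP mg; apply/measurable_wrtP.
exact: measurable_funM.
Qed.

Lemma measurable_wrtD f g : measurable_wrt G f -> measurable_wrt G g ->
  measurable_wrt G (fun w => f w + g w).
Proof.
move=> /measurable_wrtP mf /measurable_wrtP mg; apply/measurable_wrtP.
exact: measurable_funD.
Qed.

Lemma measurable_wrtB f g : measurable_wrt G f -> measurable_wrt G g ->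
  measurable_wrt G (fun w => f w - g w).
Proof.
move=> /measurable_wrtP mf /measurable_wrtP mg; apply/measurable_wrtP.
exact: measurable_funB.
Qed.

Lemma measurable_wrt_fun f : G `<=` @measurable d Omega ->
  measurable_wrt G f -> measurable_fun setT f.
Proof. by move=> GM mf _ S mS; rewrite setTI; apply: GM; exact: mf. Qed.

End measurable_wrt_theory.

Lemma measurable_wrt_sub {R : realType} d (Omega : measurableType d)
    (G H : set (set Omega)) (f : Omega -> R) :
  G `<=` H -> measurable_wrt G f -> measurable_wrt H f.
Proof. by move=> GH mf S mS; apply: GH; exact: mf. Qed.

(** * Finite sums and limits in L^2 *)

Section L2_sums_limits.
Context d (T : measurableType d) (R : realType) (mu : {measure set T -> \bar R}).

Lemma Int_sum n (f : nat -> T -> R) : (forall i, (i < n)%N -> L1 mu (f i)) ->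
  L1 mu (fun x => \sum_(i < n) f i x) /\
  \int[mu]_x (\sum_(i < n) f i x) = \sum_(i < n) \int[mu]_x f i x.
Proof.
elim: n => [|n IH] f1.
  have -> : (fun x : T => \sum_(i < 0) f i x) = fun=> 0.
    by apply/funext => x; rewrite big_ord0.
  rewrite big_ord0; split; first exact: integrable0.
  by rewrite /Rintegral integral0.
have [i1 e1] := IH (fun i h => f1 i (ltnW h)).
have -> : (fun x : T => \sum_(i < n.+1) f i x) = fun x => \sum_(i < n) f i x + f n x.
  by apply/funext => x; rewrite big_ord_recr.
split; first by apply: L1D => //; exact: f1.
by rewrite IntD//; [rewrite e1 big_ord_recr|exact: f1].
Qed.

Lemma bm_sum n (f : nat -> T -> R) : (forall i, (i < n)%N -> bounded_meas (f i)) ->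
  bounded_meas (fun x => \sum_(i < n) f i x).
Proof.
elim: n => [|n IH] fb.
  have -> : (fun x : T => \sum_(i < 0) f i x) = fun=> 0.
    by apply/funext => x; rewrite big_ord0.
  exact: bm_cst.
have -> : (fun x : T => \sum_(i < n.+1) f i x) = fun x => \sum_(i < n) f i x + f n x.
  by apply/funext => x; rewrite big_ord_recr.
by apply: bmD; [apply: IH => i h; apply: fb; exact: ltnW|exact: fb].
Qed.

Lemma L2_cvg_Int (f : nat -> T -> R) (g h : T -> R) : (forall n, L2 mu (f n)) ->
  L2 mu g -> L2 mu h -> \int[mu]_x ((f n x - g x) ^+ 2) @[n --> \oo] --> 0 ->
  \int[mu]_x (h x * f n x) @[n --> \oo] --> \int[mu]_x (h x * g x).
Proof.
move=> f2 g2 h2 D0; set Hh := \int[mu]_x (h x ^+ 2).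
have Hh0 : 0 <= Hh by apply: Rintegral_ge0 => x _; exact: sqr_ge0.
apply/cvgrPdist_le => e e0.
(* The weight in |h y| <= eta h^2 + y^2 / eta: the first term then integrates to at most e/2, and so
   does the second once the squared distance is below eta e / 2. The [+ 1] covers [Hh = 0]. *)
pose eta := e / (2 * (Hh + 1)).
have H1 : 0 < Hh + 1 by rewrite ltr_wpDl.
have eta0 : 0 < eta by rewrite divr_gt0// mulr_gt0.
have /cvgr0Pnorm_le/(_ (e / 2 * eta)) := D0.
move=> /(_ (mulr_gt0 (divr_gt0 e0 (ltr0Sn _ _)) eta0)); apply: filterS => n Dn.
have d2 := L2B (f2 n) g2; have hd := L2_L1M h2 d2.
rewrite distrC -IntB; [|exact: L2_L1M|exact: L2_L1M].
rewrite (@Int_ext _ _ _ _ _ (fun x => h x * (f n x - g x))); last by move=> x; ring.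
apply: le_trans (Int_norm hd) _.
apply: (@le_trans _ _ (\int[mu]_x (eta * h x ^+ 2 + eta^-1 * (f n x - g x) ^+ 2))).
  apply: Int_le; [exact: L1_norm|apply: L1D; apply: L1Zl; [by case: h2|by case: d2]|].
  move=> x; set y := f n x - g x; rewrite normrM.
  have := sqr_ge0 (eta * `|h x| - `|y|); rewrite -(real_normK (num_real (h x))).
  rewrite -[in X in _ -> X](real_normK (num_real y)) => hh.
  have -> : eta * `|h x| ^+ 2 + eta^-1 * `|y| ^+ 2 =
     eta^-1 * (eta * `|h x| - `|y|) ^+ 2 + 2 * (`|h x| * `|y|).
    by field; rewrite gt_eqF.
  have : 0 <= eta^-1 * (eta * `|h x| - `|y|) ^+ 2 by rewrite mulr_ge0// invr_ge0 ltW.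
  have : 0 <= `|h x| * `|y| by rewrite mulr_ge0.
  lra.
rewrite IntD; [|by apply: L1Zl; case: h2|by apply: L1Zl; case: d2].
rewrite !IntZl; [|by case: d2|by case: h2].
rewrite -/Hh.
have -> : e = e / 2 + e / 2 by field.
apply: lerD.
  have -> : eta * Hh = e / 2 * (Hh / (Hh + 1)) by rewrite /eta; field; rewrite gt_eqF.
  apply: ler_piMr; first by rewrite divr_ge0// ltW.
  by rewrite ler_pdivrMr// mul1r lerDl.
rewrite mulrC ler_pdivrMr//; apply: le_trans Dn; exact: ler_norm.
Qed.

(** Write f_n^2 = (f_n - g)^2 + 2 g f_n - g^2; the cross term converges by [L2_cvg_Int] with [h]
    equal to [g]. *)
Lemma L2_cvg_sqr (f : nat -> T -> R) (g : T -> R) : (forall n, L2 mu (f n)) ->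
  L2 mu g -> \int[mu]_x ((f n x - g x) ^+ 2) @[n --> \oo] --> 0 ->
  \int[mu]_x (f n x ^+ 2) @[n --> \oo] --> \int[mu]_x (g x ^+ 2).
Proof.
move=> f2 g2 D0; have h := L2_cvg_Int f2 g2 g2 D0.
have -> : (fun n => \int[mu]_x (f n x ^+ 2)) = (fun n => \int[mu]_x ((f n x - g x) ^+ 2)
    + 2 * \int[mu]_x (g x * f n x) - \int[mu]_x (g x ^+ 2)).
  apply/funext => n; have d2 := L2B (f2 n) g2; have gf := L2_L1M g2 (f2 n).
  rewrite -IntZl// -IntD; [|by case: d2|exact: L1Zl].
  rewrite -IntB; [|by apply: L1D; [case: d2|exact: L1Zl]|by case: g2].
  by apply: Int_ext => x; ring.
rewrite [X in _ --> X](_ : _ = 0 + 2 * \int[mu]_x (g x * g x) - \int[mu]_x (g x ^+ 2)); last first.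
  rewrite (@Int_ext _ _ _ _ (fun x => g x * g x) (fun x => g x ^+ 2))//; ring.
apply: cvgB; last exact: cvg_cst.
by apply: cvgD => //; apply: cvgM => //; exact: cvg_cst.
Qed.

End L2_sums_limits.

(** * Sums of Wiener increments over a partition *)

Section wiener_integral.
Context {R : realType} d (Omega : measurableType d) (P : probability Omega R).
Variables (T : R) (F : R -> set (set Omega)) (W : R -> Omega -> R).
Hypotheses (hF : filtration T F) (hW : wiener P T F W).
Implicit Types (r s : R) (xi : Omega -> R).

Let sF s : 0 <= s -> s <= T -> sigma_algebra setT (F s).
Proof. by move=> s0 sT; case: hF => + _ _; apply; rewrite in_itv/= s0. Qed.

Let FM s : 0 <= s -> s <= T -> F s `<=` @measurable d Omega.
Proof. by move=> s0 sT; case: hF => _ + _; apply; rewrite in_itv/= s0. Qed.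

Let FS r s : 0 <= r -> r <= s -> s <= T -> F r `<=` F s.
Proof. by move=> r0 rs sT; case: hF => _ _; apply. Qed.

Lemma wiener_wrt r s : 0 <= r -> r <= s -> s <= T -> measurable_wrt (F s) (W r).
Proof.
move=> r0 rs sT; apply: (measurable_wrt_sub (FS r0 rs sT)).
by case: hW => _ _ + _ _; apply; rewrite in_itv/= r0 (le_trans rs).
Qed.

Section increment.
Variables (r s : R).
Hypotheses (r0 : 0 <= r) (rs : r < s) (sT : s <= T).
Let X (w : Omega) := W s w - W r w.
Let sd := Num.sqrt (s - r).
Let sd0 : 0 < sd. Proof. by rewrite sqrtr_gt0 subr_gt0. Qed.

Let mX : measurable_fun setT X.
Proof.
have s0 : 0 <= s by rewrite (le_trans r0)// ltW.
apply: (measurable_wrt_fun (FM s0 sT)); apply: measurable_wrtB.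
- exact: sF.
- exact: wiener_wrt.
- by apply: wiener_wrt => //; exact: ltW.
Qed.

Lemma ge0_integral_increment (g : R -> R) : measurable_fun setT g ->
  (forall x, 0 <= g x) ->
  (\int[P]_w (g (X w))%:E = \int[lebesgue_measure]_x (g x * normal_pdf 0 sd x)%:E)%E.
Proof.
move=> mg g0.
have mX' : measurable_fun setT (X : Omega -> measurableTypeR R) by exact: mX.
pose X' : {mfun Omega >-> measurableTypeR R} :=
  HB.pack (X : Omega -> measurableTypeR R) (isMeasurableFun.Build _ _ _ _ _ mX').
have mg' : measurable_fun setT (fun x => (g x)%:E) by exact/measurable_EFinP.
under [RHS]eq_integral do rewrite EFinM.
rewrite -(@ge0_integral_normal _ sd)//.
transitivity (\int[distribution P X']_x (g x)%:E)%E.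
  by rewrite ge0_integral_distribution// => x; rewrite lee_fin.
apply: eq_measure_integral => A mA _.
by case: hW => _ _ _ + _; apply.
Qed.

Lemma L1_increment_sqr : L1 P (fun w => X w ^+ 2) /\ \int[P]_w (X w ^+ 2) = s - r.
Proof.
have e : (\int[P]_w (X w ^+ 2)%:E = (s - r)%:E)%E.
  rewrite (ge0_integral_increment (g := fun x => x ^+ 2)).
  - by rewrite normal_second_moment// sqr_sqrtr// subr_ge0 ltW.
  - exact: measurable_funX.
  - by move=> x; exact: sqr_ge0.
split; last by rewrite /Rintegral e.
apply: L1_of_lty; [exact: measurable_funX|by move=> w; exact: sqr_ge0|].
by rewrite e ltry.
Qed.

(** [ge0_integral_increment] handles nonnegative integrands; the mean is obtained by comparing the
    expectations of |X| + X and |X|. *)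
Lemma L1_increment : L1 P X /\ \int[P]_w X w = 0.
Proof.
have X2 : L2 P X by split=> //; case: L1_increment_sqr.
have X1 := L2_L1 (mass_lty P) X2; split=> //.
have aX1 := L1_norm X1.
have e1 := @ge0_integral_increment (fun x => `|x|) _ _.
have e2 := @ge0_integral_increment (fun x => `|x| + x) _ _.
have mpdf := @measurable_normal_pdf R 0 sd.
have f1 := normal_first_moment sd0.
have ip : lebesgue_measure.-integrable setT
    (EFin \o (fun x : R => `|x| * normal_pdf 0 sd x)).
  apply/integrableP; split.
    by apply/measurable_EFinP/measurable_funM => //; exact: normr_measurable.
  apply: (@le_lt_trans _ _ (\int[P]_w `|X w|%:E)%E); last by rewrite IntE// ltry.
  rewrite e1//.
    rewrite le_eqVlt; apply/orP; left; apply/eqP; apply: eq_integral => x _.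
    by rewrite gee0_abs// lee_fin mulr_ge0// normal_pdf_ge0.
have ip2 : lebesgue_measure.-integrable setT
    (EFin \o (fun x : R => x * normal_pdf 0 sd x)).
  apply: (le_integrable measurableT _ _ ip).
    by apply/measurable_EFinP/measurable_funM.
  by move=> x _; rewrite lee_fin !normrM normr_id.
have : \int[P]_w (`|X w| + X w) = \int[P]_w `|X w|.
  congr fine; rewrite e1//.
  rewrite e2.
  - under eq_integral do rewrite mulrDl.
    by rewrite integralD_EFin// f1 adde0.
  - by apply: measurable_funD => //; exact: normr_measurable.
  - by move=> x; have := ler_norm (- x); rewrite normrN; lra.
rewrite IntD// => h; lra.
Qed.

Lemma Int_indep_increment xi : measurable_wrt (F r) xi -> L1 P xi ->
  [/\ L1 P (fun w => xi w * X w), \int[P]_w (xi w * X w) = 0,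
      L1 P (fun w => xi w * X w ^+ 2) &
      \int[P]_w (xi w * X w ^+ 2) = (s - r) * \int[P]_w xi w].
Proof.
move=> mxi xi1; have [X1 X10] := L1_increment; have [X2 X20] := L1_increment_sqr.
have ind A B : measurable A -> measurable B ->
    P (xi @^-1` A `&` X @^-1` B) = (P (xi @^-1` A) * P (X @^-1` B))%E.
  move=> mA mB; case: hW => _ _ _ _; apply => //; exact: mxi.
have [a1 a2] := @indep_Int _ _ _ P xi X X id mX (@measurable_id _ _ _) erefl xi1 X1 ind.
have [b1 b2] := @indep_Int _ _ _ P xi X (fun w => X w ^+ 2) (fun x => x ^+ 2) mX
  (@measurable_funX _ _ _ _ id 2 (@measurable_id _ _ _)) erefl xi1 X2 ind.
by split=> //; [rewrite a2 X10 mulr0|rewrite b2 X20 mulrC].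
Qed.

End increment.

(** Adding one increment preserves orthogonality to the past and adds its variance, since it is
    independent of what is known at [r]. Measurability of [c] is asked only if r < s: clamping a
    partition creates steps of length zero whose coefficient is not yet known. *)
Lemma Int_step r s (c S : Omega -> R) : 0 <= r -> r <= s -> s <= T ->
  (r < s -> measurable_wrt (F r) c) -> bounded_meas c ->
  measurable_wrt (F r) S -> L2 P S ->
  [/\ measurable_wrt (F s) (fun w => S w + c w * (W s w - W r w)),
      L2 P (fun w => S w + c w * (W s w - W r w)),
      (forall xi, measurable_wrt (F r) xi -> L2 P xi ->
        \int[P]_w (xi w * (S w + c w * (W s w - W r w))) = \int[P]_w (xi w * S w))
    & \int[P]_w ((S w + c w * (W s w - W r w)) ^+ 2) =
      \int[P]_w (S w ^+ 2) + (s - r) * \int[P]_w (c w ^+ 2)].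
Proof.
move=> r0; rewrite le_eqVlt => /predU1P[<-|rs] sT mc bc mS S2.
  have -> : (fun w => S w + c w * (W r w - W r w)) = S.
    by apply/funext => w; rewrite subrr mulr0 addr0.
  split=> //.
  - by move=> xi _ _; apply: Int_ext => w; rewrite subrr mulr0 addr0.
  - rewrite subrr mul0r addr0; apply: Int_ext => w; rewrite subrr mulr0 addr0//.
have s0 : 0 <= s by rewrite (le_trans r0)// ltW.
have rT : r <= T by rewrite (le_trans _ sT)// ltW.
have {}mc := mc rs.
have c2 : L2 P c by apply: bm_L2 => //; exact: mass_lty.
have mdW : measurable_wrt (F s) (fun w => W s w - W r w).
  by apply: measurable_wrtB; [exact: sF|exact: wiener_wrt|by apply: wiener_wrt => //; exact: ltW].
have FF := FS r0 (ltW rs) sT.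
have mres : measurable_wrt (F s) (fun w => S w + c w * (W s w - W r w)).
  apply: measurable_wrtD; [exact: sF|exact: measurable_wrt_sub mS|].
  by apply: measurable_wrtM => //; [exact: sF|exact: measurable_wrt_sub mc].
have [_ _ cc1 cc2] :=
  Int_indep_increment r0 rs sT (measurable_wrtM (sF r0 rT) mc mc) (L2_L1M c2 c2).
have cX2 : L2 P (fun w => c w * (W s w - W r w)).
  split; last by apply: L1_ext cc1 => w; ring.
  apply: (measurable_wrt_fun (FM s0 sT)); apply: measurable_wrtM => //; first exact: sF.
  exact: measurable_wrt_sub mc.
have orth xi : measurable_wrt (F r) xi -> L2 P xi ->
    \int[P]_w (xi w * (c w * (W s w - W r w))) = 0.
  move=> mxi xi2.
  have [_ h _ _] :=
    Int_indep_increment r0 rs sT (measurable_wrtM (sF r0 rT) mxi mc) (L2_L1M xi2 c2).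
  by rewrite -[RHS]h; apply: Int_ext => w; ring.
split=> //.
- exact: L2D.
- move=> xi mxi xi2.
  rewrite (@Int_ext _ _ _ _ _ (fun w => xi w * S w + xi w * (c w * (W s w - W r w)))).
    by rewrite IntD; [rewrite orth// addr0|exact: L2_L1M|exact: L2_L1M].
  by move=> w; rewrite mulrDr.
- rewrite (@Int_ext _ _ _ _ _ (fun w => S w ^+ 2 + (2 * (S w * (c w * (W s w - W r w))) +
      c w * c w * (W s w - W r w) ^+ 2))); last by move=> w; ring.
  have h1 : L1 P (fun w => S w * (c w * (W s w - W r w))) by exact: L2_L1M.
  rewrite IntD; [|by case: S2|by apply: L1D => //; exact: L1Zl].
  rewrite IntD//; last exact: L1Zl.
  by rewrite IntZl// orth// mulr0 add0r cc2.
Qed.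

Section partition.
Variables (a : nat -> R) (c : nat -> Omega -> R) (n : nat).
Hypothesis a0T : forall i, (i <= n)%N -> 0 <= a i <= T.
Hypothesis a_mono : forall i, (i < n)%N -> a i <= a i.+1.
Hypothesis c_bm : forall i, (i < n)%N -> bounded_meas (c i).
Hypothesis c_wrt : forall i, (i < n)%N -> a i < a i.+1 -> measurable_wrt (F (a i)) (c i).

Let S k w := \sum_(i < k) c i w * (W (a i.+1) w - W (a i) w).

Lemma partition_integral k : (k <= n)%N ->
  [/\ measurable_wrt (F (a k)) (S k), L2 P (S k), a 0%N <= a k,
      (forall xi, measurable_wrt (F (a 0%N)) xi -> L2 P xi ->
        \int[P]_w (xi w * S k w) = 0)
    & \int[P]_w (S k w ^+ 2) = \sum_(i < k) (a i.+1 - a i) * \int[P]_w (c i w ^+ 2)].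
Proof.
elim: k => [|k IH] kn.
  have S0 : S 0%N = fun=> 0 by apply/funext => w; rewrite /S big_ord0.
  have /andP[a00 a0T'] := a0T kn.
  have z : \int[P]_w (0 : R) = 0 by rewrite /Rintegral integral0.
  rewrite S0; split => //.
  - by apply: measurable_wrt_cst; exact: sF.
  - by apply: bm_L2; [exact: mass_lty|exact: bm_cst].
  - by move=> xi _ _; rewrite -[RHS]z; apply: Int_ext => w; rewrite mulr0.
  - by rewrite big_ord0 -[RHS]z; apply: Int_ext => w; rewrite expr0n.
have [mS S2 aak orth sq] := IH (ltnW kn).
have /andP[ak0 akT] := a0T (ltnW kn); have /andP[ak10 ak1T] := a0T kn.
have /andP[a00 a0T'] := a0T (leq0n n).
have [m1 m2 m3 m4] := Int_step ak0 (a_mono kn) ak1T (c_wrt kn) (c_bm kn) mS S2.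
have SE : S k.+1 = fun w => S k w + c k w * (W (a k.+1) w - W (a k) w).
  by apply/funext => w; rewrite /S big_ord_recr.
rewrite SE; split => //.
- exact: le_trans aak (a_mono kn).
- move=> xi mxi xi2; rewrite m3//; first exact: orth.
  by apply: (measurable_wrt_sub _ mxi); exact: FS.
- by rewrite m4 sq big_ord_recr.
Qed.

End partition.

End wiener_integral.

(** * Ito integrals of simple processes and their limits *)

Section simple_integral.
Context {R : realType} d (Omega : measurableType d) (P : probability Omega R).
Variables (T : R) (F : R -> set (set Omega)) (W : R -> Omega -> R).
Hypotheses (hF : filtration T F) (hW : wiener P T F W).
Variables (t : R).
Hypotheses (t0 : 0 <= t) (tT : t <= T).
Local Notation mu := (leb_on t T \x P)%E.

Section simple.
Variable h : simple_process (R := R) (Omega := Omega).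
Hypothesis hh : simple_process_on t T F h.
Let n := sp_size h.
Let tau := sp_time h.
Let c := sp_coef h.

Let tau_mono i j : (i <= j)%N -> (j <= n)%N -> tau i <= tau j.
Proof.
elim: j => [|j IH]; first by rewrite leqn0 => /eqP ->.
rewrite leq_eqVlt => /predU1P[->//|]; rewrite ltnS => ij jn.
apply: le_trans (IH ij (ltnW jn)) _.
by case: hh => _ _ + _ _; apply.
Qed.

Let tau_ge i : (i <= n)%N -> t <= tau i.
Proof. by move=> i_n; case: hh => <- _ _ _ _; exact: tau_mono. Qed.

Let tau_le i : (i <= n)%N -> tau i <= T.
Proof. by move=> i_n; case: hh => _ <- _ _ _; exact: tau_mono. Qed.

Let c_wrt i : (i < n)%N -> measurable_wrt (F (tau i)) (c i).
Proof. by case: hh => _ _ _ + _; apply. Qed.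

Let c_bm i : (i < n)%N -> bounded_meas (c i).
Proof.
move=> i_n; split; last by case: hh => _ _ _ _; apply.
apply: (measurable_wrt_fun (G := F (tau i))); last exact: c_wrt.
case: hF => _ + _; apply; rewrite in_itv/=.
by rewrite (le_trans t0 (tau_ge (ltnW i_n))) tau_le// ltnW.
Qed.

Section clamp_times.
Variables (r s : R).
Hypotheses (tr : t <= r) (rs : r <= s) (sT : s <= T).
(** The partition clamped to [r, s]. Steps outside this segment collapse, and the increment of the
    simple integral from [r] to [s] becomes one sum over the clamped partition. *)
Let a i := Num.min (Num.max (tau i) r) s.

Let a_ge i : r <= a i. Proof. by rewrite /a le_min rs le_max lexx orbT. Qed.
Let a_le i : a i <= s. Proof. by rewrite /a ge_min lexx orbT. Qed.

Let a0T i : (i <= n)%N -> 0 <= a i <= T.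
Proof.
by move=> _; rewrite (le_trans _ (a_ge i)) ?(le_trans t0)//= (le_trans (a_le i)).
Qed.

Let a_mono i : (i < n)%N -> a i <= a i.+1.
Proof.
move=> i_n; have h1 : tau i <= tau i.+1 by exact: tau_mono.
rewrite /a le_min a_le andbT ge_min; apply/orP; left.
by rewrite ge_max !le_max h1 lexx orbT.
Qed.

Let a_wrt i : (i < n)%N -> a i < a i.+1 -> measurable_wrt (F (a i)) (c i).
Proof.
move=> i_n aa; apply: (measurable_wrt_sub _ (c_wrt i_n)).
have /andP[_ aT] := a0T (ltnW i_n).
(* A step of positive length starts before [s], so clamping can only have moved its left end
   upwards, to a time when the coefficient is known. *)
have : tau i <= a i.
  have : a i < s by rewrite (lt_le_trans aa).
  rewrite /a gt_min ltxx orbF => ms.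
  by rewrite le_min le_max lexx/= (le_trans _ (ltW ms))// le_max lexx.
case: hF => _ _ H ta; apply: H => //; exact: le_trans t0 (tau_ge (ltnW i_n)).
Qed.

Lemma sp_integralB w : sp_integral W h s w - sp_integral W h r w =
  \sum_(i < n) c i w * (W (a i.+1) w - W (a i) w).
Proof.
rewrite /sp_integral -sumrB; apply: eq_bigr => i _.
have e (x : R) : W (Num.min x s) w - W (Num.min x r) w =
    W (Num.min (Num.max x r) s) w - W r w.
  case: (leP x r) => xr.
    by rewrite (min_l (le_trans xr rs)) (min_l rs) !subrr.
  by [].
have e1 := e (tau i); have e2 := e (tau i.+1).
rewrite -/(tau _) -mulrBr; congr (_ * _); rewrite /a.
by lra.
Qed.

Lemma sp_integral_facts : let D w := sp_integral W h s w - sp_integral W h r w in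
  [/\ L2 P D,
      (forall xi, measurable_wrt (F r) xi -> L2 P xi -> \int[P]_w (xi w * D w) = 0)
    & \int[P]_w (D w ^+ 2) = \sum_(i < n) (a i.+1 - a i) * \int[P]_w (c i w ^+ 2)].
Proof.
move=> D; have DE : D = fun w => \sum_(i < n) c i w * (W (a i.+1) w - W (a i) w).
  by apply/funext => w; exact: sp_integralB.
have := partition_integral hF hW a0T a_mono (fun i => @c_bm i) a_wrt (leqnn n).
move=> [_ D2 _ orth sq]; rewrite DE; split=> // xi mxi xi2; apply: orth => //.
apply: (measurable_wrt_sub _ mxi).
have /andP[_ aT] := a0T (leq0n n).
by case: hF => _ _; apply => //; exact: le_trans tr.
Qed.

End clamp_times.

Lemma sp_integral_start w : sp_integral W h t w = 0.
Proof.
rewrite /sp_integral big1// => i _.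
by rewrite !min_r ?subrr ?mulr0//; apply: tau_ge; rewrite // ltnW.
Qed.

Lemma bm_sp_val : bounded_meas (fun q : R * Omega => sp_val h q.1 q.2).
Proof.
apply: (@bm_sum _ _ _ n (fun i q => c i q.2 * \1_(`]tau i, tau i.+1]%classic : set R) q.1)).
move=> i i_n; apply: bmM.
  have [mc [C hC]] := c_bm i_n.
  by split; [exact: measurableT_comp|exists C => q; exact: hC].
split; last by exists 1 => q; rewrite indicE; case: (_ \in _); rewrite ?normr1 ?normr0.
by apply: measurableT_comp => //; apply: measurable_indic; exact: measurable_itv.
Qed.

Let sqr_sum_orth (x : nat -> R) k : (forall i j, (i < j < k)%N -> x i * x j = 0) ->
  (\sum_(i < k) x i) ^+ 2 = \sum_(i < k) x i ^+ 2.
Proof.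
elim: k => [|k IH] xx; first by rewrite !big_ord0 expr0n.
rewrite !big_ord_recr/= sqrrD IH; last first.
  by move=> i j /andP[ij jk]; apply: xx; rewrite ij ltnS ltnW.
suff -> : (\sum_(i < k) x i) * x k = 0 by rewrite mul0rn addr0.
by rewrite mulr_suml big1// => i _; apply: xx; rewrite ltn_ord ltnSn.
Qed.

Let sp_val_sqr r w : sp_val h r w ^+ 2 =
  \sum_(i < n) (\1_(`]tau i, tau i.+1]%classic : set R) r * c i w ^+ 2).
Proof.
rewrite /sp_val -/n.
rewrite (sqr_sum_orth (x := fun i => c i w * \1_(`]tau i, tau i.+1]%classic : set R) r)).
  apply: eq_bigr => i _; rewrite exprMn mulrC; congr (_ * _).
  by rewrite indicE; case: (_ \in _); rewrite ?expr1n ?expr0n.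
move=> i j /andP[ij jn]; rewrite !indicE.
case: (boolP (r \in `]tau i, tau i.+1]%classic)) => h1; last by rewrite mulr0 mul0r.
case: (boolP (r \in `]tau j, tau j.+1]%classic)) => h2; last by rewrite !mulr0.
move: h1 h2; rewrite !inE/= !in_itv/= => /andP[_ h1] /andP[h2 _].
have := tau_mono ij (ltnW jn) => h3.
by have := lt_le_trans h2 (le_trans h1 h3); rewrite ltxx.
Qed.

(** The Ito isometry for simple processes: each side is the sum of E[c_i^2] times the length of the
    i-th step cut off at [s], the left one because the steps are disjoint. *)
Lemma Int_sp_val_sqr s : t <= s -> s <= T ->
  \int[mu]_q ((q.1 <= s)%R%:R * sp_val h q.1 q.2 ^+ 2) =
  \int[P]_w (sp_integral W h s w ^+ 2).
Proof.
move=> ts sT; have [_ _] := sp_integral_facts (lexx t) ts sT.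
under eq_Rintegral do rewrite sp_integral_start subr0.
move=> ->.
pose a i := Num.min (Num.max (tau i) t) s.
pose k i (r : R) : R := (r <= s)%R%:R * \1_(`]tau i, tau i.+1]%classic : set R) r.
have kb i : bounded_meas (k i).
  apply: bmM; first exact: bm_ler.
  split; first by apply: measurable_indic; exact: measurable_itv.
  by exists 1 => q; rewrite indicE; case: (_ \in _); rewrite ?normr1 ?normr0.
have k1 i : L1 (leb_on t T) (k i) by apply: bm_L1 => //; exact: mass_lty.
have c1 i : (i < n)%N -> L1 P (fun w => c i w ^+ 2).
  move=> i_n; have [] : L2 P (c i) by apply: bm_L2; [exact: mass_lty|exact: c_bm].
  by [].
have kc i (i_n : (i < n)%N) := L1_tensor (k1 i) (c1 i i_n).
rewrite (@Int_ext _ _ _ _ _ (fun q => \sum_(i < n) k i q.1 * c i q.2 ^+ 2)); last first.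
  by move=> q; rewrite sp_val_sqr mulr_sumr; apply: eq_bigr => i _; rewrite mulrA.
have [_ ->] := @Int_sum _ _ _ mu n (fun i q => k i q.1 * c i q.2 ^+ 2) kc.
apply: eq_bigr => -[i i_n] _ /=.
rewrite -Int_fubini1//=; last exact: kc.
have -> : \int[leb_on t T]_r \int[P]_w (k i r * c i w ^+ 2) =
    \int[leb_on t T]_r (\int[P]_w (c i w ^+ 2) * k i r).
  by apply: Int_ext => r; rewrite IntZl; [rewrite mulrC|exact: c1].
rewrite IntZl// mulrC; congr (_ * _).
have ti : t <= tau i by apply: tau_ge; exact: ltnW.
have ti1 : t <= tau i.+1 by exact: tau_ge.
have tii : tau i <= tau i.+1 by exact: tau_mono.
(* Cutting the i-th step at [s] gives the clamped step; the lower clamp at [t] does nothing, since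
   the partition starts at [t]. *)
have kE : k i = \1_(`]a i, a i.+1]%classic : set R).
  apply/funext => r; rewrite /k !indicE /a (max_l ti) (max_l ti1).
  have -> : (r \in `]tau i, tau i.+1]%classic) = (tau i < r <= tau i.+1).
    by apply/idP/idP; rewrite inE/= in_itv.
  have -> : (r \in `]Num.min (tau i) s, Num.min (tau i.+1) s]%classic) =
      (Num.min (tau i) s < r <= Num.min (tau i.+1) s).
    by apply/idP/idP; rewrite inE/= in_itv.
  rewrite gt_min le_min; case: (leP r s) => /= rs.
    by rewrite mul1r andbT orbF.
  by rewrite mul0r andbF andbF.
rewrite kE /Rintegral integral_indic//.
rewrite setIT; transitivity (fine (lebesgue_measure (`]a i, a i.+1]%classic : set R))).
  rewrite -[LHS]/(fine (lebesgue_measure ((`]a i, a i.+1]%classic : set R) `&` `[t, T]%classic))).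
  rewrite setIidl//.
  move=> x /=; rewrite !in_itv/= => /andP[h1 h2]; apply/andP; split.
    by rewrite (le_trans _ (ltW h1))// /a le_min ts le_max lexx orbT.
  by rewrite (le_trans h2)// /a ge_min sT orbT.
rewrite lebesgue_measure_itv/= lte_fin; case: ltP => //= h1.
apply/eqP; rewrite eq_sym subr_eq0 eq_le h1 /a /= (max_l ti) (max_l ti1).
by rewrite le_min !ge_min lexx tii orbT.
Qed.

End simple.

Section ito.
Variables (H Y : R -> Omega -> R) (Hb : R * Omega -> R).
Hypothesis ito : ito_integral P t T F W H Y.
Hypothesis bHb : bounded_meas Hb.
Hypothesis HbE : forall s w, s \in `[t, T] -> H s w = Hb (s, w).
Hypothesis Y2 : forall s, s \in `[t, T] -> L2 P (Y s).

Let cvg_real d' (T' : measurableType d') (m : {measure set T' -> \bar R})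
    (f : nat -> T' -> R) (g : T' -> R) :
  (forall n, L2 m (f n)) -> L2 m g ->
  ((\int[m]_x ((f n x - g x) ^+ 2)%:E)%E @[n --> \oo] --> 0%E) ->
  \int[m]_x ((f n x - g x) ^+ 2) @[n --> \oo] --> 0.
Proof. by move=> f2 g2 /fine_cvg. Qed.

(** Both properties hold for simple integrals and pass to the L^2 limit: orthogonality by
    convergence of the products with a fixed [xi], the isometry by convergence of the second moments
    on each side. [Hb] is a bounded version of the integrand on the whole product space. *)
Lemma ito_martingale_isometry :
  (forall r s xi, t <= r -> r <= s -> s <= T -> measurable_wrt (F r) xi -> L2 P xi ->
    \int[P]_w (xi w * Y s w) = \int[P]_w (xi w * Y r w)) /\
  (forall s, t <= s -> s <= T ->
    \int[P]_w (Y s w ^+ 2) = \int[mu]_q ((q.1 <= s)%R%:R * Hb q ^+ 2)).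
Proof.
have [_ _ mY [h [hs hH hY]]] := ito.
have SI2 n s : t <= s -> s <= T -> L2 P (sp_integral W (h n) s).
  move=> ts sT; have [+ _ _] := sp_integral_facts (hs n) (lexx t) ts sT.
  by congr L2; apply/funext => w; rewrite sp_integral_start// subr0.
have YL s : t <= s -> s <= T -> L2 P (Y s) by move=> ts sT; apply: Y2; rewrite in_itv/= ts.
have cY s : t <= s -> s <= T ->
    \int[P]_w ((sp_integral W (h n) s w - Y s w) ^+ 2) @[n --> \oo] --> 0.
  move=> ts sT; apply: (cvg_real (fun n => SI2 n s ts sT) (YL s ts sT)).
  by apply: hY; rewrite in_itv/= ts.
split.
- move=> r s xi tr rs sT mxi xi2.
  have ts := le_trans tr rs; have rT := le_trans rs sT.
  have l1 := L2_cvg_Int (fun n => SI2 n s ts sT) (YL s ts sT) xi2 (cY s ts sT).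
  have l2 := L2_cvg_Int (fun n => SI2 n r tr rT) (YL r tr rT) xi2 (cY r tr rT).
  suff e : (fun n => \int[P]_w (xi w * sp_integral W (h n) s w)) =
      (fun n => \int[P]_w (xi w * sp_integral W (h n) r w)).
    by rewrite e in l1; exact: (cvg_unique _ l1 l2).
  apply/funext => n; have [_ orth _] := sp_integral_facts (hs n) tr rs sT.
  have := orth xi mxi xi2.
  rewrite (@Int_ext _ _ _ _ _ (fun w => xi w * sp_integral W (h n) s w
    - xi w * sp_integral W (h n) r w)); last by move=> w; rewrite mulrBr.
  rewrite IntB; [|by apply: L2_L1M => //; exact: SI2|by apply: L2_L1M => //; exact: SI2].
  by move/eqP; rewrite subr_eq0 => /eqP.
- move=> s ts sT.
  have muoo := strip_lty P t T.
  pose f n (q : R * Omega) := (q.1 <= s)%R%:R * sp_val (h n) q.1 q.2.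
  pose g (q : R * Omega) := (q.1 <= s)%R%:R * Hb q.
  have bi : bounded_meas (fun q : R * Omega => (q.1 <= s)%R%:R : R) by exact: bm_ler.
  have bv n := bm_sp_val (hs n).
  have f2 n : L2 mu (f n) by apply: bm_L2 => //; exact: bmM.
  have g2 : L2 mu g by apply: bm_L2 => //; exact: bmM.
  have v2 n : L2 mu (fun q : R * Omega => sp_val (h n) q.1 q.2 - Hb q).
    by apply: bm_L2 => //; exact: bmB.
  (* Tonelli rewrites the iterated extended integral of [ito_integral] as one real integral over the
     strip. *)
  have E n : (\int[P]_w \int[lebesgue_measure]_(s in `[t, T])
        ((sp_val (h n) s w - H s w) ^+ 2)%:E)%E =
      (\int[mu]_q ((sp_val (h n) q.1 q.2 - Hb q) ^+ 2))%:E.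
    rewrite -IntE; last by case: (v2 n).
    have mv : measurable_fun setT (fun q : R * Omega => ((sp_val (h n) q.1 q.2 - Hb q) ^+ 2)%:E).
      by apply/measurable_EFinP; apply: measurable_funX; exact: L2_meas (v2 n).
    rewrite fubini_tonelli2//; last by move=> q; rewrite lee_fin sqr_ge0.
    apply: eq_integral => w _; rewrite /fubini_G ge0_integral_leb_on.
    - by apply: eq_integral => r; rewrite inE/= => rtT; rewrite HbE.
    - by apply: (measurableT_comp mv); exact: pair2_measurable.
    - by move=> r; rewrite lee_fin sqr_ge0.
  have c0 : \int[mu]_q ((f n q - g q) ^+ 2) @[n --> \oo] --> 0.
    have c1 : \int[mu]_q ((sp_val (h n) q.1 q.2 - Hb q) ^+ 2) @[n --> \oo] --> 0.
      by have : (fun n => (\int[mu]_q ((sp_val (h n) q.1 q.2 - Hb q) ^+ 2))%:E) @ \oo --> 0%E;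
        [under eq_fun do rewrite -E|move/fine_cvg].
    apply: (squeeze_cvgr _ (cvg_cst 0) c1); apply: nearW => n; apply/andP; split.
      by apply: Rintegral_ge0 => q _; exact: sqr_ge0.
    apply: Int_le; [by case: (L2B (f2 n) g2)|by case: (v2 n)|].
    move=> q; rewrite /f /g; case: (q.1 <= s); first by rewrite !mul1r.
    by rewrite !mul0r subrr expr0n sqr_ge0.
  have l1 := L2_cvg_sqr f2 g2 c0.
  have l2 := L2_cvg_sqr (fun n => SI2 n s ts sT) (YL s ts sT) (cY s ts sT).
  have -> : \int[mu]_q ((q.1 <= s)%R%:R * Hb q ^+ 2) = \int[mu]_q (g q ^+ 2).
    apply: Int_ext => q; rewrite /g; case: (q.1 <= s); first by rewrite !mul1r.
    by rewrite !mul0r expr0n.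
  suff e : (fun n => \int[P]_w (sp_integral W (h n) s w ^+ 2)) =
      (fun n => \int[mu]_q (f n q ^+ 2)).
    by rewrite e in l2; exact: (cvg_unique _ l2 l1).
  apply/funext => n; rewrite -(Int_sp_val_sqr (hs n))//.
  apply: Int_ext => q; rewrite /f; case: (q.1 <= s); first by rewrite !mul1r.
  by rewrite !mul0r expr0n.
Qed.

End ito.

End simple_integral.

(** * Calculus on a segment *)

Section clamp.
Context {R : realType}.
Implicit Types (a b x y : R) (f g : R -> R).

Definition clamp a b x := Num.max a (Num.min x b).

Lemma clamp_in a b x : a <= b -> clamp a b x \in `[a, b].
Proof. by move=> ab; rewrite in_itv/= /clamp le_max lexx ge_max ab ge_min lexx orbT. Qed.

Lemma clamp_id a b x : x \in `[a, b] -> clamp a b x = x.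
Proof. by rewrite in_itv/= /clamp => /andP[ax xb]; rewrite (min_l xb) max_r. Qed.

Lemma continuous_clamp a b : continuous (clamp a b).
Proof.
have lip x y : `|clamp a b x - clamp a b y| <= `|x - y|.
  wlog xy : x y / x <= y.
    move=> h; have [|/ltW yx] := leP x y; first exact: h.
    by rewrite distrC [leRHS]distrC; exact: h.
  have mono : clamp a b x <= clamp a b y.
    by rewrite /clamp ge_max !le_max lexx /= le_min !ge_min xy lexx !orbT.
  rewrite !ler0_norm ?subr_le0// !opprB lerBlDl /clamp ge_max; apply/andP; split.
    by rewrite -[a in a <= _]addr0 lerD ?subr_ge0// le_max lexx.
  rewrite maxC addr_maxl le_max; apply/orP; left.
  by case: (leP x b) => xb; rewrite ge_min ?subrKC ?lexx// lerDl subr_ge0 xy orbT.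
move=> x; apply/cvgrPdist_le => e e0; near=> y; apply: le_trans (lip x y) _.
by near: y; apply/nbhs_ballP; exists e => //= z; rewrite /ball/= => /ltW.
Unshelve. all: by end_near. Qed.

Lemma continuous_comp_clamp a b f : a <= b -> {within `[a, b], continuous f} ->
  continuous (f \o clamp a b).
Proof.
move=> ab /subspace_continuousP cf x.
apply: (cvg_comp (clamp a b) f) (cf _ (clamp_in x ab)).
move=> S hS; have hc : \forall y \near x, `[a, b]%classic (clamp a b y) -> S (clamp a b y).
  exact: (@continuous_clamp a b x _ hS).
by apply: filterS hc => y; apply; exact: clamp_in.
Qed.

Lemma continuous_funM f g : continuous f -> continuous g -> continuous (fun x => f x * g x).
Proof. by move=> cf cg x; apply: cvgM; [exact: cf|exact: cg]. Qed.

Lemma continuous_funD f g : continuous f -> continuous g -> continuous (fun x => f x + g x).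
Proof. by move=> cf cg x; apply: cvgD; [exact: cf|exact: cg]. Qed.

Lemma continuous_funN f : continuous f -> continuous (fun x => - f x).
Proof. by move=> cf x; apply: cvgN; exact: cf. Qed.

Lemma continuous_funX f n : continuous f -> continuous (fun x => f x ^+ n).
Proof.
by move=> cf x; apply: (cvg_comp f (fun y : R => y ^+ n) (cf x)); exact: exprn_continuous.
Qed.

Lemma continuous_fun_cst (c : R) : continuous (fun _ : R => c).
Proof. by move=> x; exact: cvg_cst. Qed.

Lemma continuous_bounded_clamp a b f : a <= b -> continuous f ->
  exists C, forall x, x \in `[a, b] -> `|f x| <= C.
Proof.
move=> ab cf; have cn : {within `[a, b], continuous (fun x => `|f x|)}.
  by apply: continuous_subspaceT => x; apply: cvg_norm; exact: cf.
have [c _ hc] := EVT_max ab cn.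
by exists `|f c|.
Qed.

End clamp.

Ltac prove_continuous := repeat match goal with
  | |- continuous (fun _ => ?c) => exact: (@continuous_fun_cst _ c)
  | h : continuous ?f |- continuous (fun r => ?f r) => exact: h
  | |- continuous (fun r => @?f r + @?g r) => apply: (@continuous_funD _ f g)
  | |- continuous (fun r => - @?f r) => apply: (@continuous_funN _ f)
  | |- continuous (fun r => @?f r * @?g r) => apply: (@continuous_funM _ f g)
  | |- continuous (fun r => @?f r ^+ _) => apply: (@continuous_funX _ f)
  end.


(** * Derivatives relative to a segment *)

Section derivative_within_theory.
Context {R : realType}.
Implicit Types (a b x y : R) (f g : R -> R).

(** Properness makes the limit in [deriv_within] unique. Left of [b] small positive increments are
    allowed, at [b] small negative ones. *)
Lemma within_itv_proper a b x : a < b -> x \in `[a, b] ->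
  ProperFilter (within [set h | `[a, b]%classic (x + h)] (0 : R)^').
Proof.
move=> ab; rewrite in_itv/= => /andP[ax xb]; apply: Build_ProperFilter_ex => S.
rewrite /within/= => /nbhs_ballP[e /= e0 he].
have [xb'|bx] := ltP x b.
- pose h := Num.min (e / 2) (b - x).
  have h0 : 0 < h by rewrite lt_min divr_gt0//= subr_gt0.
  exists h; apply: he; rewrite /ball/=.
  + rewrite sub0r normrN gtr0_norm//.
    apply: (@le_lt_trans _ _ (e / 2)); first by rewrite /h ge_min lexx.
    by rewrite ltr_pdivrMr// ltr_pMr// ltr1n.
  + by rewrite gt_eqF.
  + have : h <= b - x by rewrite /h ge_min lexx orbT.
    by rewrite in_itv/= => hb; apply/andP; split; lra.
- pose h := Num.min (e / 2) (x - a).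
  have h0 : 0 < h by rewrite lt_min divr_gt0//= subr_gt0 (lt_le_trans ab).
  exists (- h); apply: he; rewrite /ball/=.
  + rewrite sub0r opprK gtr0_norm//.
    apply: (@le_lt_trans _ _ (e / 2)); first by rewrite /h ge_min lexx.
    by rewrite ltr_pdivrMr// ltr_pMr// ltr1n.
  + by rewrite oppr_eq0 gt_eqF.
  + have : h <= x - a by rewrite /h ge_min lexx orbT.
    by rewrite in_itv/= => hb; apply/andP; split; lra.
Qed.

Lemma is_derive_within a b x f df : a < b -> x \in `[a, b] -> is_derive x 1 f df ->
  derivable_within `[a, b] f x /\ deriv_within `[a, b] f x = df.
Proof.
move=> ab xab [fx dfx]; have pf := within_itv_proper ab xab.
suff h : within_quotient `[a, b] f x --> df.
  by split; [apply/cvg_ex; exists df|exact: cvg_lim h].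
rewrite /within_quotient; apply: cvg_within_filter.
have : (h^-1 *: ((f \o shift x) (h *: (1:R)) - f x)) @[h --> (0:R)^'] --> df.
  by rewrite -dfx; exact: fx.
apply: cvg_trans; apply: near_eq_cvg; near=> h.
by rewrite /= /GRing.scale /= mulr1 [h + x]addrC.
Unshelve. all: by end_near. Qed.

(** Lets an equality known on the box only be differentiated, including at the endpoints. *)
Lemma eq_deriv_within (A : set R) f g x : A x -> (forall y, A y -> f y = g y) ->
  deriv_within A f x = deriv_within A g x.
Proof.
move=> Ax fg; congr lim; rewrite /within_quotient.
pose D := [set h | A (x + h)].
have Dn : \forall h \near within D (0 : R)^', D h by exact: withinT.
have e : {near within D (0 : R)^', (fun h : R => h^-1 * (f (x + h) - f x)) =1
    (fun h : R => h^-1 * (g (x + h) - g x))}.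
  by apply: filterS Dn => h; rewrite /D/= => Axh; rewrite !fg.
apply/seteqP; split; apply: near_eq_cvg => //.
by apply: filterS e => h ->.
Qed.

End derivative_within_theory.

(** * Fundamental theorem of calculus and scalar backward equations *)

Section calculus_within.
Context {R : realType}.
Implicit Types (a b x y : R) (f g : R -> R).

Lemma derivable_within_continuous_itv a b f :
  (forall x, x \in `[a, b] -> derivable_within `[a, b] f x) ->
  {within `[a, b], continuous f}.
Proof.
move=> df; apply/subspace_continuousP => x xab.
have fL : within_quotient `[a, b] f x --> deriv_within `[a, b] f x by exact: df.
set L := deriv_within `[a, b] f x in fL.
have near1 : \forall h \near within [set h | `[a, b]%classic (x + h)] (0 : R)^',
    `|L - h^-1 * (f (x + h) - f x)| < 1.
  by move/cvgrPdist_lt : fL => /(_ 1 ltr01).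
have : nbhs (0 : R) (fun h => h != 0 -> `[a, b]%classic (x + h) ->
    `|L - h^-1 * (f (x + h) - f x)| < 1) by exact: near1.
move=> /nbhs_ballP[e /= e0 he].
apply/cvgrPdist_le => eps eps0.
(* Near [x] the difference quotient is within 1 of the derivative, so [M] is a local Lipschitz
   constant at [x]. *)
pose M := `|L| + 1; have M0 : 0 < M by rewrite ltr_wpDl.
suff : \forall y \near x, `[a, b]%classic y -> `|f x - f y| <= eps by [].
apply/nbhs_ballP; exists (Num.min e (eps / M)) => /=.
  by rewrite lt_min e0 divr_gt0.
move=> y; rewrite /ball/= lt_min => /andP[xye xyM] yab.
have [->|yx] := eqVneq y x; first by rewrite subrr normr0 ltW.
have yx0 : y - x != 0 by rewrite subr_eq0.
have := he (y - x); rewrite /ball/= sub0r opprB => /(_ xye yx0).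
rewrite [x + _]addrC subrK => /(_ yab) hq.
have -> : f x - f y = - ((y - x) * ((y - x)^-1 * (f y - f x))) by field.
rewrite normrN normrM.
have h1 : `|(y - x)^-1 * (f y - f x)| <= M.
  rewrite -[X in `|X|](subKr L) (le_trans (ler_normB _ _))// lerD2l ltW//.
rewrite distrC in xyM; rewrite (le_trans (ler_pM _ _ (ltW xyM) h1))//.
by rewrite divfK// gt_eqF.
Qed.

Lemma derivable_within_interior a b f x : x \in `]a, b[ ->
  derivable_within `[a, b] f x ->
  derivable f x 1 /\ derive1 f x = deriv_within `[a, b] f x.
Proof.
move=> xab fL; set L := deriv_within _ _ _ in fL *.
have {}fL : within_quotient `[a, b] f x --> L by exact: fL.
suff h : (h^-1 *: ((f \o shift x) (h *: (1:R)) - f x)) @[h --> (0:R)^'] --> L.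
  split; first by apply/cvg_ex; exists L.
  by rewrite derive1E; exact: cvg_lim h.
have e : (fun h : R => h^-1 *: ((f \o shift x) (h *: (1:R)) - f x)) =
    (fun h : R => h^-1 * (f (x + h) - f x)).
  by apply/funext => h; rewrite /= /GRing.scale /= mulr1 [h + x]addrC.
rewrite e => S LS.
have hS : \forall h \near (0 : R)^', `[a, b]%classic (x + h) ->
    S (h^-1 * (f (x + h) - f x)) by exact: fL LS.
have hD : \forall h \near (0 : R)^', `[a, b]%classic (x + h).
  move: xab; rewrite in_itv/= => /andP[ax xb].
  apply: nbhs_dnbhs; apply/nbhs_ballP; exists (Num.min (x - a) (b - x)) => /=.
    by rewrite lt_min !subr_gt0 ax.
  move=> h; rewrite /ball/= sub0r normrN lt_min ltr_norml => /andP[h1].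
  rewrite ltr_norml => /andP[h2 h3]; rewrite in_itv/=.
  by move: h1 => /andP[h1 h4]; apply/andP; split; lra.
suff : \forall h \near (0 : R)^', S (h^-1 * (f (x + h) - f x)) by [].
by apply: filterS2 hD hS => h hD; apply.
Qed.

Lemma Rintegral_deriv_within a b f g t s :
  (forall x, x \in `[a, b] -> derivable_within `[a, b] f x) ->
  (forall x, x \in `[a, b] -> deriv_within `[a, b] f x = g x) -> continuous g ->
  a <= t -> t <= s -> s <= b ->
  \int[lebesgue_measure]_(r in `[t, s]) g r = f s - f t.
Proof.
move=> df dfg cg ta; rewrite le_eqVlt => /predU1P[->|ts] sb.
  by rewrite set_itv1 Rintegral_set1 subrr.
have cf : {within `[t, s], continuous f}.
  apply: continuous_subspaceW (derivable_within_continuous_itv df).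
  by move=> x /=; rewrite !in_itv/= => /andP[h1 h2]; rewrite (le_trans ta)// (le_trans h2).
have int x : (x \in `]t, s[) -> (x \in `]a, b[) /\ (x \in `[a, b]).
  by rewrite !in_itv/= => /andP[h1 h2]; split; apply/andP; split; lra.
rewrite /Rintegral (@continuous_FTC2 _ g f t s)//.
- exact: continuous_subspaceT.
- have /(continuous_within_itvP _ ts)[_ c1 c2] := cf; split => // x /int[h1 h2].
  by have [] := derivable_within_interior h1 (df _ h2).
- by move=> x /int[h1 h2]; have [_ ->] := derivable_within_interior h1 (df _ h2); exact: dfg.
Qed.

(* The lower limit -1 only makes 0 an interior point. *)
Lemma antiderivative g : continuous g ->
  exists G : R -> R, forall x, -1 < x -> is_derive x 1 G (g x).
Proof.
move=> cg; exists (fun x => \int[lebesgue_measure]_(r in `[-1, x]) g r) => x x1.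
have [||h1 h2] := @continuous_FTC1_closed _ g (-1) x (x + 1) _ _ x1 (cg x).
- by rewrite ltrDl.
- by apply: continuous_compact_integrable; [exact: segment_compact|exact: continuous_subspaceT].
- by apply: DeriveDef; [exact: h1|rewrite -derive1E].
Qed.

Variable T : R.
Hypothesis T0 : 0 < T.

Let TT : T \in `[0, T]. Proof. by rewrite in_itv/= lexx ltW. Qed.
Let gtN1 x : x \in `[0, T] -> -1 < x.
Proof. by rewrite in_itv/= => /andP[x0 _]; rewrite (lt_le_trans _ x0)// ltrN10. Qed.

Lemma is_derive_continuous_clamp f df : (forall x, x \in `[0, T] -> is_derive x 1 f (df x)) ->
  continuous (f \o clamp 0 T).
Proof.
move=> hf; apply: continuous_comp_clamp; first exact: ltW.
apply/subspace_continuousP => x xT; apply: cvg_within_filter.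
by apply: differentiable_continuous; apply/derivable1_diffP; case: (hf x xT).
Qed.

(** Variation of constants: with A' = p and B' = exp(-A) q, take exp(A) (B + constant), the constant
    being fixed by the value at [T]. [A] is controlled only to the right of -1, hence the clamp
    inside the continuous integrand for [B]. *)
Lemma linear_ode (p q : R -> R) (c : R) : continuous p -> continuous q ->
  exists f : R -> R, (forall x, x \in `[0, T] -> is_derive x 1 f (p x * f x + q x)) /\ f T = c.
Proof.
move=> cp cq; have [A dA] := antiderivative cp.
have cA : continuous (A \o clamp 0 T).
  by apply: (@is_derive_continuous_clamp _ p) => x xT; apply: dA; exact: gtN1.
have cq2 : continuous (fun x => expR (- A (clamp 0 T x)) * q x).
  apply: continuous_funM => // x.
  apply: (cvg_comp (fun x => - A (clamp 0 T x)) expR); last exact: continuous_expR.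
  exact: (continuous_funN cA).
have [B dB] := antiderivative cq2.
exists (fun x => expR (A x) * (B x + (expR (- A T) * c - B T))); split.
  move=> x xT; have dAx := dA x (gtN1 xT); have dBx := dB x (gtN1 xT).
  apply: is_derive_eq; rewrite /GRing.scale/= (clamp_id xT).
  have hE : expR (A x) * expR (- A x) = 1 by rewrite -expRD subrr expR0.
  transitivity (p x * (expR (A x) * (B x + (expR (- A T) * c - B T))) +
    (expR (A x) * expR (- A x)) * q x); last by rewrite hE mul1r.
  by ring.
have -> : expR (A T) * (B T + (expR (- A T) * c - B T)) = expR (A T) * expR (- A T) * c by ring.
by rewrite -expRD subrr expR0 mul1r.
Qed.

(* f = - w' / (k w), where w solves the linearised equation w'' = k c w. *)
Lemma riccati_ode (k c P0 : R) : 0 < k -> 0 < c -> 0 < P0 ->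
  exists f : R -> R, (forall x, x \in `[0, T] -> is_derive x 1 f (k * f x ^+ 2 - c)) /\ f T = P0.
Proof.
move=> k0 c0 P00; pose l := Num.sqrt (c / k); pose n := k * l.
have l0 : 0 < l by rewrite sqrtr_gt0 divr_gt0.
have l2 : k * l ^+ 2 = c by rewrite sqr_sqrtr ?divr_ge0 ?ltW// mulrC divfK// gt_eqF.
(* [u] is the solution [w] of the linearised equation and [v] is - u' / n, so - u' / (k u) = l v /
   u. The weights give v T = 2 P0 and u T = 2 l, hence the terminal value [P0]. On [0, T], e1 >= e2
   and P0 + l > P0 - l keep [u] positive, so there is no blow-up. *)
pose e1 x := expR (n * (T - x)); pose e2 x := expR (- (n * (T - x))).
pose u x := (P0 + l) * e1 x - (P0 - l) * e2 x.
pose v x := (P0 + l) * e1 x + (P0 - l) * e2 x.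
have n0 : 0 < n by rewrite mulr_gt0.
have u0 x : x \in `[0, T] -> u x != 0.
  rewrite in_itv/= => /andP[_ xT]; rewrite gt_eqF// /u subr_gt0.
  have h1 : e2 x <= e1 x.
    have h0 : 0 <= n * (T - x) by apply: mulr_ge0; [exact: ltW|rewrite subr_ge0].
    by rewrite ler_expR (le_trans _ h0)// oppr_le0.
  apply: (@lt_le_trans _ _ ((P0 + l) * e2 x)).
    by rewrite ltr_pM2r ?expR_gt0//; lra.
  by rewrite ler_pM2l//; lra.
exists (fun x => l * (v x / u x)); split; last first.
  rewrite /v /u /e1 /e2 subrr mulr0 oppr0 expR0 !mulr1.
  by field; rewrite gt_eqF//; lra.
move=> x xT; have ux := u0 x xT.
have d1 : is_derive x 1 e1 (- n * e1 x).
  by rewrite /e1; apply: is_derive_eq; rewrite /GRing.scale/=; ring.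
have d2 : is_derive x 1 e2 (n * e2 x).
  by rewrite /e2; apply: is_derive_eq; rewrite /GRing.scale/=; ring.
have du : is_derive x 1 u (- n * v x).
  by rewrite /u; apply: is_derive_eq; rewrite /GRing.scale/= /v; ring.
have dv : is_derive x 1 v (- n * u x).
  by rewrite /v; apply: is_derive_eq; rewrite /GRing.scale/= /u; ring.
have dui := is_deriveV ux du.
apply: is_derive_eq; rewrite /GRing.scale/= -l2 /n.
by field.
Qed.

End calculus_within.

(** * Solvability of the Riccati system *)

Section riccati_existence.
Context {R : realType} (p : lq_data R) (m : R).
Hypothesis hp : standing_assumptions p.
Local Notation T := (horizon p).

Lemma kappa_gt0 : 0 < kappa p.
Proof. by case: hp => _ [h _ _] _ _; rewrite /kappa invr_gt0 addr_gt0. Qed.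

Lemma horizon_gt0 : 0 < T. Proof. by case: hp => -[]. Qed.

Lemma continuous_coef (f : R -> R) : {within `[0, T], continuous f} ->
  continuous (f \o clamp 0 T).
Proof. by apply: continuous_comp_clamp; exact/ltW/horizon_gt0. Qed.

(** The system is triangular: [P1] is autonomous, [P2] and [P4] need [P1], [P3] needs [P2], [P5]
    needs [P2], [P3], [P4], and [P6] needs [P3], [P4]. Solutions already found enter the next
    equation as clamped versions [Q1], ..., [Q4], continuous on the whole line. *)
Lemma exists_riccati : exists P1 P2 P3 P4 P5 P6 : R -> R,
  riccati_system p m P1 P2 P3 P4 P5 P6.
Proof.
have T0 := horizon_gt0; have k0 := kappa_gt0.
case: hp => _ [c10 c20 pen0] _ [/continuous_coef ca /continuous_coef cs _ /continuous_coef cM].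
set k := kappa p in k0; set e := I_m p - Itarget p.
set al := alpha p \o _ in ca; set sg := sigma p \o _ in cs; set M := dispatch p \o _ in cM.
pose s2 x := sg x ^+ 2.
pose n x := m - M x.
have cn : continuous n.
  by rewrite /n; prove_continuous.
have cs2 : continuous s2 by exact: continuous_funX.
have [P1 [d1 e1]] := riccati_ode T k0 c20 pen0.
have c1' := is_derive_continuous_clamp T0 d1; set Q1 := P1 \o clamp 0 T in c1'.
have [|| P2 [d2 e2]] := @linear_ode _ _ T0 (fun x => al x + k * Q1 x)
  (fun x => - (2 * k) * Q1 x) 0.
- by prove_continuous.
- by prove_continuous.
have c2' := is_derive_continuous_clamp T0 d2; set Q2 := P2 \o clamp 0 T in c2'.
have [|| P3 [d3 e3]] := @linear_ode _ _ T0 (fun x => 2 * al x + s2 x)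
  (fun x => (-(1 - k)) + - k * Q2 x + k / 4 * Q2 x ^+ 2) 0.
- by prove_continuous.
- by prove_continuous.
have c3' := is_derive_continuous_clamp T0 d3; set Q3 := P3 \o clamp 0 T in c3'.
have [|| P4 [d4 e4]] := @linear_ode _ _ T0 (fun x => k * Q1 x)
  (fun x => - (2 * k) * n x * Q1 x) (2 * pen p * e).
- by prove_continuous.
- by prove_continuous.
have c4' := is_derive_continuous_clamp T0 d4; set Q4 := P4 \o clamp 0 T in c4'.
have [|| P5 [d5 e5]] := @linear_ode _ _ T0 al
  (fun x => - (2 * (1 - k)) * n x + - k * Q4 x + - k * n x * Q2 x + k / 2 * Q2 x * Q4 x
     + - (Xmax p - 2 * m) * s2 x * Q3 x) 0.
- by prove_continuous.
- by prove_continuous.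
have [|| P6 [d6 e6]] := @linear_ode _ _ T0 (fun=> 0)
  (fun x => - (1 - k) * n x ^+ 2 + - k * n x * Q4 x + k / 4 * Q4 x ^+ 2
     + - (m * (Xmax p - m)) * s2 x * Q3 x) (pen p * e ^+ 2).
- by prove_continuous.
- by prove_continuous.
have W f df : (forall x, x \in `[0, T] -> is_derive x 1 f (df x)) ->
    (forall x, x \in `[0, T] -> derivable_within `[0, T] f x) /\
    (forall x, x \in `[0, T] -> dot p f x = df x).
  by move=> h; split=> x xT; have [] := is_derive_within T0 xT (h x xT).
have [w1 f1] := W _ _ d1; have [w2 f2] := W _ _ d2; have [w3 f3] := W _ _ d3.
have [w4 f4] := W _ _ d4; have [w5 f5] := W _ _ d5; have [w6 f6] := W _ _ d6.
exists P1, P2, P3, P4, P5, P6; split => // x xT /=.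
rewrite (f1 x xT) (f2 x xT) (f3 x xT) (f4 x xT) (f5 x xT) (f6 x xT).
rewrite /Q1 /Q2 /Q3 /Q4 /s2 /n /M /al /sg /= (clamp_id xT) -/k.
by split; [split|..]; ring.
Qed.

End riccati_existence.

(** * Moments of the state and completion of the square *)

Section lq_moments.
Context {R : realType} d (Omega : measurableType d) (P : probability Omega R).
Variables (a b : R).
Hypothesis ab : a <= b.
Local Notation nu := (leb_on a b).
Local Notation mu := (nu \x P)%E.
Implicit Types (q : R * Omega) (s : R).

Variables (al s2 n : R -> R) (Z u : R * Omega -> R) (z0 j0 Xm m : R).
Hypotheses (bal : bounded_meas al) (bs2 : bounded_meas s2) (bn : bounded_meas n).
Hypothesis bZ : bounded_meas Z.
Hypothesis u2 : L2 mu u.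

(** Z = B + N splits the centred state into an absolutely continuous part and a martingale part; [G]
    is the squared diffusion coefficient. All that is known of [N] is in the hypotheses [Zorth],
    [uorth], [N0] and [N2]. *)
Let v q := - (al q.1 * Z q).
Let B q := z0 + prim a b (fun r => v (r, q.2)) q.1.
Let N q := Z q - B q.
Let J q := j0 + prim a b (fun r => u (r, q.2)) q.1.
Let G q := s2 q.1 * ((Z q + m) * (Xm - (Z q + m))).

(* [g] is uncorrelated with the increments of [N] after each time. *)
Let orth (g : R * Omega -> R) := forall r s, a <= r -> r <= s -> s <= b ->
  L2 P (fun w => g (r, w)) ->
  \int[P]_w (g (r, w) * N (s, w)) = \int[P]_w (g (r, w) * N (r, w)).

Hypothesis Zorth : orth v.
Hypothesis uorth : orth u.
Hypothesis N0 : forall s, s \in `[a, b] -> \int[P]_w N (s, w) = 0.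
Hypothesis N2 : forall s, s \in `[a, b] ->
  \int[P]_w (N (s, w) ^+ 2) = \int[mu]_q ((q.1 <= s)%R%:R * G q).

Let muoo := strip_lty P a b.
Let Poo := mass_lty P.

Let bv : bounded_meas v.
Proof.
have := bmM (bm_cst (R * Omega)%type (-1)) (bmM (bm_fst _ bal) bZ).
by congr bounded_meas; apply/funext => q; rewrite /v mulN1r.
Qed.

Let v2 : L2 mu v := bm_L2 muoo bv.

Let bB : bounded_meas B. Proof. by apply: bmD; [exact: bm_cst|exact: bm_prim_time]. Qed.
Let bN : bounded_meas N. Proof. exact: bmB. Qed.

Let J2 : L2 mu J. Proof. exact: L2_primD. Qed.
Let Z2 : L2 mu Z. Proof. exact: bm_L2. Qed.

Let Js2 s : L2 P (fun w => J (s, w)).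
Proof.
apply: L2D; last exact: L2_prim_slice.
by apply: bm_L2 => //; exact: bm_cst.
Qed.
Let Bs2 s : L2 P (fun w => B (s, w)). Proof. by apply: bm_L2 => //; exact: bm_slice2. Qed.
Let Ns2 s : L2 P (fun w => N (s, w)). Proof. by apply: bm_L2 => //; exact: bm_slice2. Qed.

Let P1 : fine (P setT) = 1. Proof. by rewrite probability_setT. Qed.

Let ind_add (f g : R * Omega -> R) s : L1 mu f -> L1 mu g ->
  \int[mu]_q ((q.1 <= s)%R%:R * (f q + g q)) =
  \int[mu]_q ((q.1 <= s)%R%:R * f q) + \int[mu]_q ((q.1 <= s)%R%:R * g q).
Proof.
move=> f1 g1; rewrite -IntD; try by apply: L1Ml => //; exact: bm_ler.
by apply: Int_ext => q; rewrite mulrDr.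
Qed.

Lemma Int_state s : s \in `[a, b] ->
  \int[P]_w J (s, w) = j0 + \int[mu]_q ((q.1 <= s)%R%:R * u q).
Proof.
move=> sab; have u1 := L2_L1 muoo u2; have [p1 e1] := Int_prim s u1.
rewrite /J IntD//; last by apply: bm_L1 => //; exact: bm_cst.
by rewrite Int_cst P1 mulr1 e1 prim_Int.
Qed.

Lemma Int_state_sqr s : s \in `[a, b] ->
  \int[P]_w (J (s, w) ^+ 2) = j0 ^+ 2 + \int[mu]_q ((q.1 <= s)%R%:R * (2 * (u q * J q))).
Proof.
move=> sab; have /= h := Int_prod_prim j0 j0 s u2 u2; rewrite P1 mulr1 in h.
transitivity (\int[P]_w (J (s, w) * J (s, w))); first by apply: Int_ext => w; rewrite expr2.
rewrite h -expr2; congr (_ + _); apply: Int_ext => q; rewrite -/(J q); ring.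
Qed.

Lemma Int_exog s : s \in `[a, b] ->
  \int[P]_w Z (s, w) = z0 + \int[mu]_q ((q.1 <= s)%R%:R * v q).
Proof.
move=> sab; have v1 := L2_L1 muoo v2; have [p1 e1] := Int_prim s v1.
rewrite (@Int_ext _ _ _ _ (fun w => Z (s, w)) (fun w => B (s, w) + N (s, w))); last first.
  by move=> w; rewrite /N; ring.
rewrite IntD; [|exact: L2_L1 (Bs2 s)|exact: L2_L1 (Ns2 s)].
rewrite N0// addr0 /B IntD//; last by apply: bm_L1 => //; exact: bm_cst.
by rewrite Int_cst P1 mulr1 e1 prim_Int.
Qed.

Let Int_primD_mart (g : R * Omega -> R) g0 s : s \in `[a, b] -> L2 mu g -> orth g ->
  \int[P]_w ((g0 + prim a b (fun r => g (r, w)) s) * N (s, w)) =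
  \int[mu]_q ((q.1 <= s)%R%:R * (g q * N q)).
Proof.
move=> sab g2 og; move: (sab); rewrite in_itv/= => /andP[a_s sb].
rewrite (@Int_ext _ _ _ _ _ (fun w => g0 * N (s, w) + prim a b (fun r => g (r, w)) s * N (s, w)));
  last by move=> w; rewrite mulrDl.
have n1 := L2_L1 Poo (Ns2 s).
rewrite IntD; [|exact: L1Zl|by apply: L2_L1M => //; exact: L2_prim_slice].
rewrite IntZl// N0// mulr0 add0r; apply: (Int_prim_martingale bN g2) => r rab rs gr.
by apply: og => //; move: rab; rewrite in_itv/= => /andP[].
Qed.

(** Split J Z = J B + J N. The first product obeys the ordinary product rule; the second contributes
    u N, and u B + v J + u N = u Z - alpha J Z. *)
Lemma Int_state_exog s : s \in `[a, b] ->
  \int[P]_w (J (s, w) * Z (s, w)) = j0 * z0 +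
    \int[mu]_q ((q.1 <= s)%R%:R * (u q * Z q - al q.1 * (J q * Z q))).
Proof.
move=> sab.
rewrite (@Int_ext _ _ _ _ _ (fun w => J (s, w) * B (s, w) + J (s, w) * N (s, w))); last first.
  by move=> w; rewrite /N; ring.
rewrite IntD; [|exact: L2_L1M|exact: L2_L1M].
have := Int_prod_prim j0 z0 s u2 v2; rewrite P1 mulr1 => /= ->.
have /= -> := Int_primD_mart j0 sab u2 uorth.
rewrite -addrA; congr (_ + _); rewrite -ind_add.
- by apply: Int_ext => q; congr (_ * _); rewrite -/(B q) -/(J q) /N /v; ring.
- by apply: L1D; apply: L2_L1M => //; exact: bm_L2.
- by apply: L2_L1M => //; exact: bm_L2.
Qed.

(** From Z^2 = B^2 + 2 B N + N^2 the three terms contribute 2 v B, 2 v N and the isometry term [G],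
    that is 2 v Z + G. *)
Lemma Int_exog_sqr s : s \in `[a, b] ->
  \int[P]_w (Z (s, w) ^+ 2) = z0 ^+ 2 +
    \int[mu]_q ((q.1 <= s)%R%:R * (- (2 * al q.1 * Z q ^+ 2) + G q)).
Proof.
move=> sab.
rewrite (@Int_ext _ _ _ _ _ (fun w => B (s, w) * B (s, w) +
    (2 * (B (s, w) * N (s, w)) + N (s, w) ^+ 2))); last first.
  by move=> w; rewrite /N; ring.
have BN := L2_L1M (Bs2 s) (Ns2 s).
have NN : L1 P (fun w => N (s, w) ^+ 2) by case: (Ns2 s).
rewrite IntD; [|exact: L2_L1M|by apply: L1D => //; exact: L1Zl].
rewrite IntD//; last exact: L1Zl.
rewrite IntZl//.
have := Int_prod_prim z0 z0 s v2 v2; rewrite P1 mulr1 => /= ->.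
have /= -> := Int_primD_mart z0 sab v2 Zorth.
rewrite N2// -expr2 -addrA; congr (_ + _).
have vN : L1 mu (fun q => v q * N q) by apply: L2_L1M => //; exact: bm_L2.
have iN : L1 mu (fun q => (q.1 <= s)%R%:R * (v q * N q)) by apply: L1Ml => //; exact: bm_ler.
have G1 : L1 mu G.
  apply: bm_L1 => //; apply: bmM; first exact: bm_fst.
  apply: bmM; first by apply: bmD => //; exact: bm_cst.
  by apply: bmB; [exact: bm_cst|apply: bmD => //; exact: bm_cst].
rewrite -IntZl//.
rewrite (@Int_ext _ _ _ _ (fun q => 2 * ((q.1 <= s)%R%:R * (v q * N q)))
  (fun q => (q.1 <= s)%R%:R * (2 * (v q * N q)))); last by move=> q; ring.
rewrite -ind_add//; last exact: L1Zl.
rewrite -ind_add//.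
- by apply: Int_ext => q; congr (_ * _); rewrite -/(B q) /N /v; ring.
- by apply: L1D; apply: L2_L1M => //; exact: bm_L2.
- by apply: L1D => //; exact: L1Zl.
Qed.

(** * Completion of the square *)

Section verification.
Variables (c1 c2 : R) (Q1 Q2 Q3 Q4 Q5 Q6 : R -> R).
Hypothesis c10 : 0 < c1.
Hypotheses (bQ1 : bounded_meas Q1) (bQ2 : bounded_meas Q2) (bQ3 : bounded_meas Q3).
Hypotheses (bQ4 : bounded_meas Q4) (bQ5 : bounded_meas Q5) (bQ6 : bounded_meas Q6).
Let k := (1 + c1)^-1.
(** [d1], ..., [d6] are the Riccati equations solved for the derivative; [isprim] states them in
    integrated form, ready for [Int_weighted]. *)
Let d1 r := k * Q1 r ^+ 2 - c2.
Let d2 r := al r * Q2 r + k * Q1 r * Q2 r - 2 * k * Q1 r.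
Let d3 r := (2 * al r + s2 r) * Q3 r - (1 - k) - k * Q2 r + k / 4 * Q2 r ^+ 2.
Let d4 r := k * Q1 r * Q4 r - 2 * k * n r * Q1 r.
Let d5 r := al r * Q5 r - 2 * (1 - k) * n r - k * Q4 r - k * n r * Q2 r
  + k / 2 * Q2 r * Q4 r - (s2 r * Xm - 2 * s2 r * m) * Q3 r.
Let d6 r := k / 4 * Q4 r ^+ 2 - (1 - k) * n r ^+ 2 - k * n r * Q4 r
  - s2 r * m * (Xm - m) * Q3 r.
Let isprim (f g : R -> R) := forall s, s \in `[a, b] -> f s = f a + prim a b g s.
Hypotheses (e1 : isprim Q1 d1) (e2 : isprim Q2 d2) (e3 : isprim Q3 d3).
Hypotheses (e4 : isprim Q4 d4) (e5 : isprim Q5 d5) (e6 : isprim Q6 d6).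

(** Feedback and running cost in centred variables: with n = m - M, the mismatch X - M is
    [Z + n]. *)
Let fb q := k * (Z q + n q.1) - k * Q1 q.1 * J q - k / 2 * Q2 q.1 * Z q - k / 2 * Q4 q.1.
Let Lg q := (Z q + n q.1 - u q) ^+ 2 + c1 * u q ^+ 2 + c2 * J q ^+ 2.

Let bd1 : bounded_meas d1. Proof. by rewrite /d1; bm. Qed.
Let bd2 : bounded_meas d2. Proof. by rewrite /d2; bm. Qed.
Let bd3 : bounded_meas d3. Proof. by rewrite /d3; bm. Qed.
Let bd4 : bounded_meas d4. Proof. by rewrite /d4; bm. Qed.
Let bd5 : bounded_meas d5. Proof. by rewrite /d5; bm. Qed.
Let bd6 : bounded_meas d6. Proof. by rewrite /d6; bm. Qed.

Let L1b (g : R -> R) (f : R * Omega -> R) : bounded_meas g -> L1 mu f ->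
  L1 mu (fun q => g q.1 * f q).
Proof. by move=> bg f1; apply: L1Ml => //; exact: bm_fst. Qed.

Let L2fb : L2 mu fb.
Proof.
have bk (g : R -> R) : bounded_meas g -> bounded_meas (fun q : R * Omega => k * g q.1).
  by move=> bg; apply: bmM; [exact: bm_cst|exact: bm_fst].
rewrite /fb; apply: L2B.
  apply: L2B.
    apply: L2B.
      apply: L2Zl; apply: L2D => //; apply: bm_L2 => //; exact: bm_fst.
    by apply: L2Ml => //; exact: bk.
  by apply: L2Ml => //; apply: bmM; [exact: bm_cst|exact: bm_fst].
apply: bm_L2 => //; apply: bmM; [exact: bm_cst|exact: bm_fst].
Qed.

Let L1sqr (f : R * Omega -> R) : L2 mu f -> L1 mu (fun q => f q ^+ 2). Proof. by case. Qed.

Lemma L1_running_cost : L1 mu Lg.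
Proof.
apply: L1D; last by apply: L1Zl; exact: L1sqr.
apply: L1D; last by apply: L1Zl; exact: L1sqr.
apply: L1sqr; apply: L2B => //; apply: L2D => //; apply: bm_L2 => //; exact: bm_fst.
Qed.

Lemma L1_feedback_gap : L1 mu (fun q => (u q - fb q) ^+ 2).
Proof. by apply: L1sqr; exact: L2B. Qed.

(** [Int_weighted] turns each coefficient times its moment into boundary terms plus an integral over
    the strip; these integrals and the running cost together form a pointwise square. *)
Lemma verification_identity :
  Q1 b * \int[P]_w (J (b, w) ^+ 2) + Q2 b * \int[P]_w (J (b, w) * Z (b, w)) +
  Q3 b * \int[P]_w (Z (b, w) ^+ 2) + Q4 b * \int[P]_w J (b, w) +
  Q5 b * \int[P]_w Z (b, w) + Q6 b + \int[mu]_q Lg q =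
  Q1 a * j0 ^+ 2 + Q2 a * (j0 * z0) + Q3 a * z0 ^+ 2 + Q4 a * j0 + Q5 a * z0 + Q6 a
  + (1 + c1) * \int[mu]_q ((u q - fb q) ^+ 2).
Proof.
have u1 := L2_L1 muoo u2; have v1 := L2_L1 muoo v2; have J1 := L2_L1 muoo J2.
have Z1 := L2_L1 muoo Z2.
have uJ := L2_L1M u2 J2; have uZ := L2_L1M u2 Z2; have JZ := L2_L1M J2 Z2.
have JJ := L1sqr J2; have ZZ := L1sqr Z2.
have G1 : L1 mu G.
  apply: bm_L1 => //; apply: bmM; first exact: bm_fst.
  apply: bmM; first by apply: bmD => //; exact: bm_cst.
  by apply: bmB; [exact: bm_cst|apply: bmD => //; exact: bm_cst].
have f2_1 : L1 mu (fun q => 2 * (u q * J q)) by exact: L1Zl.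
have f3_1 : L1 mu (fun q => u q * Z q - al q.1 * (J q * Z q)) by apply: L1B => //; exact: L1b.
have f4_1 : L1 mu (fun q => - (2 * al q.1 * Z q ^+ 2) + G q).
  apply: L1D => //; apply: (@L1_ext _ _ _ _ (fun q => -2 * (al q.1 * Z q ^+ 2))).
    by move=> q; ring.
  by apply: L1Zl; exact: L1b.
have w1 := Int_weighted ab bd1 bQ1 e1 f2_1 JJ Int_state_sqr.
have w2 := Int_weighted ab bd2 bQ2 e2 f3_1 JZ Int_state_exog.
have w3 := Int_weighted ab bd3 bQ3 e3 f4_1 ZZ Int_exog_sqr.
have w4 := Int_weighted ab bd4 bQ4 e4 u1 J1 Int_state.
have w5 := Int_weighted ab bd5 bQ5 e5 v1 Z1 Int_exog.
have one1 : L1 mu (fun=> 1) by apply: bm_L1 => //; exact: bm_cst.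
have zero1 : L1 mu (fun=> 0) by apply: bm_L1 => //; exact: bm_cst.
(* [Q6] weighs the constant function one, whose expectation does not vary in time. *)
have w6 := @Int_weighted _ _ _ P a b Q6 d6 1 (fun=> 0) (fun=> 1) ab bd6 bQ6 e6 zero1 one1.
have {}w6 : \int[mu]_q (d6 q.1 * 1 + Q6 q.1 * 0) = Q6 b * \int[P]_w 1 - Q6 a * 1.
  apply: w6 => s _; rewrite Int_cst P1 mulr1.
  by rewrite (@Int_ext _ _ _ _ _ (fun=> 0)); [rewrite Int_cst mul0r addr0|move=> q; rewrite mulr0].
have i1 : L1 mu (fun q => d1 q.1 * J q ^+ 2 + Q1 q.1 * (2 * (u q * J q))).
  by apply: L1D; exact: L1b.
have i2 : L1 mu (fun q => d2 q.1 * (J q * Z q) + Q2 q.1 * (u q * Z q - al q.1 * (J q * Z q))).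
  by apply: L1D; exact: L1b.
have i3 : L1 mu (fun q => d3 q.1 * Z q ^+ 2 + Q3 q.1 * (- (2 * al q.1 * Z q ^+ 2) + G q)).
  by apply: L1D; exact: L1b.
have i4 : L1 mu (fun q => d4 q.1 * J q + Q4 q.1 * u q) by apply: L1D; exact: L1b.
have i5 : L1 mu (fun q => d5 q.1 * Z q + Q5 q.1 * v q) by apply: L1D; exact: L1b.
have i6 : L1 mu (fun q => d6 q.1 * 1 + Q6 q.1 * 0) by apply: L1D; exact: L1b.
have i7 := L1_running_cost; have i8 := L1_feedback_gap.
(* Here the form of the Riccati system matters: as polynomials in J, Z and u the integrands add up
   to (1 + c1) (u - fb)^2 at every point. The last term of [d6] cancels the constant part m (Xm - m)
   of [G] times [Q3]. *)
have key : \int[mu]_q (d1 q.1 * J q ^+ 2 + Q1 q.1 * (2 * (u q * J q)))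
  + \int[mu]_q (d2 q.1 * (J q * Z q) + Q2 q.1 * (u q * Z q - al q.1 * (J q * Z q)))
  + \int[mu]_q (d3 q.1 * Z q ^+ 2 + Q3 q.1 * (- (2 * al q.1 * Z q ^+ 2) + G q))
  + \int[mu]_q (d4 q.1 * J q + Q4 q.1 * u q)
  + \int[mu]_q (d5 q.1 * Z q + Q5 q.1 * v q)
  + \int[mu]_q (d6 q.1 * 1 + Q6 q.1 * 0)
  + \int[mu]_q Lg q = (1 + c1) * \int[mu]_q ((u q - fb q) ^+ 2).
  rewrite -IntZl// -!IntD//; do ?exact: L1D.
  - apply: Int_ext => q; rewrite /Lg /fb /d1 /d2 /d3 /d4 /d5 /d6 /G /v /k.
    by field; rewrite gt_eqF// addr_gt0.
  - by do 5 (apply: L1D => //).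
  - by do 4 (apply: L1D => //).
  - by do 3 (apply: L1D => //).
  - by do 2 (apply: L1D => //).
rewrite w1 w2 w3 w4 w5 w6 Int_cst P1 in key.
by rewrite -key; ring.
Qed.

End verification.

End lq_moments.

(** * The cost of a control *)

Lemma continuous_riccati_rhs {R : realType} (k c2 Xm m : R)
    (al s2 n Q1 Q2 Q3 Q4 : R -> R) : continuous al -> continuous s2 -> continuous n ->
  continuous Q1 -> continuous Q2 -> continuous Q3 -> continuous Q4 ->
  forall Q5 : R -> R, continuous Q5 ->
  [/\ continuous (fun r => k * Q1 r ^+ 2 - c2),
      continuous (fun r => al r * Q2 r + k * Q1 r * Q2 r - 2 * k * Q1 r),
      continuous (fun r => (2 * al r + s2 r) * Q3 r - (1 - k) - k * Q2 r + k / 4 * Q2 r ^+ 2)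
    & [/\ continuous (fun r => k * Q1 r * Q4 r - 2 * k * n r * Q1 r),
          continuous (fun r => al r * Q5 r - 2 * (1 - k) * n r - k * Q4 r
            - k * n r * Q2 r + k / 2 * Q2 r * Q4 r - (s2 r * Xm - 2 * s2 r * m) * Q3 r)
        & continuous (fun r => k / 4 * Q4 r ^+ 2 - (1 - k) * n r ^+ 2 - k * n r * Q4 r
            - s2 r * m * (Xm - m) * Q3 r)]].
Proof.
move=> cal cs2 cn c1 c2' c3 c4 Q5 c5.
by split; [| | |split]; prove_continuous.
Qed.

Section control_cost.
Context {R : realType} (p : lq_data R) d (Omega : measurableType d).
Variables (P : probability Omega R) (F : R -> set (set Omega)) (W : R -> Omega -> R).
Variable m : R.
Hypotheses (hp : standing_assumptions p) (hF : filtration (horizon p) F).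
Hypothesis hW : wiener P (horizon p) F W.
Hypothesis hm : forall r : R, r \in `[0, horizon p] -> level p r = m.
Local Notation T := (horizon p).

Variables (t x i : R) (X : R -> Omega -> R).
Hypothesis ht : t \in `[0, T].
Hypothesis hX : jacobi_solution p P F W t x X.

Local Notation mu := (leb_on t T \x P)%E.

Lemma start_ge0 : 0 <= t. Proof. by move: ht; rewrite in_itv/= => /andP[]. Qed.
Lemma start_le : t <= T. Proof. by move: ht; rewrite in_itv/= => /andP[]. Qed.
Let t0 := start_ge0.
Let tT := start_le.
Let T0 : 0 <= T := le_trans t0 tT.

Lemma sub_horizon s : s \in `[t, T] -> s \in `[0, T].
Proof. by rewrite !in_itv/= => /andP[ts ->]; rewrite (le_trans t0). Qed.

(* Coefficients and state are frozen outside the horizon, which makes them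
   bounded and measurable on the whole line. *)
Definition coef (f : R -> R) : R -> R := f \o clamp 0 T.

Lemma coefE f s : s \in `[t, T] -> coef f s = f s.
Proof. by move=> sT; rewrite /coef /= clamp_id//; exact: sub_horizon. Qed.

Lemma bm_coef f : {within `[0, T], continuous f} -> bounded_meas (coef f).
Proof.
move=> cf; have cc := continuous_comp_clamp T0 cf; split; first exact: continuous_measurable_fun.
have [C hC] := continuous_bounded_clamp T0 cc.
by exists C => r; have := hC _ (clamp_in r T0); rewrite /coef /= clamp_id//; exact: clamp_in.
Qed.

Definition exog (q : R * Omega) : R := X (clamp t T q.1) q.2 - m.
Definition drift (q : R * Omega) : R := - (coef (alpha p) q.1 * exog q).
(** The martingale part of the state, read off the path of [X]. It is bounded and jointly
    measurable, whereas the Ito integral in the state equation is tied to it only at each fixed time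
    and up to a null set. *)
Definition noise (q : R * Omega) : R :=
  exog q - ((x - m) + prim t T (fun r => drift (r, q.2)) q.1).
Definition state (u : R * Omega -> R) (q : R * Omega) : R :=
  (i - I_m p) + prim t T (fun r => u (r, q.2)) q.1.

Lemma exogE s w : s \in `[t, T] -> exog (s, w) = X s w - m.
Proof. by move=> sT; rewrite /exog /= clamp_id. Qed.

Lemma X_bound q : 0 <= X (clamp t T q.1) q.2 <= Xmax p.
Proof. by case: hX => _ _ + _; apply; exact: clamp_in. Qed.

Lemma measurable_X : measurable_fun setT (fun q : R * Omega => X (clamp t T q.1) q.2).
Proof.
apply: (measurable_caratheodory (f := fun s w => X (clamp t T s) w)).
- move=> w; have cX : {within `[t, T], continuous (X ^~ w)} by case: hX => _ + _ _; apply.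
  exact: (continuous_comp_clamp tT cX).
- move=> s; apply: (measurable_wrt_fun (G := F (clamp t T s))).
    by case: hF => _ + _; apply; apply: sub_horizon; exact: clamp_in.
  by case: hX => + _ _ _; apply; exact: clamp_in.
Qed.

Lemma bm_X : bounded_meas (fun q : R * Omega => X (clamp t T q.1) q.2).
Proof.
split; first exact: measurable_X.
by exists (Xmax p) => q; have /andP[h0 h1] := X_bound q; rewrite ger0_norm.
Qed.

Lemma bm_exog : bounded_meas exog.
Proof. by apply: bmB; [exact: bm_X|exact: bm_cst]. Qed.

Let ca : {within `[0, T], continuous (alpha p)}. Proof. by case: hp => _ _ _ []. Qed.
Let cs : {within `[0, T], continuous (sigma p)}. Proof. by case: hp => _ _ _ []. Qed.
Let cM : {within `[0, T], continuous (dispatch p)}. Proof. by case: hp => _ _ _ []. Qed.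

Lemma bm_drift : bounded_meas drift.
Proof.
have := bmM (bm_cst (R * Omega)%type (-1)) (bmM (bm_fst _ (bm_coef ca)) bm_exog).
by congr bounded_meas; apply/funext => q; rewrite /drift mulN1r.
Qed.

Lemma bm_noise : bounded_meas noise.
Proof.
apply: bmB; first exact: bm_exog.
by apply: bmD; [exact: bm_cst|apply: bm_prim_time; exact: bm_drift].
Qed.

(** The constancy of the level enters here: alpha (m - X) is the [drift] of the centred state. *)
Lemma noise_ito : exists Y : R -> Omega -> R,
  ito_integral P t T F W
    (fun s w => sigma p s * Num.sqrt (X s w * (Xmax p - X s w))) Y /\
  forall s : R, s \in `[t, T] -> {ae P, forall w, noise (s, w) = Y s w}.
Proof.
case: hX => _ _ _ [Y [hY sde]]; exists Y; split=> // s sT.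
apply: filterS (sde s sT) => w; rewrite /noise exogE//= => ->.
have /andP[ts sT'] : t <= s <= T by move: sT; rewrite in_itv.
rewrite primE//; last by apply: slice_meas; case: bm_drift.
suff -> : \int[lebesgue_measure]_(r in `[t, s]) (alpha p r * (level p r - X r w)) =
    \int[lebesgue_measure]_(r in `[t, s]) drift (r, w) by ring.
apply: eq_Rintegral => r; rewrite inE/= in_itv/= => /andP[tr rs].
have rT : r \in `[t, T] by rewrite in_itv/= tr (le_trans rs).
by rewrite /drift coefE// exogE// hm ?sub_horizon//; ring.
Qed.

Let G (q : R * Omega) : R :=
  coef (sigma p) q.1 ^+ 2 * ((exog q + m) * (Xmax p - (exog q + m))).

(** Boundedness of [noise] makes the Ito integral square-integrable at each time, so its martingale
    property and isometry apply and transfer back through almost sure equality. The bounds 0 <= X <=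
    Xmax give a bounded version of the integrand and undo the square root. *)
Lemma noise_martingale_isometry :
  [/\ (forall r s xi, t <= r -> r <= s -> s <= T -> measurable_wrt (F r) xi -> L2 P xi ->
        \int[P]_w (xi w * noise (s, w)) = \int[P]_w (xi w * noise (r, w))),
      (forall s, s \in `[t, T] ->
        \int[P]_w (noise (s, w) ^+ 2) = \int[mu]_q ((q.1 <= s)%R%:R * G q))
    & (forall s, s \in `[t, T] -> \int[P]_w noise (s, w) = 0)].
Proof.
have [Y [hY nY]] := noise_ito.
have mY s : s \in `[t, T] -> measurable_fun setT (Y s) by case: hY => _ _ + _; apply.
have n2 s : L2 P (fun w => noise (s, w)).
  by apply: bm_L2; [exact: mass_lty|apply: bm_slice2; exact: bm_noise].
have Y2 s : s \in `[t, T] -> L2 P (Y s) by move=> sT; apply: L2_ae (n2 s); [exact: mY|exact: nY].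
pose Hb (q : R * Omega) := coef (sigma p) q.1 *
  Num.sqrt (X (clamp t T q.1) q.2 * (Xmax p - X (clamp t T q.1) q.2)).
have bHb : bounded_meas Hb.
  apply: bmM; first by apply: bm_fst; exact: bm_coef.
  split.
    have msq : measurable_fun setT (Num.sqrt : R -> R).
      by apply: continuous_measurable_fun; exact: sqrt_continuous.
    apply: (measurableT_comp msq).
    apply: measurable_funM; first exact: measurable_X.
    by apply: measurable_funB => //; exact: measurable_X.
  exists (Xmax p) => q; have /andP[h0 h1] := X_bound q.
  rewrite ger0_norm ?sqrtr_ge0//.
  have X0 : 0 <= Xmax p by exact: le_trans h1.
  rewrite -[leRHS](ger0_norm X0) -sqrtr_sqr; apply: ler_wsqrtr.
  by rewrite expr2 ler_pM ?subr_ge0// gerBl.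
have HbE s w : s \in `[t, T] ->
    sigma p s * Num.sqrt (X s w * (Xmax p - X s w)) = Hb (s, w).
  by move=> sT; rewrite /Hb /= coefE// clamp_id.
have GE q : G q = Hb q ^+ 2.
  have /andP[h0 h1] := X_bound q.
  by rewrite /G /Hb /exog exprMn sqr_sqrtr ?mulr_ge0 ?subr_ge0// subrK.
have [orth sq] := ito_martingale_isometry hF hW t0 hY bHb HbE Y2.
have iY s (xi : Omega -> R) : s \in `[t, T] -> measurable_fun setT xi ->
    \int[P]_w (xi w * noise (s, w)) = \int[P]_w (xi w * Y s w).
  move=> sT mxi; apply: Int_ae.
  - by apply: measurable_funM => //; exact: L2_meas (n2 s).
  - by apply: measurable_funM => //; exact: mY.
  - by apply: filterS (nY s sT) => w ->.
have ino r s : t <= r -> r <= s -> s <= T -> r \in `[t, T] /\ s \in `[t, T].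
  by move=> tr rs sT; rewrite !in_itv/=; split; apply/andP; split => //; lra.
have o1 r s xi : t <= r -> r <= s -> s <= T -> measurable_wrt (F r) xi -> L2 P xi ->
    \int[P]_w (xi w * noise (s, w)) = \int[P]_w (xi w * noise (r, w)).
  move=> tr rs sT mxi xi2; have [rT sT'] := ino _ _ tr rs sT.
  by rewrite !iY//; [exact: orth|exact: L2_meas xi2|exact: L2_meas xi2].
have o2 s : s \in `[t, T] ->
    \int[P]_w (noise (s, w) ^+ 2) = \int[mu]_q ((q.1 <= s)%R%:R * G q).
  move=> sT; move: (sT); rewrite in_itv/= => /andP[ts sT'].
  have -> : \int[mu]_q ((q.1 <= s)%R%:R * G q) = \int[P]_w (Y s w ^+ 2).
    by rewrite sq//; apply: Int_ext => q; rewrite GE.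
  apply: Int_ae.
  - by apply: measurable_funX; exact: L2_meas (n2 s).
  - by apply: measurable_funX; exact: mY.
  - by apply: filterS (nY s sT) => w ->.
have tin : t \in `[t, T] by rewrite in_itv/= lexx.
(* At the initial time the isometry integrates over a single point, so the second moment is zero;
   orthogonality with [xi] equal to one then keeps the mean constant. *)
have Nt0 : \int[P]_w noise (t, w) = 0.
  have G1 : L1 mu G.
    apply: bm_L1; first exact: strip_lty.
    rewrite (_ : G = fun q => Hb q * Hb q); first exact: bmM.
    by apply/funext => q; rewrite GE expr2.
  have := Int_sqr_le (n2 t); rewrite o2// -prim_Int// prim_bot//; last first.
    exact: L1_meas (L1_fubini1 G1).
  by rewrite mulr0 => h; apply/eqP; rewrite -sqrf_eq0 eq_le h sqr_ge0.
split; [exact: o1|exact: o2|move=> s sT].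
move: (sT); rewrite in_itv/= => /andP[ts sT']; rewrite -Nt0.
have := o1 t s (fun=> 1) (lexx t) ts sT' _ _.
rewrite (@Int_ext _ _ _ _ (fun w => 1 * noise (s, w)) (fun w => noise (s, w))); last first.
  by move=> w; rewrite mul1r.
rewrite (@Int_ext _ _ _ _ (fun w => 1 * noise (t, w)) (fun w => noise (t, w))); last first.
  by move=> w; rewrite mul1r.
apply.
- by apply: measurable_wrt_cst; case: hF => + _ _; apply.
- by apply: bm_L2; [exact: mass_lty|exact: bm_cst].
Qed.

(** * The cost of a fixed admissible control *)

Section control.
Variable B : R -> Omega -> R.
Hypothesis hB : admissible p P F t B.

Definition control : R * Omega -> R :=
  (fun q => B q.1 q.2) \_ ((`[t, T]%classic : set R) `*` [set: Omega]).
Local Notation u := control.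

Lemma controlE s w : s \in `[t, T] -> u (s, w) = B s w.
Proof. by move=> sT; rewrite /control patchE mem_set. Qed.

Lemma measurable_control : measurable_fun setT u.
Proof.
apply/(measurable_restrictT _ _).1; first by apply: measurableX.
by case: hB.
Qed.

Lemma charge_stateE s w : s \in `[t, T] ->
  charge_state t i B s w = I_m p + state u (s, w).
Proof.
rewrite in_itv/= => /andP[ts sT]; rewrite /charge_state /state primE//=; last first.
  by apply: slice_meas; exact: measurable_control.
suff -> : \int[lebesgue_measure]_(r in `[t, s]) B r w =
    \int[lebesgue_measure]_(r in `[t, s]) u (r, w) by ring.
apply: eq_Rintegral => r; rewrite inE/= in_itv/= => /andP[tr rs].
by rewrite controlE// in_itv/= tr (le_trans rs).
Qed.

Definition running (q : R * Omega) : R :=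
  (exog q + (m - coef (dispatch p) q.1) - u q) ^+ 2 + c1 p * u q ^+ 2
  + c2 p * state u q ^+ 2.

Definition terminal (w : Omega) : R :=
  pen p * (state u (T, w) + (I_m p - Itarget p)) ^+ 2.

Lemma measurable_state : measurable_fun setT (state u).
Proof.
by apply: measurable_funD => //; apply: prim_jmeas; exact: measurable_control.
Qed.

Lemma measurable_running : measurable_fun setT running.
Proof.
have mu' := measurable_control; have ms := measurable_state.
have mM : measurable_fun setT (fun q : R * Omega => coef (dispatch p) q.1).
  by case: (bm_fst Omega (bm_coef cM)).
have me : measurable_fun setT exog by case: bm_exog.
apply: measurable_funD; last by apply: measurable_funM => //; exact: measurable_funX.
apply: measurable_funD; last by apply: measurable_funM => //; exact: measurable_funX.
apply: measurable_funX; apply: measurable_funB => //; apply: measurable_funD => //.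
exact: measurable_funB.
Qed.

Lemma measurable_terminal : measurable_fun setT terminal.
Proof.
apply: measurable_funM => //; apply: measurable_funX; apply: measurable_funD => //.
exact: (slice_meas2 T measurable_state).
Qed.

Let c10 : 0 < c1 p. Proof. by case: hp => _ []. Qed.
Let c20 : 0 < c2 p. Proof. by case: hp => _ []. Qed.
Let pen0 : 0 < pen p. Proof. by case: hp => _ []. Qed.

Lemma running_ge0 q : 0 <= running q.
Proof.
apply: addr_ge0; [apply: addr_ge0; [exact: sqr_ge0|]|];
  by apply: mulr_ge0; [exact: ltW|exact: sqr_ge0].
Qed.

Lemma terminal_ge0 w : 0 <= terminal w.
Proof. by apply: mulr_ge0; [exact: ltW|exact: sqr_ge0]. Qed.

Lemma costE : cost p P t i X B =
  (\int[mu]_q (running q)%:E + \int[P]_w (terminal w)%:E)%E.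
Proof.
have mr : measurable_fun setT (fun q => (running q)%:E).
  by apply/measurable_EFinP; exact: measurable_running.
have mt : measurable_fun setT (fun w => (terminal w)%:E).
  by apply/measurable_EFinP; exact: measurable_terminal.
have r0 q : (0 <= (running q)%:E)%E by rewrite lee_fin running_ge0.
rewrite fubini_tonelli2// -ge0_integralD//; last 3 first.
- by move=> w _; apply: integral_ge0.
- exact: (measurable_fun_fubini_tonelli_G (fun q => (running q)%:E)).
- by move=> w _; rewrite lee_fin terminal_ge0.
have TT : T \in `[t, T] by rewrite in_itv/= lexx tT.
apply: eq_integral => w _; congr (_ + _)%E; last first.
  by rewrite charge_stateE// /terminal; congr EFin; ring.
rewrite /fubini_G ge0_integral_leb_on//; last first.
  by apply: (measurableT_comp mr); exact: pair2_measurable.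
apply: eq_integral => s; rewrite inE/= => sT.
rewrite charge_stateE// /running controlE// exogE// coefE//; congr EFin; ring.
Qed.

(** The running cost dominates c1 u^2 and c1 > 0, so a finite cost bounds the second moment of the
    control. *)
Lemma control_L2 : (cost p P t i X B < +oo)%E -> L2 mu u.
Proof.
rewrite costE => fin; split; first exact: measurable_control.
apply: L1_of_lty; [apply: measurable_funX; exact: measurable_control|by move=> q; exact: sqr_ge0|].
have mr : measurable_fun setT (fun q => (running q)%:E).
  by apply/measurable_EFinP; exact: measurable_running.
have h : (\int[mu]_q (running q)%:E < +oo)%E.
  apply: le_lt_trans fin; apply: leeDl.
  by apply: integral_ge0 => w _; rewrite lee_fin terminal_ge0.
apply: (@le_lt_trans _ _ (\int[mu]_q ((c1 p)^-1%:E * (running q)%:E))%E).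
  apply: ge0_le_integral => //.
  - by move=> q _; rewrite lee_fin sqr_ge0.
  - by apply/measurable_EFinP; apply: measurable_funX; exact: measurable_control.
  - exact: emeasurable_funM.
  - move=> q _; rewrite -EFinM lee_fin ler_pdivlMl// /running.
    rewrite -addrA addrCA -[leLHS]addr0 lerD2l; apply: addr_ge0; first exact: sqr_ge0.
    by apply: mulr_ge0; [exact: ltW|exact: sqr_ge0].
rewrite ge0_integralZl//; last 2 first.
- by move=> q _; rewrite lee_fin running_ge0.
- by rewrite lee_fin invr_ge0 ltW.
by rewrite lte_mul_pinfty// lee_fin invr_ge0 ltW.
Qed.

Variables (P1 P2 P3 P4 P5 P6 : R -> R).
Hypothesis ric : riccati_system p m P1 P2 P3 P4 P5 P6.

Definition ansatz (s y j : R) : R :=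
  P1 s * (j - I_m p) ^+ 2 + P2 s * (j - I_m p) * (y - m) + P3 s * (y - m) ^+ 2
  + P4 s * (j - I_m p) + P5 s * (y - m) + P6 s.

Definition feedback_gap (q : R * Omega) : R :=
  u q - (kappa p * (exog q + (m - coef (dispatch p) q.1)) - kappa p * coef P1 q.1 * state u q
    - kappa p / 2 * coef P2 q.1 * exog q - kappa p / 2 * coef P4 q.1).

Let dclamp (f : R -> R) : (forall r, r \in `[0, T] -> derivable_within `[0, T] f r) ->
  {within `[0, T], continuous f}.
Proof. exact: derivable_within_continuous_itv. Qed.

Lemma coef_prim (f g : R -> R) :
  (forall r, r \in `[0, T] -> derivable_within `[0, T] f r) -> continuous g ->
  (forall r, r \in `[0, T] -> dot p f r = g r) ->
  forall s, s \in `[t, T] -> coef f s = coef f t + prim t T g s.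
Proof.
move=> df cg dfg s sT; move: (sT); rewrite in_itv/= => /andP[ts sT'].
have tin : t \in `[t, T] by rewrite in_itv/= lexx.
rewrite !coefE// primE//; last exact: continuous_measurable_fun.
by rewrite (Rintegral_deriv_within df dfg cg t0 ts sT'); ring.
Qed.

(** [verification_identity] on [t, T]: the terminal conditions turn its left side into the
    expectation of pen (J_T + e)^2, expanded in J_T, plus the running cost, and the values at [t]
    give the ansatz. *)
Lemma cost_feedback_gap : L2 mu u ->
  cost p P t i X B =
  (ansatz t x i + (1 + c1 p) * \int[mu]_q (feedback_gap q ^+ 2))%:E.
Proof.
move=> u2.
have [no1 no2 no3] := noise_martingale_isometry.
have [[[w1 w2 w3] w4 w5 w6] [f1 f2 f3] [f4 f5 f6] odes] := ric.
have cc f : (forall r, r \in `[0, T] -> derivable_within `[0, T] f r) -> continuous (coef f).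
  by move=> /dclamp; exact: continuous_comp_clamp.
have bc f : (forall r, r \in `[0, T] -> derivable_within `[0, T] f r) -> bounded_meas (coef f).
  by move=> h; apply: bm_coef; exact: dclamp.
have TT : T \in `[t, T] by rewrite in_itv/= lexx tT.
have tin : t \in `[t, T] by rewrite in_itv/= lexx.
have ino r s : t <= r -> r <= s -> s <= T -> r \in `[t, T].
  by move=> tr rs sT; rewrite in_itv/= tr (le_trans rs).
have oZ r s : t <= r -> r <= s -> s <= T -> L2 P (fun w => drift (r, w)) ->
    \int[P]_w (drift (r, w) * noise (s, w)) = \int[P]_w (drift (r, w) * noise (r, w)).
  move=> tr rs sT d2; apply: no1 => //; have rT := ino _ _ tr rs sT.
  have sF : sigma_algebra setT (F r) by case: hF => + _ _; apply; exact: sub_horizon.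
  rewrite (_ : (fun w => drift (r, w)) = (fun w => (- coef (alpha p) r) * (X r w - m))).
    apply: measurable_wrtM; [exact: sF|exact: measurable_wrt_cst|].
    apply: measurable_wrtB; [exact: sF| |exact: measurable_wrt_cst].
    by case: hX => + _ _ _; apply.
  by apply/funext => w; rewrite /drift exogE//= mulNr.
(* Adaptedness of the control is what makes it orthogonal to later increments of the noise. *)
have ou r s : t <= r -> r <= s -> s <= T -> L2 P (fun w => u (r, w)) ->
    \int[P]_w (u (r, w) * noise (s, w)) = \int[P]_w (u (r, w) * noise (r, w)).
  move=> tr rs sT d2; apply: no1 => //; have rT := ino _ _ tr rs sT.
  rewrite (_ : (fun w => u (r, w)) = B r); last by apply/funext => w; rewrite controlE.
  by case: hB => _ + _; apply.
have cal := continuous_comp_clamp T0 ca; rewrite -/(coef (alpha p)) in cal.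
have csg := continuous_comp_clamp T0 cs; rewrite -/(coef (sigma p)) in csg.
have cdp := continuous_comp_clamp T0 cM; rewrite -/(coef (dispatch p)) in cdp.
have cQ1 := cc _ w1; have cQ2 := cc _ w2; have cQ3 := cc _ w3.
have cQ4 := cc _ w4; have cQ5 := cc _ w5; have cQ6 := cc _ w6.
have cE f r : r \in `[0, T] -> coef f r = f r by move=> rT; rewrite /coef /= clamp_id.
have bs2 : bounded_meas (fun r => coef (sigma p) r ^+ 2).
  by have := bmM (bm_coef cs) (bm_coef cs); congr bounded_meas.
have bn : bounded_meas (fun r => m - coef (dispatch p) r).
  by apply: bmB; [exact: bm_cst|exact: bm_coef].
have L1r : L1 mu running.
  exact: (@L1_running_cost _ _ _ P t T _ _ _ (i - I_m p) bn bm_exog u2 (c1 p) (c2 p)).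
pose k := kappa p.
pose al := coef (alpha p); pose s2 r := coef (sigma p) r ^+ 2.
pose n r := m - coef (dispatch p) r.
have ode f g : (forall r, r \in `[0, T] -> derivable_within `[0, T] f r) -> continuous g ->
    (forall r, r \in `[0, T] -> dot p f r = g r) ->
    forall s, s \in `[t, T] -> coef f s = coef f t + prim t T g s by exact: coef_prim.
have e1 := ode P1 (fun r => k * coef P1 r ^+ 2 - c2 p) w1.
have e2 := ode P2 (fun r => al r * coef P2 r + k * coef P1 r * coef P2 r
  - 2 * k * coef P1 r) w2.
have e3 := ode P3 (fun r => (2 * al r + s2 r) * coef P3 r - (1 - k) - k * coef P2 r
  + k / 4 * coef P2 r ^+ 2) w3.
have e4 := ode P4 (fun r => k * coef P1 r * coef P4 r - 2 * k * n r * coef P1 r) w4.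
have e5 := ode P5 (fun r => al r * coef P5 r - 2 * (1 - k) * n r - k * coef P4 r
  - k * n r * coef P2 r + k / 2 * coef P2 r * coef P4 r
  - (s2 r * Xmax p - 2 * s2 r * m) * coef P3 r) w5.
have e6 := ode P6 (fun r => k / 4 * coef P4 r ^+ 2 - (1 - k) * n r ^+ 2 - k * n r * coef P4 r
  - s2 r * m * (Xmax p - m) * coef P3 r) w6.
have cal' : continuous al by [].
have csg' : continuous s2 by exact: continuous_funX.
have cn : continuous n.
  by rewrite /n; prove_continuous.
have odeP r : r \in `[0, T] ->
  [/\ dot p P1 r = k * coef P1 r ^+ 2 - c2 p,
      dot p P2 r = al r * coef P2 r + k * coef P1 r * coef P2 r - 2 * k * coef P1 r,
      dot p P3 r = (2 * al r + s2 r) * coef P3 r - (1 - k) - k * coef P2 r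
        + k / 4 * coef P2 r ^+ 2
    & [/\ dot p P4 r = k * coef P1 r * coef P4 r - 2 * k * n r * coef P1 r,
          dot p P5 r = al r * coef P5 r - 2 * (1 - k) * n r - k * coef P4 r
            - k * n r * coef P2 r + k / 2 * coef P2 r * coef P4 r
            - (s2 r * Xmax p - 2 * s2 r * m) * coef P3 r
        & dot p P6 r = k / 4 * coef P4 r ^+ 2 - (1 - k) * n r ^+ 2 - k * n r * coef P4 r
            - s2 r * m * (Xmax p - m) * coef P3 r]].
  move=> rT; have [[h1 h2 h3] h4 h5 h6] := odes r rT.
  rewrite /n /s2 /al !cE// -/k in h1 h2 h3 h4 h5 h6 *.
  by split; [| | |split]; apply: subr0_eq;
    [rewrite -[RHS]h1|rewrite -[RHS]h2|rewrite -[RHS]h3|rewrite -[RHS]h4|rewrite -[RHS]h5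
    |rewrite -[RHS]h6]; ring.
have [r1 r2 r3 [r4 r5 r6]] := continuous_riccati_rhs k (c2 p) (Xmax p) m cal' csg' cn
  cQ1 cQ2 cQ3 cQ4 cQ5.
have {}e1 := e1 r1 (fun r rT => let: And4 h _ _ _ := odeP r rT in h).
have {}e2 := e2 r2 (fun r rT => let: And4 _ h _ _ := odeP r rT in h).
have {}e3 := e3 r3 (fun r rT => let: And4 _ _ h _ := odeP r rT in h).
have {}e4 := e4 r4 (fun r rT => let: And4 _ _ _ (And3 h _ _) := odeP r rT in h).
have {}e5 := e5 r5 (fun r rT => let: And4 _ _ _ (And3 _ h _) := odeP r rT in h).
have {}e6 := e6 r6 (fun r rT => let: And4 _ _ _ (And3 _ _ h) := odeP r rT in h).
have := @verification_identity _ _ _ P t T tT al s2 n exog u (x - m) (i - I_m p) (Xmax p) m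
  (bm_coef ca) bs2 bn bm_exog u2 oZ ou no3 no2 (c1 p) (c2 p)
  (coef P1) (coef P2) (coef P3) (coef P4) (coef P5) (coef P6) c10
  (bc _ w1) (bc _ w2) (bc _ w3) (bc _ w4) (bc _ w5) (bc _ w6) e1 e2 e3 e4 e5 e6.
rewrite !(coefE _ TT) !(coefE _ tin) f1 f2 f3 f4 f5 f6 => id.
set e := I_m p - Itarget p in id.
have J2 : L2 P (fun w => state u (T, w)).
  apply: L2D; last exact: L2_prim_slice.
  by apply: bm_L2; [exact: mass_lty|exact: bm_cst].
have JJ : L1 P (fun w => state u (T, w) ^+ 2) by case: J2.
have J1 := L2_L1 (mass_lty P) J2.
have c1' : L1 P (fun=> pen p * e ^+ 2) by apply: bm_L1; [exact: mass_lty|exact: bm_cst].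
have L1t : L1 P terminal.
  apply: (@L1_ext _ _ _ _ (fun w => pen p * state u (T, w) ^+ 2 +
     ((2 * pen p * e) * state u (T, w) + pen p * e ^+ 2))).
    by move=> w; rewrite /terminal -/e; ring.
  by apply: L1D; [exact: L1Zl|apply: L1D => //; exact: L1Zl].
rewrite costE !IntE// -EFinD; congr EFin.
have -> : \int[P]_w terminal w = pen p * \int[P]_w (state u (T, w) ^+ 2) +
    (2 * pen p * e * \int[P]_w state u (T, w) + pen p * e ^+ 2).
  rewrite -[in X in _ + (_ + X)](mulr1 (pen p * e ^+ 2)).
  have P1' : fine (P setT) = 1 by rewrite probability_setT.
  rewrite -{2}P1' -(Int_cst P) -!IntZl// -!IntD//; try exact: L1Zl.
  - by apply: Int_ext => w; rewrite /terminal -/e; ring.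
  - by apply: L1D => //; exact: L1Zl.
rewrite /ansatz; rewrite -/(state u) in id.
transitivity (pen p * \int[P]_w (state u (T, w) ^+ 2) + 2 * pen p * e * \int[P]_w state u (T, w)
  + pen p * e ^+ 2 + \int[mu]_q running q); first by ring.
rewrite -[P2 t * _ * _]mulrA.
rewrite -[RHS]id; rewrite /running /state; ring.
Qed.

End control.
End control_cost.

(** * The closed-loop control *)

Section optimal_control.
Context {R : realType} (p : lq_data R) d (Omega : measurableType d).
Variables (P : probability Omega R) (F : R -> set (set Omega)) (W : R -> Omega -> R).
Variable m : R.
Hypotheses (hp : standing_assumptions p) (hF : filtration (horizon p) F).
Hypothesis hW : wiener P (horizon p) F W.
Hypothesis hm : forall r : R, r \in `[0, horizon p] -> level p r = m.
Local Notation T := (horizon p).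

Variables (t x i : R) (X : R -> Omega -> R).
Hypothesis ht : t \in `[0, T].
Hypothesis hX : jacobi_solution p P F W t x X.
Variables (P1 P2 P3 P4 P5 P6 : R -> R).
Hypothesis ric : riccati_system p m P1 P2 P3 P4 P5 P6.
Local Notation mu := (leb_on t T \x P)%E.
Local Notation k := (kappa p).
Local Notation cP := (coef p).
Let t0 := start_ge0 ht.
Let tT := start_le ht.
Let T0 := horizon_gt0 hp.

Let cont (f : R -> R) : (forall r, r \in `[0, T] -> derivable_within `[0, T] f r) ->
  continuous (cP f) /\ bounded_meas (cP f).
Proof.
move=> /derivable_within_continuous_itv h; split.
  by apply: continuous_comp_clamp => //; exact: ltW.
by apply: (bm_coef ht).
Qed.

Let cP1 : continuous (cP P1). Proof. by case: ric => -[[/cont[]]]. Qed.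
Let bP1 : bounded_meas (cP P1). Proof. by case: ric => -[[/cont[]]]. Qed.
Let bP2 : bounded_meas (cP P2). Proof. by case: ric => -[[_ /cont[]]]. Qed.
Let bP4 : bounded_meas (cP P4). Proof. by case: ric => -[_ /cont[]]. Qed.
Let bM : bounded_meas (cP (dispatch p)).
Proof. by case: hp => _ _ _ [_ _ _ h]; exact: (bm_coef ht). Qed.

(* Integrating factors of the closed-loop equation J' = inflow - kappa P1 J. *)
Let factors : exists E1 E2 : R -> R,
  [/\ bounded_meas (cP E1), bounded_meas (cP E2),
      (forall s, s \in `[t, T] -> cP E1 s * cP E2 s = 1)
    & (forall s, s \in `[t, T] ->
        cP E1 s = cP E1 t + prim t T (fun r => - (k * cP P1 r) * cP E1 r) s)].
Proof.
have cnP1 : continuous (fun r => k * cP P1 r).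
  by apply: continuous_funM => //; exact: continuous_fun_cst.
have [K dK] := antiderivative cnP1.
have dKT r : r \in `[0, T] -> is_derive r 1 K (k * cP P1 r).
  by move=> rT; apply: dK; move: rT; rewrite in_itv/= => /andP[r0 _]; lra.
pose E1 r := expR (- K r); pose E2 r := expR (K r).
have dE1 r : r \in `[0, T] -> is_derive r 1 E1 (- (k * cP P1 r) * E1 r).
  move=> /dKT h; rewrite /E1; apply: is_derive_eq; rewrite /GRing.scale/=; ring.
have dE2 r : r \in `[0, T] -> is_derive r 1 E2 ((k * cP P1 r) * E2 r).
  move=> /dKT h; rewrite /E2; apply: is_derive_eq; rewrite /GRing.scale/=; ring.
have w1 r : r \in `[0, T] -> derivable_within `[0, T] E1 r.
  by move=> rT; have [] := is_derive_within T0 rT (dE1 r rT).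
have w2 r : r \in `[0, T] -> derivable_within `[0, T] E2 r.
  by move=> rT; have [] := is_derive_within T0 rT (dE2 r rT).
have [c1 b1] := cont w1; have [c2 b2] := cont w2.
exists E1, E2; split => //.
- by move=> s sT; rewrite /coef /= /E1 /E2 -expRD addNr expR0.
- apply: (coef_prim ht w1).
    by apply: continuous_funM => //; exact: continuous_funN.
  move=> r rT; have [_] := is_derive_within T0 rT (dE1 r rT).
  by rewrite /dot => ->; rewrite [cP E1 r]/coef /= clamp_id.
Qed.

Let inflow (r y : R) : R := k * (y + (m - cP (dispatch p) r)) - k / 2 * cP P2 r * y
  - k / 2 * cP P4 r.

Let bm_inflow d' (T' : measurableType d') (y : R * T' -> R) : bounded_meas y ->
  bounded_meas (fun q => inflow q.1 (y q)).
Proof.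
move=> hy.
have hc c : bounded_meas (fun _ : R * T' => c) by exact: bm_cst.
have h1 : bounded_meas (fun q : R * T' => m - cP (dispatch p) q.1).
  by apply: bmB => //; exact: bm_fst.
have h2 : bounded_meas (fun q : R * T' => k / 2 * cP P2 q.1 * y q).
  by apply: bmM => //; apply: bmM => //; exact: bm_fst.
have h3 : bounded_meas (fun q : R * T' => k / 2 * cP P4 q.1) by apply: bmM => //; exact: bm_fst.
apply: bmB => //; apply: bmB => //; apply: bmM => //; exact: bmD.
Qed.

(** Variation of constants gives the closed-loop state as an explicit functional of the past of [X],
    and the control is read off from it. Since [X] and the coefficients are bounded, so are this
    state and control; the feedback gap vanishes on [t, T], so only the ansatz is left in the
    cost. *)
Lemma optimal_control : exists B : R -> Omega -> R,
  [/\ admissible p P F t B,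
      forall (s : R) (w : Omega), s \in `[t, T] ->
        B s w = feedback p m P1 P2 P4 s (X s w) (charge_state t i B s w)
    & cost p P t i X B = (ansatz p m P1 P2 P3 P4 P5 P6 t x i)%:E].
Proof.
have [E1 [E2 [bE1 bE2 E12 E1P]]] := factors.
pose Z := exog p m t X; pose j0 := i - I_m p.
have bZ : bounded_meas Z by exact: (bm_exog m hF ht hX).
pose h (q : R * Omega) := cP E2 q.1 * inflow q.1 (Z q).
have bh : bounded_meas h by apply: bmM; [exact: bm_fst|exact: bm_inflow].
(* [E1] and [E2] are inverse to each other, so the factor [cP E2 t] makes the value at time [t]
   equal to [j0]. *)
pose J (q : R * Omega) := cP E1 q.1 * (cP E2 t * j0 + prim t T (fun r => h (r, q.2)) q.1).
have bJ : bounded_meas J.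
  apply: bmM; first exact: bm_fst.
  by apply: bmD; [exact: bm_cst|exact: bm_prim_time].
pose b (q : R * Omega) := inflow q.1 (Z q) - k * cP P1 q.1 * J q.
have bb : bounded_meas b.
  apply: bmB; first exact: bm_inflow.
  by apply: bmM => //; apply: bmM; [exact: bm_cst|exact: bm_fst].
have bw w : bounded_meas (fun r => b (r, w)).
  by case: bb => mb [C bC]; split; [exact: slice_meas|exists C => r].
have tin : t \in `[t, T] by rewrite in_itv/= lexx.
(* The product rule for [E1] and the bracket shows that [J] is the charge state driven by [b]
   itself: the explicit formula solves the closed loop. *)
have JE s w : s \in `[t, T] -> J (s, w) = j0 + prim t T (fun r => b (r, w)) s.
  move=> sT; rewrite /J /= E1P//.
  have hw : bounded_meas (fun r => h (r, w)).
    by case: bh => mh [C hC]; split; [exact: slice_meas|exists C => r].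
  have h1 : L1 (leb_on t T) (fun r => h (r, w)) by apply: bm_L1 => //; exact: mass_lty.
  have bk : bounded_meas (fun r => - (k * cP P1 r) * cP E1 r).
    apply: bmM => //; have := bmM (bm_cst R (- k)) bP1.
    by congr bounded_meas; apply/funext => r; rewrite mulNr.
  have k1 : L1 (leb_on t T) (fun r => - (k * cP P1 r) * cP E1 r).
    by apply: bm_L1 => //; exact: mass_lty.
  rewrite prim_mulD// mulrA E12// mul1r; congr (_ + _); apply: prim_ext.
  - apply: measurable_funD; apply: measurable_funM.
    + exact: L1_meas k1.
    + by apply: measurable_funD => //; exact: prim_meas (L1_meas h1).
    + exact: L1_meas h1.
    + by apply: measurable_funD => //; exact: prim_meas (L1_meas k1).
  - by case: (bw w).
  - move=> r rT _; rewrite -E1P// /b /J /h /=.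
    have := E12 r rT => e12.
    transitivity (- (k * cP P1 r) * (cP E1 r * (cP E2 t * j0 +
      prim t T (fun r0 => cP E2 r0 * inflow r0 (Z (r0, w))) r)) +
      (cP E1 r * cP E2 r) * inflow r (Z (r, w))); first by ring.
    by rewrite e12; ring.
pose B s w := b (s, w).
have jB : jointly_measurable t T B.
  rewrite /jointly_measurable (_ : (fun q => B q.1 q.2) = b).
    by apply: measurable_funTS; case: bb.
  by apply/funext => -[].
have aB : adapted t T F B.
  move=> s sT; have sF : sigma_algebra setT (F s).
    by case: hF => + _ _; apply; exact: sub_horizon sT.
  have mZs : measurable_wrt (F s) (fun w => Z (s, w)).
    rewrite (_ : (fun w => _) = fun w => X s w - m).
      apply: measurable_wrtB; [exact: sF| |exact: measurable_wrt_cst].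
      by case: hX => + _ _ _; apply.
    by apply/funext => w; rewrite /Z exogE.
  have minf : measurable_wrt (F s) (fun w => inflow s (Z (s, w))).
    apply: measurable_wrtB; [exact: sF| |exact: measurable_wrt_cst].
    apply: measurable_wrtB; [exact: sF| |].
      apply: measurable_wrtM; [exact: sF|exact: measurable_wrt_cst|].
      by apply: measurable_wrtD; [exact: sF| |exact: measurable_wrt_cst].
    by apply: measurable_wrtM; [exact: sF|exact: measurable_wrt_cst|].
  rewrite /B /b /J /=; apply: measurable_wrtB; [exact: sF|exact: minf|].
  apply: measurable_wrtM; [exact: sF|exact: measurable_wrt_cst|].
  apply: measurable_wrtM; [exact: sF|exact: measurable_wrt_cst|].
  apply: measurable_wrtD; [exact: sF|exact: measurable_wrt_cst|].
  move: (sT); rewrite in_itv/= => /andP[ts sT'].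
  (* Adaptedness of the time integral: [X] is clamped to [t, s], so its values are all known at time
     [s], and joint measurability is proved anew with the sigma-algebra [F s] on the sample space.
     The primitive at [s] does not see the difference. *)
  pose Om := g_sigma_algebraType (F s).
  pose Zs (q : R * Om) : R := X (clamp t s q.1) q.2 - m.
  have cin r : clamp t s r \in `[t, s] by exact: clamp_in.
  have cin' r : clamp t s r \in `[t, T].
    by have := cin r; rewrite !in_itv/= => /andP[-> h2]; rewrite (le_trans h2).
  have mZ : measurable_fun setT Zs.
    apply: measurable_funB => //.
    apply: (@measurable_caratheodory _ _ Om (fun r w => X (clamp t s r) w)).
      move=> w; have cX : {within `[t, s], continuous (X ^~ w)}.
        apply: (@continuous_subspaceW _ _ `[t, s]%classic `[t, T]%classic).
          by move=> r /=; rewrite !in_itv/= => /andP[-> h2]; rewrite (le_trans h2).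
        by case: hX => _ + _ _; apply.
      exact: (continuous_comp_clamp ts cX).
    move=> r; apply/(measurable_wrtP sF).
    apply: (@measurable_wrt_sub _ _ _ (F (clamp t s r))).
      have := cin r; rewrite in_itv/= => /andP[h1 h2].
      by case: hF => _ _; apply => //; exact: le_trans h1.
    by case: hX => + _ _ _; apply.
  have bZs : bounded_meas Zs.
    split => //; exists (Xmax p + `|m|) => q; rewrite (le_trans (ler_normB _ _))// lerD2r.
    have : 0 <= X (clamp t s q.1) q.2 <= Xmax p by case: hX => _ _ + _; apply.
    by move=> /andP[h0 h1]; rewrite ger0_norm.
  pose hs (q : R * Om) := cP E2 q.1 * inflow q.1 (Zs q).
  have bhs : bounded_meas hs by apply: bmM; [exact: bm_fst|exact: bm_inflow].
  apply/(measurable_wrtP sF).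
  have mp := slice_meas2 s (@prim_jmeas _ _ Om t T hs bhs.1).
  apply: eq_measurable_fun mp => w _ /=; apply: prim_ext.
  - exact: (slice_meas w bhs.1).
  - exact: (slice_meas (w : Omega) bh.1).
  - move=> r rT rs; rewrite /hs /h /= /Zs /Z /exog /= clamp_id.
      by rewrite clamp_id.
    by move: rT; rewrite !in_itv/= rs andbT => /andP[].
have hB : admissible p P F t B.
  split => //; apply: aeW => w; have [mw [C bC]] := bw w.
  apply: measurable_bounded_integrable.
  - exact: measurable_itv.
  - exact: leb_itv_lty.
  - exact: measurable_funTS.
  - exists C; split; first exact: num_real.
    by move=> y Cy r _; apply: le_trans (bC r) (ltW Cy).
have csE s w : s \in `[t, T] -> charge_state t i B s w = I_m p + J (s, w).
  move=> sT; rewrite JE// /charge_state; move: sT; rewrite in_itv/= => /andP[ts sT].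
  by rewrite primE//; [rewrite /j0; ring|case: (bw w)].
exists B; split=> //.
  move=> s w sT; rewrite csE// /B /b /feedback /inflow /= !(coefE ht)// /Z exogE//; ring.
have u2 : L2 mu (control p t B).
  apply: bm_L2; first exact: strip_lty.
  split; first exact: (measurable_control hB).
  case: bb => _ [C bC]; exists C => q; rewrite /control patchE.
  by case: ifP => _; [case: q => ? ?; exact: bC | rewrite normr0 (le_trans _ (bC q))].
rewrite (cost_feedback_gap hp hF hW hm i ht hX hB ric u2); congr EFin.
suff -> : \int[mu]_q (feedback_gap p m t i X B P1 P2 P4 q ^+ 2) = 0 by rewrite mulr0 addr0.
have st s w : s \in `[t, T] -> state p t i (control p t B) (s, w) = J (s, w).
  move=> sT; have := charge_stateE i hB w sT; rewrite csE// => /addrI <-//.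
have g0 s w : s \in `[t, T] -> feedback_gap p m t i X B P1 P2 P4 (s, w) = 0.
  by move=> sT; rewrite /feedback_gap st// controlE// /B /b /inflow /= -/Z; ring.
have g1 : L1 mu (fun q => feedback_gap p m t i X B P1 P2 P4 q ^+ 2).
  have bn : bounded_meas (fun r => m - cP (dispatch p) r) by apply: bmB => //; exact: bm_cst.
  exact: (@L1_feedback_gap _ _ _ P t T _ _ _ j0 bn bZ u2 (c1 p) (cP P1) (cP P2) (cP P4)).
rewrite -Int_fubini1//; transitivity (\int[leb_on t T]_r (0 : R)); last first.
  by rewrite Int_cst mul0r.
apply: Int_ae => //; first exact: L1_meas (L1_fubini1 g1).
apply: leb_on_ae => r rT; transitivity (\int[P]_w (0 : R)); last by rewrite Int_cst mul0r.
by apply: Int_ext => w; rewrite g0// expr0n.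
Qed.

Lemma ansatz_le_cost B : admissible p P F t B ->
  ((ansatz p m P1 P2 P3 P4 P5 P6 t x i)%:E <= cost p P t i X B)%E.
Proof.
move=> hB; have [fin|] := ltP (cost p P t i X B) +oo%E; last exact: le_trans (leey _).
have u2 := control_L2 m hp hF ht hX hB fin.
rewrite (cost_feedback_gap hp hF hW hm i ht hX hB ric u2) lee_fin lerDl.
apply: mulr_ge0; last by apply: Rintegral_ge0 => q _; exact: sqr_ge0.
by case: hp => _ [h _ _] _ _; rewrite addr_ge0// ltW.
Qed.

End optimal_control.

(** * Value function and minimiser of the Hamiltonian *)

Lemma deriv_within_ansatz {R : realType} (p : lq_data R) (m : R)
    (P1 P2 P3 P4 P5 P6 : R -> R) (t x i : R) : Imin p < Imax p ->
  i \in `[Imin p, Imax p] ->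
  deriv_within `[Imin p, Imax p] (ansatz p m P1 P2 P3 P4 P5 P6 t x) i =
  2 * P1 t * (i - I_m p) + P2 t * (x - m) + P4 t.
Proof.
move=> II iI; have [//|_ ->//] := @is_derive_within _ _ _ i (ansatz p m P1 P2 P3 P4 P5 P6 t x)
  (2 * P1 t * (i - I_m p) + P2 t * (x - m) + P4 t) II iI.
by rewrite /ansatz; apply: is_derive_eq; rewrite /GRing.scale/=; ring.
Qed.

Theorem proposition1 (R : realType) (p : lq_data R)
  (d : measure_display) (Omega : measurableType d) (P : probability Omega R)
  (F : R -> set (set Omega)) (W : R -> Omega -> R)
  (X : R -> R -> R -> Omega -> R) (V : R -> R -> R -> R) (m : R)
  (hp : standing_assumptions p)
  (hF : filtration (horizon p) F)
  (hW : wiener P (horizon p) F W)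
  (hX : forall t x : R, t \in `[0, horizon p] -> x \in `[0, Xmax p] ->
     jacobi_solution p P F W t x (X t x))
  (hV : forall t x i : R, box p (t, x, i) ->
     value_function p P F X t x i = (V t x i)%:E)
  (hC12 : class_C12 p V)
  (hHJB : solves_HJB p V)
  (hm : forall t : R, t \in `[0, horizon p] -> level p t = m) :
  (exists P1 P2 P3 P4 P5 P6 : R -> R,
     riccati_system p m P1 P2 P3 P4 P5 P6) /\
  (forall P1 P2 P3 P4 P5 P6 : R -> R,
     riccati_system p m P1 P2 P3 P4 P5 P6 ->
     forall t x i : R, box p (t, x, i) ->
     [/\ V t x i = P1 t * (i - I_m p) ^+ 2 + P2 t * (i - I_m p) * (x - m)
           + P3 t * (x - m) ^+ 2 + P4 t * (i - I_m p) + P5 t * (x - m) + P6 t,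
         forall b : R, b != feedback p m P1 P2 P4 t x i ->
           hamiltonian p V t x i (feedback p m P1 P2 P4 t x i)
             < hamiltonian p V t x i b
       & exists B : R -> Omega -> R,
         [/\ admissible p P F t B,
             forall (s : R) (w : Omega), s \in `[t, horizon p] ->
               B s w = feedback p m P1 P2 P4 s (X t x s w)
                         (charge_state t i B s w)
           & cost p P t i (X t x) B = (V t x i)%:E]]).
Proof.
split; first exact: exists_riccati.
move=> P1 P2 P3 P4 P5 P6 ric.
have VE t x i : box p (t, x, i) -> V t x i = ansatz p m P1 P2 P3 P4 P5 P6 t x i.
  move=> hbox; have [/= ht hx _] := hbox.
  have [B [aB _ cB]] := optimal_control hp hF hW hm i ht (hX t x ht hx) ric.
  apply: EFin_inj; rewrite -hV//; apply/eqP; rewrite eq_le; apply/andP; split.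
    by rewrite -cB; apply: ereal_inf_lbound; exists B.
  apply: le_ereal_inf_tmp => _ [C aC <-].
  exact: (ansatz_le_cost hp hF hW hm i ht (hX t x ht hx) ric aC).
move=> t x i hbox; have [/= ht hx hi] := hbox.
have II : Imin p < Imax p by case: hp => -[].
have c10 : 0 < c1 p by case: hp => _ [].
split; first by rewrite VE.
  move=> b hb.
  have dV : d_I p V t x i = 2 * P1 t * (i - I_m p) + P2 t * (x - m) + P4 t.
    rewrite /d_I -(deriv_within_ansatz m P1 P2 P3 P4 P5 P6 t x II hi).
    by apply: eq_deriv_within => // j jI; exact: VE.
  (* The terms in [d_X V] and its derivative do not involve [b] and cancel in the difference, which
     is (1 + c1) (b - f)^2. *)
  rewrite -subr_gt0 /hamiltonian dV; set f := feedback p m P1 P2 P4 t x i.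
  have : 0 < (1 + c1 p) * (b - f) ^+ 2.
    by rewrite mulr_gt0 ?addr_gt0// exprn_even_gt0//= subr_eq0.
  congr (is_true (0 < _)).
  have k1 : (1 + c1 p) * kappa p = 1 by rewrite /kappa divff// gt_eqF// addr_gt0.
  (* The first-order condition for the minimiser: the right side is x - M minus half of [d_I V]. *)
  have fE : (1 + c1 p) * f = (x - dispatch p t) - P1 t * (i - I_m p)
      - P2 t / 2 * (x - m) - P4 t / 2.
    transitivity (((1 + c1 p) * kappa p) * ((x - dispatch p t) - P1 t * (i - I_m p)
      - P2 t / 2 * (x - m) - P4 t / 2)); first by rewrite /f /feedback; field.
    by rewrite k1 mul1r.
  have -> : (1 + c1 p) * (b - f) ^+ 2 =
      (1 + c1 p) * (b ^+ 2 - f ^+ 2) - 2 * ((1 + c1 p) * f) * (b - f) by ring.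
  by rewrite fE; field.
have [B [aB fB cB]] := optimal_control hp hF hW hm i ht (hX t x ht hx) ric.
by exists B; split=> //; rewrite VE.
Qed.
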